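(* Let $p\ge1$ and let $\mu,\nu$ be probability measures on $\mathbb R^d$ with $\mu\le_{cvx}\nu$ and $\nu$ compactly supported. For $N\ge1$ let $\Gamma_{2,N}$ be a quadratic optimal $N$-quantizer of $\mu$ with Borel nearest neighbour projection $\mathrm{Proj}_{\Gamma_{2,N}}$ and $\hat\mu^N=\mu\circ\mathrm{Proj}_{\Gamma_{2,N}}^{-1}$. For $K\ge d+1$ let $(\Gamma^{del}_{p,K},\mathrm{Proj}^{del}_{\Gamma^{del}_{p,K}})$ be an $L^p$-optimal dual $K$-quantization of $\nu$ and $\check\nu^K$ the law of $\mathrm{Proj}^{del}_{\Gamma^{del}_{p,K}}(Y,U)$ with $Y\sim\nu$ independent of $U\sim\mathcal U[0,1]$. For $y\in\mathbb R^d$ let $q_y$ be the law of $\mathrm{Proj}^{del}_{\Gamma^{del}_{p,K}}(y,U)$ if $y\in\mathrm{conv}(\Gamma^{del}_{p,K})$ and $q_y=\delta_y$ otherwise. For $\pi\in\mathcal M(\mu,\nu)$ define $$\bar\pi^{N,K}(d\hat x,d\check y)=\int_{(x,y)\in\mathbb R^d\times\mathbb R^d}\delta_{\mathrm{Proj}_{\Gamma_{2,N}}(x)}(d\hat x)\,\pi(dx,dy)\,q_y(d\check y).$$ Then $\bar\pi^{N,K}\in\mathcal M(\hat\mu^N,\check\nu^K)$ and $$W_p^p(\bar\pi^{N,K},\pi)\le\begin{cases}e_{2,N}^p(\mu)+d_{p,K}^p(\nu)&\text{if }p\le2,\\ C N^{-p/d}+2^{\frac{p-2}{2}}d_{p,K}^p(\nu)&\text{if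 }2<p<2+d,\end{cases}$$ for some constant $C<\infty$ not depending on $N,K$. Moreover, when $p\ge2$, $W_2^2(\bar\pi^{N,K},\pi)\le e_{2,N}^2(\mu)+d_{p,K}^2(\nu)$. Finally, for every $p\ge1$ and $K$, $\limsup_{N\to\infty}AW_p(\bar\pi^{N,K},\pi)\le d_{p,K}(\nu)$.
   Context: $\le_{cvx}$: convex order ($\int\varphi d\mu\le\int\varphi d\nu$ for all convex $\varphi$). Every coupling $\pi$ of $\mu,\nu$ disintegrates as $\pi(dx,dy)=\mu(dx)\pi_x(dy)$; $\mathcal M(\mu,\nu)$ is the set of couplings with $\int y\,\pi_x(dy)=x$ for $\mu$-a.e. $x$ (martingale couplings), and $M_p(\mu,\nu)=\inf_{\pi\in\mathcal M(\mu,\nu)}(\int|x-y|^p d\pi)^{1/p}$. $W_p$ is the $p$-Wasserstein distance (on $\mathbb R^d\times\mathbb R^d$ with the Euclidean norm on $\mathbb R^{2d}$ for couplings). Adapted Wasserstein distance between $\pi=\mu(dx)\pi_x(dy)$ and $\tilde\pi=\tilde\mu(d\tilde x)\tilde\pi_{\tilde x}(d\tilde y)$: $AW_p(\pi,\tilde\pi)=\inf_m\left(\int(|x-\tilde x|^p+W_p^p(\pi_x,\tilde\pi_{\tilde x}))m(dx,d\tilde x)\right)^{1/p}$, infimum over couplings $m$ of $\mu,\tilde\mu$. Primal: $e_{2,N}(\mu)^2=\inf_{|\Gamma|\le N}\int\mathrm{dist}(x,\Gamma)^2\mu(dx)$; a quadratic optimal $N$-quantizer attains it; a Borel nearest neighbour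 projection is a Borel map $\mathrm{Proj}_\Gamma:\mathbb R^d\to\Gamma$ with $|x-\mathrm{Proj}_\Gamma(x)|=\mathrm{dist}(x,\Gamma)$. Dual: for a finite $\Gamma$, a splitting operator is a measurable map $\mathrm{Proj}^{del}_\Gamma:\mathrm{conv}(\Gamma)\times[0,1]\to\Gamma$ with $\int_0^1\mathrm{Proj}^{del}_\Gamma(y,u)du=y$ for all $y\in\mathrm{conv}(\Gamma)$. The dual quantization error is $d_{p,K}(\nu)=\inf\{M_p(\nu,\eta):\nu\le_{cvx}\eta,\ \eta\text{ supported on at most }K\text{ points}\}$. An $L^p$-optimal dual $K$-quantization of $\nu$ is a set $\Gamma$ of at most $K$ points with $\mathrm{supp}(\nu)\subset\mathrm{conv}(\Gamma)$ together with a splitting operator such that $d_{p,K}(\nu)=\left(\mathbb E|Y-\mathrm{Proj}^{del}_\Gamma(Y,U)|^p\right)^{1/p}$ for $Y\sim\nu$ independent of $U\sim\mathcal U[0,1]$ (such exists for $K\ge d+1$). *)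

(* Defs.v *)
From HB Require Import structures.
From mathcomp Require Import all_boot all_order all_algebra.
From mathcomp Require Import all_classical all_reals all_analysis.
From mathcomp Require Import measurable_realfun lebesgue_stieltjes_measure.
Import Order.TTheory GRing.Theory Num.Theory.
Import numFieldTopology.Exports numFieldNormedType.Exports.

Set Implicit Arguments.
Unset Strict Implicit.
Unset Printing Implicit Defensive.

Local Open Scope classical_set_scope.
Local Open Scope ring_scope.

Section borel_rV.
Variables (R : realType) (n : nat).

Lemma rV_borelC (A : set 'rV[R]_n) :
  <<s (@open 'rV[R]_n) >> A -> <<s (@open 'rV[R]_n) >> (~` A).
Proof. by move=> sGA; rewrite -setTD; exact: sigma_algebraCD. Qed.

HB.instance Definition _ := @isMeasurable.Build default_measure_display
  'rV[R]_n <<s (@open 'rV[R]_n) >>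
  (@sigma_algebra0 _ setT (@open 'rV[R]_n)) rV_borelC
  (@sigma_algebra_bigcup _ setT (@open 'rV[R]_n)).
End borel_rV.

Section generic.
Context {R : realType}.

Definition is_coupling {d1 d2} {T1 : measurableType d1} {T2 : measurableType d2}
  (a : probability T1 R) (b : probability T2 R) (g : probability (T1 * T2)%type R) : Prop :=
  (forall A, measurable A -> g (A `*` setT) = a A) /\
  (forall B, measurable B -> g (setT `*` B) = b B).

Definition Wp {dT} {T : measurableType dT} (dist : T -> T -> R) (p : R)
  (a b : probability T R) : \bar R :=
  ((ereal_inf [set (\int[g]_z ((dist z.1 z.2) `^ p)%:E)%E
             | g in [set g : probability (T * T)%type R | is_coupling a b g]])
  `^ (p^-1)%R)%E.

Definition disintegrates {dT} {T : measurableType dT} (mu : probability T R)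
  (k : T -> probability T R) (pi : probability (T * T)%type R) : Prop :=
  (forall B, measurable B -> measurable_fun [set: T] (k ^~ B)) /\
  (forall A B, measurable A -> measurable B ->
     pi (A `*` B) = (\int[mu]_(x in A) k x B)%E).

End generic.

Section Rd.
Context {R : realType} {d : nat}.
Local Notation V := 'rV[R]_d.

Definition enorm (x : V) : R := Num.sqrt (\sum_(i < d) (x ord0 i) ^+ 2).

Definition edist (x y : V) : R := enorm (x - y).
Definition edist2 (z w : V * V) : R :=
  Num.sqrt (enorm (z.1 - w.1) ^+ 2 + enorm (z.2 - w.2) ^+ 2).

Definition Wp1 (p : R) (a b : probability V R) := Wp edist p a b.
Definition Wp2 (p : R) (a b : probability (V * V)%type R) := Wp edist2 p a b.

Definition convex_fun (phi : V -> R) : Prop :=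
  forall (x y : V) (t : R), 0 <= t <= 1 ->
    phi (t *: x + (1 - t) *: y) <= t * phi x + (1 - t) * phi y.

Definition cvx_le (mu nu : probability V R) : Prop :=
  forall phi : V -> R, convex_fun phi ->
    (\int[mu]_x (phi x)%:E <= \int[nu]_x (phi x)%:E)%E.

Definition supp (mu : probability V R) : set V :=
  [set x | forall e : R, 0 < e -> (0 < mu (ball x e))%E].

Definition barycenter_is (m : probability V R) (x : V) : Prop :=
  forall i : 'I_d, m.-integrable setT (fun y : V => (y ord0 i)%:E) /\
    (\int[m]_y (y ord0 i)%:E)%E = (x ord0 i)%:E.

Definition mart_coupling (mu nu : probability V R) (pi : probability (V * V)%type R) : Prop :=
  is_coupling mu nu pi /\
  exists k : V -> probability V R,
    disintegrates mu k pi /\ {ae mu, forall x, barycenter_is (k x) x}.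

Definition Mp (p : R) (mu nu : probability V R) : \bar R :=
  ((ereal_inf [set (\int[pi]_z ((edist z.1 z.2) `^ p)%:E)%E
             | pi in [set pi | mart_coupling mu nu pi]]) `^ (p^-1)%R)%E.

Definition dpK (p : R) (K : nat) (nu : probability V R) : \bar R :=
  ereal_inf [set Mp p nu eta | eta in
    [set eta : probability V R | cvx_le nu eta /\
       exists s : seq V, (size s <= K)%N /\ supp eta `<=` [set` s]]].

Definition distS (s : seq V) (x : V) : \bar R :=
  \big[Order.min/+oo%E]_(g <- s) (edist x g)%:E.

Definition quant_err2 (s : seq V) (mu : probability V R) : \bar R :=
  (\int[mu]_x (distS s x `^ 2))%E.

Definition e2N2 (N : nat) (mu : probability V R) : \bar R :=
  ereal_inf [set quant_err2 s mu | s in [set s : seq V | (size s <= N)%N]].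

Definition e2N (N : nat) (mu : probability V R) : \bar R := (e2N2 N mu `^ (2^-1)%R)%E.

Definition opt_quantizer (N : nat) (mu : probability V R) (s : seq V) : Prop :=
  (size s <= N)%N /\ quant_err2 s mu = e2N2 N mu.

Definition nn_proj (s : seq V) (proj : V -> V) : Prop :=
  measurable_fun setT proj /\
  forall x, proj x \in s /\ (edist x (proj x))%:E = distS s x.

Definition conv (s : seq V) : set V :=
  [set y | exists w : 'I_(size s) -> R, (forall i, 0 <= w i) /\
     \sum_i w i = 1 /\ y = \sum_i w i *: s`_i].

Definition unit_itv : set R := `[0, 1]%classic.

(* splitting operator conv(s) x [0,1] -> s (given as a total function whose
   restriction to conv(s) x [0,1] is the operator) *)
Definition splitting (s : seq V) (P : V -> R -> V) : Prop :=
  measurable_fun (conv s `*` unit_itv) (fun z : V * R => P z.1 z.2) /\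
  (forall y u, conv s y -> unit_itv u -> P y u \in s) /\
  (forall y, conv s y -> forall i : 'I_d,
     lebesgue_measure.-integrable unit_itv (fun u => (P y u ord0 i)%:E) /\
     (\int[lebesgue_measure]_(u in unit_itv) (P y u ord0 i)%:E)%E = (y ord0 i)%:E).

Definition opt_dual_quant (p : R) (K : nat) (nu : probability V R)
  (s : seq V) (P : V -> R -> V) : Prop :=
  (size s <= K)%N /\ supp nu `<=` conv s /\ splitting s P /\
  dpK p K nu =
    ((\int[nu]_y \int[lebesgue_measure]_(u in unit_itv)
        ((edist y (P y u)) `^ p)%:E) `^ (p^-1)%R)%E.

Definition qker (s : seq V) (P : V -> R -> V) (y : V) (B : set V) : \bar R :=
  if `[< conv s y >] then lebesgue_measure [set u | unit_itv u /\ B (P y u)]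
  else \d_y B.

Definition is_image_measure (mu : probability V R) (proj : V -> V)
  (muhat : probability V R) : Prop :=
  forall B, measurable B -> muhat B = mu (proj @^-1` B).

Definition is_split_law (nu : probability V R) (P : V -> R -> V)
  (nucheck : probability V R) : Prop :=
  forall B, measurable B ->
    nucheck B = (\int[nu]_y lebesgue_measure [set u | unit_itv u /\ B (P y u)])%E.

Definition is_pibar (pi : probability (V * V)%type R) (proj : V -> V)
  (s : seq V) (P : V -> R -> V) (pibar : probability (V * V)%type R) : Prop :=
  forall C, measurable C ->
    pibar C = (\int[pi]_z qker s P z.2 [set yc | C (proj z.1, yc)])%E.

(* adapted Wasserstein distance AW_p: the infimum also ranges over the
   versions of the disintegrations (the value does not depend on them) *)
Definition AWp (p : R) (pi1 pi2 : probability (V * V)%type R) : \bar R :=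
  ((ereal_inf [set v | exists (mu1 mu2 : probability V R)
       (k1 k2 : V -> probability V R) (m : probability (V * V)%type R),
       disintegrates mu1 k1 pi1 /\ disintegrates mu2 k2 pi2 /\
       is_coupling mu1 mu2 m /\
       v = (\int[m]_z (((edist z.1 z.2) `^ p)%:E + Wp1 p (k1 z.1) (k2 z.2) `^ p))%E])
  `^ (p^-1)%R)%E.

End Rd.

(* Main.v *)
Require Import Defs.
From HB Require Import structures.
From mathcomp Require Import all_boot all_order all_algebra.
From mathcomp Require Import all_classical all_reals all_analysis.
From mathcomp Require Import measurable_realfun lebesgue_stieltjes_measure.
From mathcomp Require Import giry ring lra zify.
Import Order.TTheory GRing.Theory Num.Theory.
Import numFieldTopology.Exports numFieldNormedType.Exports.
Import HBNNSimple.

Set Implicit Arguments.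
Unset Strict Implicit.
Unset Printing Implicit Defensive.

Local Open Scope classical_set_scope.
Local Open Scope ring_scope.
Local Notation edist := Defs.edist.
Local Notation conv := Defs.conv.

(* Disintegrating the dual splitting operator gives measurable weights w_j(y), a
   partition of unity with barycentre y, and pibar becomes the mixture over pi of
   the points (Proj x, g_j) with weights w_j(y). Coupling these points with
   (x, y) itself bounds W_p through the two quantization errors; for
   2 < p < 2 + d the primal error is measured in the stronger L^p norm, where
   optimality of the quantizer is used through the decrease of the distortion:
   a point y at distance D from the quantizer would, if added, gain about
   D^2 mu(B(y, D/4)), while deleting a point costs only O(N^(-1-2/d)), so that
   mu(D > t) has a weak-type tail t^(-2-d).
   Stationarity (each point is the mean of its cell) makes pibar a martingale.
   For AW_p the law of (Proj x, x) is used as outer coupling: the kernel of pibar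
   is the conditional expectation, given Proj x, of the weights averaged against
   pi_x, and it converges in L^1 because the quantization error vanishes. *)

(** * Probabilities, mixtures and disintegrations *)

(** The splitting operator takes finitely many values, so every kernel of the discretized coupling
    is a vector of weights on the same points g_j. Adapted convergence, for which weak convergence
    of the couplings would not be enough, thereby reduces to L^1 convergence of finitely many scalar
    conditional expectations. The map x -> pi_x is only measurable, so the averaged weights are
    first approximated by Lipschitz functions; the smallness then required of the quantization error
    is uniform over all quantizers. The limit bound carries no constant because the coupling of
    kernels composes two moves, from y to g_i and from g_i to g_j, and the mass of the second move
    tends to zero in mean; no triangle inequality for W_p enters. The range p < 2 + d: a ball around
    a point at distance t has mass at most of order t^(-2) N^(-1-2/d), and of order t^(-d) such
    balls cover the box. Summing t^p against this product over dyadic t gives a geometric series of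
    ratio 2^(p-2-d). *)

Section measure_lemmas.
Context {R : realType}.
Local Open Scope ereal_scope.

Lemma integral_indicE d (T : measurableType d) (m : {measure set T -> \bar R})
    (A : set T) : measurable A -> \int[m]_x (\1_A x)%:E = m A.
Proof. by move=> mA; rewrite integral_indic// setIT. Qed.

(** No measurability of [f] or [g] is asked for: a nonnegative integral is a supremum over simple
    functions below the integrand, and cutting such a function to zero on [N] keeps its integral and
    puts it below [g]. This admits integrands such as [qker] and [Wp1], whose measurability is never
    established. *)
Lemma le_integral_off_null d (T : measurableType d)
    (m : {measure set T -> \bar R}) (N : set T) (f g : T -> \bar R) :
  measurable N -> m N = 0 -> (forall x, 0 <= f x) -> (forall x, 0 <= g x) ->
  (forall x, ~ N x -> f x <= g x) ->
  \int[m]_x f x <= \int[m]_x g x.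
Proof.
move=> mN N0 f0 g0 fg; rewrite !ge0_integralTE//.
apply/ge_ereal_sup => _ [h hf <-].
have -> : sintegral m h = sintegral m (proj_nnsfun h (measurableC mN)).
  rewrite -!integralT_nnsfun; apply: ge0_ae_eq_integral => //.
  - by apply/measurable_EFinP.
  - by apply/measurable_EFinP.
  - by move=> x _; rewrite lee_fin.
  - by move=> x _; rewrite lee_fin.
  - exists N; split => // x /= /not_implyP[_ hx].
    apply: contrapT => Nx; apply: hx.
    by rewrite /= mindicE mem_set ?mulr1.
apply: ereal_sup_ubound; exists (proj_nnsfun h (measurableC mN)) => // x.
have [Nx|Nx] := pselect (N x).
  by rewrite /= mindicE memNset ?mulr0//; exact/not_notP.
by rewrite /= mindicE mem_set ?mulr1//; exact: le_trans (hf x) (fg x Nx).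
Qed.

Lemma eq_integral_off_null d (T : measurableType d)
    (m : {measure set T -> \bar R}) (N : set T) (f g : T -> \bar R) :
  measurable N -> m N = 0 -> (forall x, 0 <= f x) -> (forall x, 0 <= g x) ->
  (forall x, ~ N x -> f x = g x) ->
  \int[m]_x f x = \int[m]_x g x.
Proof.
move=> mN N0 f0 g0 fg; apply/eqP; rewrite eq_le; apply/andP; split;
  by apply: (le_integral_off_null mN N0) => // x Nx; rewrite fg.
Qed.

Lemma le_integral_nonneg d (T : measurableType d)
    (m : {measure set T -> \bar R}) (f g : T -> \bar R) :
  (forall x, 0 <= f x) -> (forall x, f x <= g x) ->
  \int[m]_x f x <= \int[m]_x g x.
Proof.
move=> f0 fg; apply: (@le_integral_off_null _ _ _ set0) => // x.
exact: le_trans (f0 x) (fg x).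
Qed.

Lemma exists_probability d (T : measurableType d) (m : {measure set T -> \bar R}) :
  m setT = 1 -> exists P : probability T R, forall A, P A = m A.
Proof.
move=> m1; exists (mnormalize m point) => A.
by rewrite /= /mnormalize m1 onee_eq0/= invr1 mule1.
Qed.

Lemma exists_finite_support d (T : measurableType d) n (w : nat -> R)
    (x : nat -> T) : (forall j, 0 <= w j)%R -> (\sum_(j < n) w j = 1)%R ->
  exists P : giry T R, forall f : T -> \bar R, measurable_fun setT f ->
    (forall y, 0 <= f y) ->
    \int[P]_y f y = \sum_(j < n) (w j)%:E * f (x j).
Proof.
move=> w0 w1.
pose m j : {measure set T -> \bar R} := mscale (NngNum (w0 j)) (\d_(x j)).
have mE f : measurable_fun setT f -> (forall y, 0 <= f y) ->
    \int[msum m n]_y f y = \sum_(j < n) (w j)%:E * f (x j).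
  move=> mf f0; rewrite ge0_integral_measure_sum//; apply: eq_bigr => j _.
  by rewrite ge0_integral_mscale//= integral_dirac// diracT mul1e.
have [|P PE] := @exists_probability _ _ (msum m n).
  rewrite -integral_indicE// mE//.
    under eq_bigr do rewrite indicT mule1.
    by rewrite sumEFin w1.
  exact/measurable_EFinP.
exists (P : giry T R) => f mf f0; rewrite -mE//; apply: eq_measure_integral => A mA _.
exact: PE.
Qed.

(** The common device for building measures, a Giry bind of finitely supported kernels. Couplings,
    image measures and kernels with finite support all come from it by a choice of weights [W] and
    destinations [phi]. *)
Lemma exists_mixture d1 d2 (T1 : measurableType d1) (T2 : measurableType d2)
    (m : probability T1 R) n (W : nat -> T1 -> R) (phi : nat -> T1 -> T2) :
  (forall j, measurable_fun setT (W j)) -> (forall j t, 0 <= W j t)%R ->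
  (forall t, \sum_(j < n) W j t = 1)%R ->
  (forall j, measurable_fun setT (phi j)) ->
  exists M : probability T2 R, forall f : T2 -> R, measurable_fun setT f ->
    (forall y, 0 <= f y)%R ->
    \int[M]_y (f y)%:E = \int[m]_t (\sum_(j < n) W j t * f (phi j t))%:E.
Proof.
move=> mW W0 W1 mphi.
have /choice[k kE] t := exists_finite_support (fun j => phi j t)
  (fun j => W0 j t) (W1 t).
have kB t B : measurable B ->
    k t B = (\sum_(j < n) W j t * \1_B (phi j t))%:E.
  move=> mB; rewrite -integral_indicE// kE//; last first.
    exact/measurable_EFinP.
  by rewrite -sumEFin; apply: eq_bigr => j _; rewrite EFinM.
have mk : measurable_fun setT k.
  apply: measurable_giry_codensity => // B mB.
  under eq_fun do rewrite kB//.
  apply/measurable_EFinP; apply: measurable_sum => j; apply: measurable_funM => //.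
  by apply: measurableT_comp => //; exact: mphi.
have mE f : measurable_fun setT f -> (forall y, 0 <= f y) ->
    \int[giry_bind m mk]_y f y = \int[m]_t (\sum_(j < n) (W j t)%:E * f (phi j t)).
  move=> mf f0; rewrite [LHS](giry_int_bind _ mk mf f0).
  by apply: eq_integral => t _; rewrite /giry_int kE.
have [|M ME] := @exists_probability _ _ (giry_bind m mk).
  rewrite -integral_indicE// mE//; last exact/measurable_EFinP.
  rewrite (eq_integral (cst 1)) ?integral_cst//=.
    by rewrite mul1e; exact: probability_setT.
  move=> t _.
  under eq_bigr do rewrite indicT mule1.
  by rewrite sumEFin W1.
exists M => f mf f0; transitivity (\int[giry_bind m mk]_y (f y)%:E).
  by apply: eq_measure_integral => A mA _; exact: ME.
rewrite mE//; last exact/measurable_EFinP.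
by apply: eq_integral => t _; rewrite -sumEFin; under eq_bigr do rewrite -EFinM.
Qed.

Lemma eq_probability_prod d1 d2 (T1 : measurableType d1) (T2 : measurableType d2)
    (m1 m2 : {measure set (T1 * T2) -> \bar R}) :
  m1 setT < +oo ->
  (forall A B, measurable A -> measurable B -> m1 (A `*` B) = m2 (A `*` B)) ->
  forall C, measurable C -> m1 C = m2 C.
Proof.
move=> m1T mAB C mC.
apply: (measure_unique [set A `*` B | A in @measurable _ T1 & B in @measurable _ T2]
  (fun=> setT)) => //.
- by rewrite measurable_prod_measurableType.
- move=> _ _ [X1 mX1 [X2 mX2 <-]] [Y1 mY1 [Y2 mY2 <-]].
  exists (X1 `&` Y1); first exact: measurableI.
  by exists (X2 `&` Y2); [exact: measurableI|rewrite setXI].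
- by move=> _; exists setT => //; exists setT => //; rewrite setXTT.
- by rewrite bigcup_const.
- by move=> _ [A mA [B mB <-]]; exact: mAB.
Qed.

Section disintegration.
Context d (T : measurableType d) (mu : probability T R)
  (k : T -> probability T R) (pi : probability (T * T)%type R)
  (kpi : disintegrates mu k pi).

(** The law of (x, y) with y drawn from [k x]; its bind with [mu] is the measure rebuilt from the
    disintegration. *)
Let kk x : giry (T * T)%type R := giry_prod (giry_ret x : giry T R, k x : giry T R).

Let kkE (f : T * T -> \bar R) x : measurable_fun setT f -> (forall z, 0 <= f z) ->
  \int[kk x]_z f z = \int[k x]_y f (x, y).
Proof.
move=> mf f0; rewrite [LHS](giry_int_prod1 _ _ mf f0) /giry_int integral_dirac//.
  by rewrite diracT mul1e.
by apply: (measurable_fun_fubini_tonelli_F f).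
Qed.

Let mkk : measurable_fun setT kk.
Proof.
apply: measurableT_comp; first exact: measurable_giry_prod.
apply/measurable_fun_pair => /=; first exact: measurable_giry_ret.
by apply: measurable_giry_codensity => //; case: kpi.
Qed.

Lemma disintegrates_measurable (f : T * T -> \bar R) :
  measurable_fun setT f -> (forall z, 0 <= f z) ->
  measurable_fun setT (fun x => \int[k x]_y f (x, y)).
Proof.
move=> mf f0; apply: (eq_measurable_fun (giry_int ^~ f \o kk)).
  by move=> x _; rewrite /= /giry_int kkE.
by apply: measurableT_comp => //; exact: measurable_giry_int.
Qed.

Lemma disintegrates_integral (f : T * T -> \bar R) :
  measurable_fun setT f -> (forall z, 0 <= f z) ->
  \int[pi]_z f z = \int[mu]_x \int[k x]_y f (x, y).
Proof.
move=> mf f0; transitivity (\int[giry_bind mu mkk]_z f z).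
  apply: eq_measure_integral => C mC _.
  apply: eq_probability_prod => //.
    by apply: (@le_lt_trans _ _ 1); [exact: probability_le1|exact: ltry].
  move=> A B mA mB; apply: etrans (proj2 kpi A B mA mB) _.
  rewrite -[RHS]integral_indicE//; last exact: measurableX.
  rewrite [RHS](giry_int_bind _ mkk)//; last first.
    by apply/measurable_EFinP; apply: measurable_indic; exact: measurableX.
  rewrite integral_mkcond; apply: eq_integral => x _.
  rewrite /giry_int kkE//; last first.
    by apply/measurable_EFinP; apply: measurable_indic; exact: measurableX.
  rewrite patchE; case: ifPn => Ax.
    rewrite -integral_indicE//; apply: eq_integral => y _.
    by rewrite !indicE in_setX /= Ax.
  rewrite integral0_eq// => y _.
  by rewrite indicE in_setX /= (negbTE Ax).
rewrite [LHS](giry_int_bind _ mkk mf f0).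
by apply: eq_integral => x _; rewrite /giry_int kkE.
Qed.

End disintegration.
Lemma integral_cst_prob d (T : measurableType d) (m : probability T R) (c : R) :
  \int[m]_x c%:E = c%:E.
Proof.
rewrite integral_cst// -[RHS]mule1; congr (_ * _); exact: probability_setT.
Qed.

Lemma measure_bigsetU_le d (T : measurableType d) (m : {measure set T -> \bar R})
    (I : Type) (r : seq I) (F : I -> set T) : (forall i, measurable (F i)) ->
  m (\big[setU/set0]_(i <- r) F i) <= \sum_(i <- r) m (F i).
Proof.
move=> mF; elim: r => [|i r IH]; first by rewrite !big_nil measure0.
rewrite !big_cons; apply: le_trans (measureU2 _ _ _) _ => //.
  exact: bigsetU_measurable.
by rewrite leeD2l.
Qed.

(** Young's inequality for x^r and 1 with the conjugate exponents 1/r and 1/(1-r): the concave power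
    lies below its tangent at 1. *)
Lemma powR_young (r x : R) : (0 < r < 1 -> 0 <= x -> x `^ r <= r * x + (1 - r))%R.
Proof.
move=> /andP[r0 r1] x0.
have r1' : (0 < 1 - r)%R by rewrite subr_gt0.
have := @conjugate_powR R (x `^ r)%R 1%R r^-1%R (1 - r)^-1%R (powR_ge0 _ _) ler01.
rewrite !invr_gt0 !invrK => /(_ r0 r1'); rewrite addrC subrK => /(_ erefl).
by rewrite mulr1 powR1 mul1r -powRrM mulfV ?gt_eqF// powRr1// mulrC.
Qed.

(** Jensen's inequality through the tangent at the mean. The tangent needs a positive finite mean,
    so a null integral ([f] vanishes almost everywhere) and an infinite one are handled apart. *)
Lemma integral_powR_le d (T : measurableType d) (m : probability T R)
    (f : T -> R) (r : R) : measurable_fun setT f -> (forall x, 0 <= f x)%R ->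
  (0 < r <= 1)%R -> \int[m]_x (f x `^ r)%:E <= (\int[m]_x (f x)%:E) `^ r.
Proof.
move=> mf f0 /andP[r0]; rewrite le_eqVlt => /predU1P[->|r1].
  rewrite poweRe1; last by apply: integral_ge0 => x _; rewrite lee_fin.
  by under eq_integral do rewrite powRr1//.
have mfr : measurable_fun setT (fun x => f x `^ r)%R.
  exact: (measurableT_comp (measurable_powR r) mf).
have If0 : 0 <= \int[m]_x (f x)%:E by apply: integral_ge0 => x _; rewrite lee_fin.
case E : (\int[m]_x (f x)%:E) If0 => [c| |] //; last first.
  by move=> _; rewrite poweRyr ?gt_eqF// leey.
rewrite lee_fin le_eqVlt => /predU1P[c0|c0].
  rewrite -c0 poweR0r ?gt_eqF// le_eqVlt; apply/orP; left; apply/eqP.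
  rewrite (ge0_ae_eq_integral _ _ (g := cst 0)) ?integral0//.
  - exact/measurable_EFinP.
  - by move=> x _; rewrite lee_fin powR_ge0.
  - have : ae_eq m setT (EFin \o f) (cst 0).
      apply/ae_eq_integral_abs => //; first exact/measurable_EFinP.
      transitivity (\int[m]_x (f x)%:E); last by rewrite E -c0.
      apply: eq_integral => x _ /=.
      by rewrite ger0_norm.
    apply: filterS => x /= /(_ Logic.I)[->] _.
    by rewrite powR0// gt_eqF.
have -> : (c%:E `^ r = (c `^ r)%:E) by [].
have key x : (f x `^ r <= c `^ r * (r / c) * f x + c `^ r * (1 - r))%R.
  have := powR_young (r := r) (x := f x / c); rewrite r0 r1 => /(_ erefl).
  have fc : (0 <= f x / c)%R by rewrite divr_ge0// ltW.
  move=> /(_ fc) h.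
  have -> : f x = (c * (f x / c))%R by rewrite mulrCA mulfV ?gt_eqF// mulr1.
  rewrite powRM//; last exact: ltW.
  have -> : (c `^ r * (r / c) * (c * (f x / c)) + c `^ r * (1 - r) =
    c `^ r * (r * (f x / c) + (1 - r)))%R.
    by field; rewrite gt_eqF.
  by rewrite ler_wpM2l ?powR_ge0.
have cr0 : (0 <= c `^ r * (r / c))%R by rewrite mulr_ge0 ?powR_ge0 ?divr_ge0 ?ltW.
have cr1 : (0 <= c `^ r * (1 - r))%R by rewrite mulr_ge0 ?powR_ge0// subr_ge0 ltW.
apply: le_trans (le_integral_nonneg m (g := fun x =>
  ((c `^ r * (r / c)) * f x)%:E + (c `^ r * (1 - r))%:E) _ _) _.
- by move=> x; rewrite lee_fin powR_ge0.
- by move=> x; rewrite -EFinD lee_fin.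
rewrite ge0_integralD//; last 2 first.
- by move=> x _; rewrite lee_fin mulr_ge0.
- by apply/measurable_EFinP; apply: measurable_funM.
under eq_integral do rewrite EFinM.
rewrite ge0_integralZl//; last 2 first.
- exact/measurable_EFinP.
- by move=> x _; rewrite lee_fin.
rewrite E (integral_cst_prob m) -EFinM -EFinD lee_fin.
rewrite le_eqVlt; apply/orP; left; apply/eqP; field.
by rewrite gt_eqF.
Qed.

Lemma integral_scale_indic d (T : measurableType d) (m : probability T R)
    (A : set T) (c : R) : measurable A ->
  \int[m]_x (c * \1_A x)%:E = (c * fine (m A))%:E.
Proof.
move=> mA; under eq_integral do rewrite EFinM.
rewrite integralZl//; last exact: integrable_indic.
by rewrite integral_indicE// EFinM fineK// fin_num_measure.
Qed.

Lemma integrable_off_null d (T : measurableType d) (m : probability T R)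
    (N : set T) (f : T -> R) (B : R) :
  measurable N -> m N = 0 -> measurable_fun setT f ->
  (forall x, ~ N x -> `|f x| <= B)%R -> m.-integrable setT (EFin \o f).
Proof.
move=> mN N0 mf fB; apply/integrableP; split; first exact/measurable_EFinP.
apply: (@le_lt_trans _ _ (\int[m]_x (`|B|)%:E)).
  apply: (le_integral_off_null mN N0) => x; [exact: abse_ge0|by rewrite lee_fin|].
  by move=> /fB h; rewrite /= lee_fin (le_trans h)// ler_norm.
by rewrite integral_cst_prob ltry.
Qed.

End measure_lemmas.

(** * Borel structure and convex hulls in R^d *)

Section rV_borel.
Context {R : realType} {d : nat}.
Local Notation V := 'rV[R]_d.

Lemma open_measurable_rV (A : set V) : open A -> measurable A.
Proof. exact: sub_sigma_algebra. Qed.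

Lemma closed_measurable_rV (A : set V) : closed A -> measurable A.
Proof.
by move=> cA; rewrite -(setCK A); apply: measurableC; apply: open_measurable_rV;
  exact: closed_openC.
Qed.

Lemma compact_measurable_rV (A : set V) : compact A -> measurable A.
Proof.
move=> cA; apply: closed_measurable_rV; apply: compact_closed => //.
Qed.

Lemma measurable_set1_rV (x : V) : measurable [set x].
Proof. by apply: compact_measurable_rV; exact: compact_set1. Qed.

Lemma measurable_mem_seq (s : seq V) : measurable [set` s].
Proof.
elim: s => [|a s IH]; first by rewrite set_nil.
rewrite (_ : [set` _] = [set a] `|` [set` s]).
  by apply: measurableU => //; exact: measurable_set1_rV.
apply/seteqP; split => x /=; rewrite inE.
  by move=> /orP[/eqP|]; [left|right].
by case=> [->|->]; rewrite ?eqxx ?orbT.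
Qed.

Lemma continuous_measurable_rV (f : V -> R) : continuous f -> measurable_fun setT f.
Proof.
move=> cf; apply: (measurability _ (RGenOInfty.measurableE R)).
move=> _ [_ [a ->] <-]; rewrite setTI; apply: open_measurable_rV.
by apply: open_comp => //; move=> x _; exact: cf.
Qed.

Lemma measurable_coord (i : 'I_d) : measurable_fun setT (fun x : V => x ord0 i).
Proof. by apply: continuous_measurable_rV; exact: coord_continuous. Qed.

Lemma enorm_sqr (x : V) : enorm x ^+ 2 = \sum_(i < d) (x ord0 i) ^+ 2.
Proof. by rewrite sqr_sqrtr// sumr_ge0// => i _; exact: sqr_ge0. Qed.

Lemma edist_sqr (x y : V) : edist x y ^+ 2 = \sum_(i < d) (x ord0 i - y ord0 i) ^+ 2.
Proof. by rewrite enorm_sqr; apply: eq_bigr => i _; rewrite !mxE. Qed.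

Lemma edist_nonneg (x y : V) : 0 <= edist x y.
Proof. exact: sqrtr_ge0. Qed.

Lemma edistC (x y : V) : edist x y = edist y x.
Proof.
by congr Num.sqrt; apply: eq_bigr => i _; rewrite !mxE -sqrrN opprB.
Qed.

Lemma edistE (x y : V) : edist x y = Num.sqrt (\sum_(i < d) (x ord0 i - y ord0 i) ^+ 2).
Proof. by rewrite -edist_sqr sqrtr_sqr ger0_norm// edist_nonneg. Qed.

Lemma edist_sqr_quasi (x y z : V) :
  edist x z ^+ 2 <= 2 * edist x y ^+ 2 + 2 * edist y z ^+ 2.
Proof.
rewrite !edist_sqr !mulr_sumr -big_split/=; apply: ler_sum => i _.
have := sqr_ge0 ((x ord0 i - y ord0 i) - (y ord0 i - z ord0 i)); nra.
Qed.

Lemma coord_le_edist (x y : V) (i : 'I_d) : `|x ord0 i - y ord0 i| <= edist x y.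
Proof.
rewrite -(@ler_pXn2r _ 2) ?nnegrE ?edist_nonneg// edist_sqr real_normK ?num_real//.
by rewrite (bigD1 i)//= lerDl sumr_ge0// => j _; exact: sqr_ge0.
Qed.

Lemma norm_le_edist (x y : V) : `|x - y| <= edist x y.
Proof.
rewrite [leLHS]/Num.norm/= mx_normrE; apply/bigmax_leP; split => [|[a j] _ /=].
  exact: edist_nonneg.
by rewrite !mxE ord1; exact: coord_le_edist.
Qed.

Lemma coord_le_norm (x : V) (i : 'I_d) : `|x ord0 i| <= `|x|.
Proof.
rewrite [leRHS]/Num.norm/= mx_normrE.
by rewrite (le_bigmax_cond _ (fun ij : 'I_1 * 'I_d => `|x ij.1 ij.2|) (j:=(ord0, i))).
Qed.

Lemma measurable_edist d1 (T : measurableType d1) (f g : T -> V) :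
  measurable_fun setT f -> measurable_fun setT g ->
  measurable_fun setT (fun t => edist (f t) (g t)).
Proof.
move=> mf mg; under eq_fun do rewrite edistE.
have ms : measurable_fun setT (@Num.sqrt R).
  by apply: continuous_measurable_fun; exact: sqrt_continuous.
apply: (measurableT_comp ms).
apply: measurable_sum => i; apply: measurable_funX; apply: measurable_funB.
  by apply: (measurableT_comp (measurable_coord i)).
by apply: (measurableT_comp (measurable_coord i)).
Qed.

(** Bounds coordinate by coordinate suit both the convex test functions and the grids used later. *)
Definition box (M : R) : set V := [set x | forall i, `|x ord0 i| <= M].

Lemma measurable_coord_gt (i : 'I_d) (M : R) :
  measurable [set x : V | M < `|x ord0 i|].
Proof.
rewrite (_ : mkset _ = (fun x : V => `|x ord0 i|) @^-1` `]M, +oo[); last first.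
  by apply/seteqP; split => x /=; rewrite in_itv/= andbT.
rewrite -[X in measurable X]setTI.
have mc : measurable_fun setT (fun x : V => `|x ord0 i|).
  by apply: measurableT_comp => //; exact: measurable_coord.
by apply: mc => //; exact: measurable_itv.
Qed.

Lemma boxCE (M : R) : ~` box M = \big[setU/set0]_(i < d) [set x : V | M < `|x ord0 i|].
Proof.
apply/seteqP; split => x.
  move=> /existsNP[i /negP]; rewrite -ltNge => Mx.
  by rewrite (bigD1 i)//=; left.
move=> xM bx; elim/big_ind: _ xM => //=.
- by move=> A B hA hB [].
- by move=> i _; rewrite ltNge => /negP; apply; exact: bx.
Qed.

Lemma measurable_box (M : R) : measurable (box M).
Proof.
rewrite -(setCK (box M)) boxCE; apply: measurableC; apply: bigsetU_measurable => i _.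
exact: measurable_coord_gt.
Qed.

Lemma edist_box (M : R) (x y : V) : box M x -> box M y ->
  edist x y ^+ 2 <= d%:R * (2 * M) ^+ 2.
Proof.
move=> bx by_; rewrite edist_sqr mulr_natl.
rewrite (le_trans (ler_sum _ (G := fun=> (2 * M) ^+ 2) _))//.
  move=> i _; rewrite -real_normK ?num_real// ler_pXn2r ?nnegrE//.
    by rewrite (le_trans (ler_normB _ _))//; have := bx i; have := by_ i; lra.
  by have := bx i; have := normr_ge0 (x ord0 i); lra.
by rewrite sumr_const card_ord.
Qed.

(** A countable base. Both the nullity of the complement of a support and the generation of the
    Borel sets by balls rest on it. *)
Lemma rational_balls : exists B : nat -> V * R, (forall k, 0 < (B k).2) /\
  forall (A : set V) x, open A -> A x ->
    exists k, ball (B k).1 (B k).2 x /\ ball (B k).1 (B k).2 `<=` A.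
Proof.
pose F (k : nat) : V * R := if @unpickle ('rV[rat]_d * nat)%type k is Some qn
  then (map_mx ratr qn.1, qn.2.+1%:R^-1) else (0, 1).
exists F; split.
  by move=> k; rewrite /F; case: unpickle => [[q n]|] //=; rewrite invr_gt0.
move=> A x oA Ax.
have /nbhs_ballP[e /= e0 xeA] := open_nbhs_nbhs (conj oA Ax).
have [n ne] : exists n : nat, n.+1%:R^-1 < e / 2.
  have /ltr_add_invr[n] : 0 < e / 2 by rewrite divr_gt0.
  by rewrite add0r; exists n.
have n0 : 0 < (n.+1%:R : R)^-1 by rewrite invr_gt0.
have /choice[q qP] (i : 'I_d) : exists q : rat,
    ratr q \in `]x ord0 i - n.+1%:R^-1, x ord0 i + n.+1%:R^-1[.
  have [|q] := @rat_in_itvoo R (x ord0 i - n.+1%:R^-1) (x ord0 i + n.+1%:R^-1).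
    by rewrite ltrBlDr -addrA ltrDl addr_gt0.
  by exists q.
exists (pickle (\row_i q i, n)); rewrite /F pickleK/=.
set c : V := map_mx ratr (\row_i q i).
have xq : ball c n.+1%:R^-1 x.
  rewrite mx_norm_ball /ball_/= [X in X < _]/Num.norm/= mx_normrE.
  apply/bigmax_ltP; split => // -[a i] _ /=; rewrite !mxE ord1.
  by rewrite ltr_distl; have := qP i; rewrite in_itv.
split => // y yq; apply: xeA.
have -> : e = e / 2 + e / 2 by lra.
apply: (@ball_triangle _ _ c).
  by apply: ball_sym; apply: le_ball xq; exact: ltW.
by apply: le_ball yq; exact: ltW.
Qed.

(** A point off the support has a null ball around it, hence lies in a null ball of the countable
    base, and countably many null sets stay null. *)
Lemma supp_full (nu : probability V R) :
  measurable (supp nu) -> nu (~` supp nu) = 0%E.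
Proof.
move=> ms; have [B [B0 BP]] := rational_balls.
pose F k : set V := if nu (ball (B k).1 (B k).2) == 0%E then ball (B k).1 (B k).2 else set0.
have mF k : measurable (F k).
  rewrite /F; case: ifP => // _; apply: open_measurable_rV.
  exact: ball_open.
apply/eqP; rewrite -measure_le0.
have : nu.-negligible (\bigcup_k F k).
  apply: negligible_bigcup => k; exists (F k); split => //.
  by rewrite /F; case: ifP => [/eqP//|]; rewrite measure0.
move=> [N [mN N0 FN]]; rewrite -N0 le_measure ?inE//; first exact: measurableC.
apply: subset_trans FN => x; rewrite /supp /= => /existsNP[e /not_implyP[e0]].
move/negP; rewrite lt0e measure_ge0 andbT negbK => /eqP xe.
have oB : open (ball x e) by exact: ball_open.
have [k [kx kA]] := BP _ x oB (ballxx x e0).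
exists k => //; rewrite /F ifT//.
by rewrite -measure_le0 -xe le_measure ?inE//; apply: open_measurable_rV; exact: ball_open.
Qed.

Lemma cvg_sumr (I T : Type) (W : normedModType R) (F : set_system T)
    {FF : Filter F} (r : seq I) (f : I -> T -> W) (a : I -> W) :
  (forall i, f i x @[x --> F] --> a i) ->
  \sum_(i <- r) f i x @[x --> F] --> \sum_(i <- r) a i.
Proof.
move=> fa; elim: r => [|i r IH].
  by under eq_fun do rewrite big_nil; rewrite big_nil; exact: cvg_cst.
by under eq_fun do rewrite big_cons; rewrite big_cons; exact: cvgD.
Qed.

(** The hull is a continuous image of the standard simplex, which is closed and bounded. *)
Lemma conv_compact (s : seq V) : compact (conv s).
Proof.
pose S := [set w : 'rV[R]_(size s) | (forall i, 0 <= w ord0 i) /\ \sum_i w ord0 i = 1].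
pose L (w : 'rV[R]_(size s)) : V := \sum_i w ord0 i *: s`_i.
have -> : conv s = L @` S.
  apply/seteqP; split => y.
    move=> [w [w0 [w1 ->]]]; exists (\row_i w i).
      by split => [i|]; rewrite ?mxE//; under eq_bigr do rewrite mxE.
    by apply: eq_bigr => i _; rewrite mxE.
  by move=> [w [w0 w1] <-]; exists (fun i => w ord0 i).
apply: continuous_compact.
  apply: continuous_subspaceT => w; rewrite /L.
  have FF : Filter (nbhs w) by exact: nbhs_filter.
  apply: (@cvg_sumr _ _ V (nbhs w) FF) => i; apply: (@cvgZr_tmp _ V _ (nbhs w) FF).
  exact: coord_continuous.
apply: bounded_closed_compact.
  exists 1; split => // M M1 w [w0 w1] /=; apply: le_trans (ltW M1).
  rewrite [leLHS]/Num.norm/= mx_normrE; apply/bigmax_leP; split => // -[a i] _ /=.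
  rewrite ord1 ger0_norm// -w1 (bigD1 i)//= lerDl sumr_ge0//.
have cc i : closed [set w : 'rV[R]_(size s) | 0 <= w ord0 i].
  apply: (@preimage_closed _ _ _ [set x : R | 0 <= x]); last exact: closed_ge.
  by move=> x _; exact: coord_continuous.
have cs : closed [set w : 'rV[R]_(size s) | \sum_i w ord0 i = 1].
  apply: (@preimage_closed _ _ (fun w : 'rV[R]_(size s) => \sum_i w ord0 i) [set x : R | x = 1]).
    move=> w _; have FF : Filter (nbhs w) by exact: nbhs_filter.
    apply: (@cvg_sumr _ _ R^o (nbhs w) FF) => i; exact: coord_continuous.
  exact: closed_eq.
rewrite (_ : S = \bigcap_i [set w : 'rV[R]_(size s) | 0 <= w ord0 i] `&`
   [set w : 'rV[R]_(size s) | \sum_i w ord0 i = 1]).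
  by apply: closedI => //; exact: closed_bigI.
by apply/seteqP; split => w [w0 w1]; split => // i; [move=> _|]; exact: w0.
Qed.

Lemma measurable_conv (s : seq V) : measurable (conv s).
Proof. by apply: compact_measurable_rV; exact: conv_compact. Qed.

End rV_borel.

(** * Splitting operators *)

Section splitting_weights.
Context {R : realType} {d : nat}.
Local Notation V := 'rV[R]_d.
Variables (s : seq V) (P : V -> R -> V) (sP : splitting s P).
Hypothesis s0 : s != [::].

Let RR := measurableTypeR R.
Let D : set (V * RR) := conv s `*` unit_itv.
(** A total extension of [P] that is measurable everywhere. Its default is a point of [s], so that
    it never leaves [s] and the weights sum to 1 even off the hull. *)
Let P0 (z : V * RR) : V := if `[< D z >] then P z.1 z.2 else s`_0.

Let mU : measurable (unit_itv : set RR). Proof. exact: measurable_itv. Qed.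

Let mD : measurable D.
Proof. by apply: measurableX => //; exact: measurable_conv. Qed.

Let mP0 : measurable_fun setT P0.
Proof.
move=> _ B mB; rewrite setTI.
have -> : P0 @^-1` B = (D `&` (fun z : V * RR => P z.1 z.2) @^-1` B) `|`
    (if `[< B s`_0 >] then ~` D else set0).
  apply/seteqP; split => z; rewrite /preimage /P0 /=.
    case: asboolP => Dz Bz; [by left|right].
    by case: asboolP.
  move=> [[Dz Bz]|]; first by case: asboolP.
  by case: asboolP => // Bs Dz; case: asboolP.
apply: measurableU; first by case: sP => mP _; exact: mP.
by case: asboolP => // _; exact: measurableC.
Qed.

Let P0s z : P0 z \in s.
Proof.
rewrite /P0; case: asboolP => [[z1 z2]|_].
  by case: sP => _ [h _]; exact: h.
by apply: mem_nth; case: (s) s0.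
Qed.

(** Duplicates are removed so that each value of [P0] has exactly one index and the sections of the
    [A j] split the unit interval. *)
Let g (j : nat) : V := (undup s)`_j.
Let A (j : nat) : set (V * RR) := P0 @^-1` [set g j] `&` (setT `*` unit_itv).
Let mA j : measurable (A j).
Proof.
apply: measurableI; last by apply: measurableX.
by rewrite -[X in measurable X]setTI; apply: mP0 => //; exact: measurable_set1_rV.
Qed.
Let w (j : nat) (y : V) : R := fine (lebesgue_measure (xsection (A j) y)).

Let xA j y : xsection (A j) y `<=` (unit_itv : set RR).
Proof. by move=> u; rewrite /xsection/= inE => -[_ []]. Qed.

Let mxA j y : measurable (xsection (A j) y).
Proof. exact: measurable_xsection. Qed.

Let unit1 : lebesgue_measure (unit_itv : set RR) = 1%E.
Proof. by rewrite /unit_itv lebesgue_measure_itv/= lte_fin ltr01 -EFinB subr0. Qed.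

Let wE j y : (w j y)%:E = lebesgue_measure (xsection (A j) y).
Proof.
rewrite /w fineK// ge0_fin_numE// (@le_lt_trans _ _ 1%E) ?ltry//.
by rewrite -unit1 le_measure ?inE//; exact: xA.
Qed.

Let w_int (y : V) (F : V -> R) :
  (\int[lebesgue_measure]_(u in unit_itv) (F (P0 (y, u)))%:E)%E =
  (\sum_(j < size (undup s)) w j y * F (g j))%:E.
Proof.
have E u : unit_itv u -> (F (P0 (y, u)))%:E =
    (\sum_(j < size (undup s)) (F (g j))%:E * (\1_(xsection (A j) y) u)%:E)%E.
  move=> uu; have ks : P0 (y, u) \in undup s by rewrite mem_undup.
  have ki : (index (P0 (y, u)) (undup s) < size (undup s))%N by rewrite index_mem.
  rewrite (bigD1 (Ordinal ki))//= big1 => [|j jk].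
    rewrite adde0 indicE mem_set ?mule1.
      by rewrite /g nth_index.
    by rewrite /xsection/= inE; split => //=; rewrite /g nth_index.
  rewrite indicE memNset ?mule0// /xsection/= inE => -[/= h _].
  move: jk; apply/negP; rewrite negbK; apply/eqP/val_inj => /=.
  by rewrite h /g index_uniq ?undup_uniq.
rewrite (eq_integral (fun u => \sum_(j < size (undup s)) (F (g j))%:E * (\1_(xsection (A j) y) u)%:E)%E); last first.
  by move=> u; rewrite inE => uu; exact: E.
have ii j : lebesgue_measure.-integrable unit_itv (fun u => (\1_(xsection (A j) y) u)%:E).
  apply: (@measurable_bounded_integrable _ _ _ lebesgue_measure (\1_(xsection (A j) y)) unit_itv) => //.
    by rewrite [X in (X < _)%E]unit1 ltry.
  exists 1; split => // M M1 u _ /=; rewrite indicE.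
  by case: (_ \in _); rewrite ?normr1 ?normr0 ltW// (lt_trans _ M1).
rewrite integral_sum//; last by move=> j; exact: integrableZl.
rewrite -sumEFin; apply: eq_bigr => j _; rewrite integralZl// integral_indic//.
by rewrite EFinM muleC wE; congr (_ * _)%E; congr (lebesgue_measure _);
  apply/seteqP; split => u; [case|move=> h; split => //; exact: xA h].
Qed.

Lemma splitting_weights : exists (n : nat) (g : nat -> V) (w : nat -> V -> R),
  [/\ forall j, measurable_fun setT (w j), forall j y, 0 <= w j y,
      forall y, \sum_(j < n) w j y = 1,
      forall j, (j < n)%N -> g j \in s &
   forall y, conv s y ->
   [/\ forall i, \sum_(j < n) w j y * (g j) ord0 i = y ord0 i,
    forall B, measurable B ->
     lebesgue_measure [set u : R | unit_itv u /\ B (P y u)] =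
     (\sum_(j < n) w j y * \1_B (g j))%:E &
    forall F : V -> R, (\int[lebesgue_measure]_(u in unit_itv) (F (P y u))%:E)%E =
     (\sum_(j < n) w j y * F (g j))%:E]].
Proof.
exists (size (undup s)), g, w; split.
- move=> j; apply/measurable_EFinP.
  rewrite (_ : _ \o _ = lebesgue_measure \o xsection (A j)).
    exact: measurable_fun_xsection.
  by apply/funext => y /=; rewrite wE.
- by move=> j y; rewrite fine_ge0.
- move=> y; apply: EFin_inj.
  have e : (\int[lebesgue_measure]_(u in (unit_itv : set RR)) 1%:E = 1)%E.
    by rewrite integral_cst// mul1e; exact: unit1.
  rewrite -[RHS]e (w_int y (fun=> 1)); congr EFin.
  by apply: eq_bigr => j _; rewrite mulr1.
- by move=> j jn; rewrite -mem_undup mem_nth.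
move=> y sy.
have PE u : unit_itv u -> P0 (y, u) = P y u by move=> uu; rewrite /P0 asboolT.
have FE (F : V -> R) : (\int[lebesgue_measure]_(u in unit_itv) (F (P y u))%:E)%E =
     (\sum_(j < size (undup s)) w j y * F (g j))%:E.
  by rewrite -w_int; apply: eq_integral => u; rewrite inE => uu; rewrite PE.
split => //.
- by move=> i; apply: EFin_inj; rewrite -(FE (fun z => z ord0 i)); case: sP => _ [_ /(_ y sy i)[]].
move=> B mB; rewrite -FE.
pose S : set RR := [set u : RR | unit_itv u /\ B (P y u)].
have mS : measurable S.
  have -> : S = xsection (P0 @^-1` B `&` (setT `*` unit_itv)) y.
    apply/seteqP; split => u; rewrite /S /xsection/= inE /=.
      by move=> [uu]; rewrite PE.
    by move=> [Bu [_ uu]]; rewrite -PE.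
  apply: measurable_xsection; apply: measurableI; last exact: measurableX.
  by rewrite -[X in measurable X]setTI; exact: mP0.
transitivity (\int[lebesgue_measure]_(u in (unit_itv : set RR)) (\1_S u)%:E)%E.
  rewrite integral_indic//; congr (lebesgue_measure _).
  by apply/seteqP; split => u; [move=> h; split => //; case: h|case].
apply: eq_integral => u; rewrite inE => uu; rewrite !indicE; congr (_%:R%:E); congr (nat_of_bool _).
by apply/idP/idP; rewrite !inE => // -[].
Qed.

End splitting_weights.

(** * Optimal quantizers *)

Section quantization.
Context {R : realType} {d : nat}.
Local Notation V := 'rV[R]_d.

Lemma distS_le (s : seq V) (x g : V) : g \in s -> (distS s x <= (edist x g)%:E)%E.
Proof.
rewrite /distS; elim: s => // a s IH; rewrite inE big_cons ge_min.
by move=> /predU1P[->|/IH ->]; rewrite ?lexx ?orbT.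
Qed.

Lemma distS_ge0 (s : seq V) (x : V) : (0 <= distS s x)%E.
Proof.
rewrite /distS; elim: s => [|a s IH]; first by rewrite big_nil leey.
by rewrite big_cons le_min lee_fin edist_nonneg.
Qed.

Lemma nn_proj_le (s : seq V) (proj : V -> V) (x g : V) :
  nn_proj s proj -> g \in s -> edist x (proj x) <= edist x g.
Proof.
by move=> [_ /(_ x)[_ xE]] gs; rewrite -lee_fin xE; exact: distS_le.
Qed.

Lemma nn_proj_err (mu : probability V R) (s : seq V) (proj : V -> V) :
  nn_proj s proj ->
  (quant_err2 s mu = \int[mu]_x (edist x (proj x) ^+ 2)%:E)%E.
Proof.
move=> [_ sp]; apply: eq_integral => x _; rewrite -(sp x).2.
by rewrite poweR_EFin powR_mulrn// edist_nonneg.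
Qed.

Lemma measurable_proj_err (s : seq V) (proj : V -> V) : nn_proj s proj ->
  measurable_fun setT (fun x => edist x (proj x)).
Proof. by case=> mp _; exact: measurable_edist. Qed.

Variables (mu : probability V R) (M : R).
Hypotheses (M0 : 0 < M) (muM : mu (~` box M) = 0%E).

(** The competitor enters through any pointwise bound [h] on a squared distance to it, so its
    nearest neighbours need not be known. *)
Lemma opt_quantizer_le (N : nat) (G s : seq V) (proj : V -> V) (h : V -> R) :
  opt_quantizer N mu G -> nn_proj G proj -> (size s <= N)%N ->
  (forall x, 0 <= h x) ->
  (forall x, box M x -> exists2 g, g \in s & edist x g ^+ 2 <= h x) ->
  (\int[mu]_x (edist x (proj x) ^+ 2)%:E <= \int[mu]_x (h x)%:E)%E.
Proof.
move=> [_ oG] pG sN h0 hs; rewrite -(nn_proj_err mu pG) oG.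
apply: (@le_trans _ _ (quant_err2 s mu)); first by apply: ereal_inf_lbound; exists s.
apply: (le_integral_off_null _ muM).
- by apply: measurableC; exact: measurable_box.
- by move=> x; exact: poweR_ge0.
- by move=> x; rewrite lee_fin.
move=> x /contrapT/hs[g gs gh].
apply: (@le_trans _ _ ((edist x g)%:E `^ 2)%E).
  by apply: gt0_ler_poweR; rewrite // ?in_itv/= ?distS_ge0 ?lee_fin ?edist_nonneg ?leey//;
     exact: distS_le.
by rewrite poweR_EFin powR_mulrn ?edist_nonneg// lee_fin.
Qed.

(** Nearest point of the box. Points of a quantizer may lie outside the box; clamping brings them
    into the grid without moving them away from any point of the box. *)
Definition clamp (x : V) : V := \row_i Num.max (- M) (Num.min M (x ord0 i)).

Lemma clamp_box (x : V) : box M (clamp x).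
Proof.
move=> i; rewrite mxE ler_norml le_max lexx/= ge_max ge_min lexx/= andbT.
by rewrite (le_trans _ (ltW M0))// lerNl oppr0 ltW.
Qed.

Lemma edist_clamp (x y : V) : box M x -> edist x (clamp y) ^+ 2 <= edist x y ^+ 2.
Proof.
move=> bx; rewrite !edist_sqr; apply: ler_sum => i _; rewrite mxE.
have := bx i; rewrite ler_norml => /andP[].
set a := x ord0 i; set b := y ord0 i => a1 a2.
rewrite -[leLHS]real_normK ?num_real// -[leRHS]real_normK ?num_real//.
rewrite ler_pXn2r ?nnegrE//.
case: (ltP M b) => [Mb|bM].
  rewrite (max_idPr _); last lra.
  by rewrite !ler0_norm; lra.
case: (leP (- M) b) => // bM'.
by rewrite !ger0_norm; lra.
Qed.

Lemma unit_grid (m : nat) (r : R) : (0 < m)%N -> 0 <= r <= 1 ->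
  exists k : 'I_m, k%:R <= r * m%:R <= k.+1%:R.
Proof.
move=> m0 /andP[r0 r1]; have m0' : 0 < m%:R :> R by rewrite ltr0n.
have rm0 : 0 <= r * m%:R by rewrite mulr_ge0// ltW.
have /andP[t1 t2] := truncn_itv rm0.
have [tm|mt] := ltnP (Num.truncn (r * m%:R)) m.
  by exists (Ordinal tm) => /=; rewrite t1 ltW.
(* Only r = 1 reaches the floor [m]; it goes to the last cell. *)
have mm : (m.-1 < m)%N by rewrite prednK.
exists (Ordinal mm) => /=; rewrite prednK//; apply/andP; split.
  by apply: le_trans t1; rewrite ler_nat (leq_trans _ mt)// leq_pred.
by rewrite ler_piMl// ltW.
Qed.

(** Squared diagonal of a cell when the box is cut into m^d cubes of side 2M/m. *)
Definition mesh (m : nat) : R := d%:R * (2 * M / m%:R) ^+ 2.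

Lemma box_grid (m : nat) : (0 < m)%N -> exists cell : V -> {ffun 'I_d -> 'I_m},
  forall x y, box M x -> box M y -> cell x = cell y -> edist x y ^+ 2 <= mesh m.
Proof.
move=> m0; have m0' : 0 < m%:R :> R by rewrite ltr0n.
have M20 : 0 < 2 * M by rewrite mulr_gt0.
have /choice[c cP] (a : R) : exists k : 'I_m, `|a| <= M ->
    k%:R <= (a + M) / (2 * M) * m%:R <= k.+1%:R.
  have [aM|aM] := pselect (`|a| <= M); last by exists (Ordinal m0) => /aM.
  have [|k kP] := @unit_grid m ((a + M) / (2 * M)) m0; last by exists k.
  move: aM; rewrite ler_norml => /andP[a1 a2].
  by rewrite divr_ge0 ?(ltW M20)//= ?ler_pdivrMr//; lra.
exists (fun x => [ffun i => c (x ord0 i)]) => x y bx by_ /ffunP xy.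
rewrite edist_sqr /mesh mulr_natl -[in leRHS](card_ord d) -sumr_const.
apply: ler_sum => i _; have := xy i; rewrite !ffunE => ci.
have /andP[x1 x2] := cP _ (bx i); have /andP[y1 y2] := cP _ (by_ i).
rewrite ci in x1 x2.
rewrite -real_normK ?num_real// ler_pXn2r ?nnegrE ?divr_ge0// ?(ltW M20) ?(ltW m0')//.
rewrite ler_pdivlMr//.
set X := (x ord0 i + M) / (2 * M) * m%:R in x1 x2.
set Y := (y ord0 i + M) / (2 * M) * m%:R in y1 y2.
have D : (x ord0 i - y ord0 i) * m%:R = (2 * M) * (X - Y).
  by rewrite /X /Y; field; rewrite ?gt_eqF.
have E : `|x ord0 i - y ord0 i| * m%:R = (2 * M) * `|X - Y|.
  by have := congr1 Num.norm D; rewrite [LHS]normrM [RHS]normrM (gtr0_norm m0') (gtr0_norm M20).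
rewrite E -[leRHS]mulr1 ler_pM2l// ler_norml.
rewrite -natr1 in x2; rewrite -natr1 in y2.
set a : R := (c (y ord0 i))%:R in x1 x2 y1 y2.
by clearbody a X Y; clear -x1 x2 y1 y2; apply/andP; split; lra.
Qed.

(** One representative per grid cell gives a competitor of at most m^d points; a cell without points
    of the box may get any value. *)
Lemma opt_err_mesh (N m : nat) (G : seq V) (proj : V -> V) :
  opt_quantizer N mu G -> nn_proj G proj -> (0 < m)%N -> (m ^ d <= N)%N ->
  (\int[mu]_x (edist x (proj x) ^+ 2)%:E <= (mesh m)%:E)%E.
Proof.
move=> oG pG m0 mN; have [cell cellP] := box_grid m0.
have /choice[rep repP] (c : {ffun 'I_d -> 'I_m}) : exists z : V,
    forall x, box M x -> cell x = c -> box M z /\ cell z = c.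
  have [[z [bz zc]]|h] := pselect (exists z, box M z /\ cell z = c).
    by exists z.
  by exists 0 => x bx xc; exfalso; apply: h; exists x.
have mm0 : 0 <= mesh m by rewrite mulr_ge0// sqr_ge0.
rewrite -(integral_cst_prob mu (mesh m)).
apply: (opt_quantizer_le (s := [seq rep c | c : {ffun 'I_d -> 'I_m}]) oG pG) => //.
  by rewrite size_image card_ffun !card_ord.
move=> x bx; exists (rep (cell x)); first by apply/fintype.imageP; exists (cell x).
have [bz zc] := repP (cell x) x bx erefl.
exact: cellP.
Qed.

Lemma exists_le_integral (f : V -> R) (c c' : R) :
  (forall x, 0 <= f x) -> 0 <= c' -> (\int[mu]_x (f x)%:E <= c%:E)%E -> c < c' ->
  exists2 x, box M x & f x <= c'.
Proof.
move=> f0 c'0 fc cc'; apply: contrapT => h.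
have hc x : box M x -> c' <= f x.
  move=> bx; rewrite leNgt; apply/negP => fx; apply: h; exists x => //.
  exact: ltW.
have : (c'%:E <= c%:E)%E; last by rewrite lee_fin leNgt cc'.
apply: le_trans fc; rewrite -(integral_cst_prob mu c').
apply: (le_integral_off_null _ muM) => [|x|x|x /contrapT/hc]; rewrite ?lee_fin//.
by apply: measurableC; exact: measurable_box.
Qed.

(** Quantizer points need not lie in the box. By averaging, some y in the box has squared distance
    at most 2 mesh 1 to its projection; the squared distance from x to y is at most mesh 1, and 2 *
    1 + 2 * 2 = 6. *)
Lemma opt_dist_bounded (N : nat) (G : seq V) (proj : V -> V) (x : V) :
  (0 < d)%N ->
  opt_quantizer N mu G -> nn_proj G proj -> (0 < N)%N -> box M x ->
  edist x (proj x) ^+ 2 <= 6 * mesh 1.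
Proof.
move=> d0 oG pG N0 bx.
have m10 : 0 < mesh 1.
  by rewrite /mesh divr1 mulr_gt0 ?ltr0n// exprn_gt0// mulr_gt0.
have [||||y by_ ya] := @exists_le_integral (fun x => edist x (proj x) ^+ 2) (mesh 1) (2 * mesh 1).
- by move=> z; exact: sqr_ge0.
- by rewrite mulr_ge0// ltW.
- by apply: (opt_err_mesh oG pG) => //; rewrite exp1n.
- by rewrite ltr_pMl// ltr1n.
have ps : proj y \in G by case: pG => _ /(_ y)[].
have h1 : edist x (proj x) ^+ 2 <= edist x (proj y) ^+ 2.
  by rewrite ler_pXn2r ?nnegrE ?edist_nonneg//; exact: (nn_proj_le x pG ps).
have := edist_sqr_quasi x y (proj y); have h2 := edist_box bx by_.
have h4 : edist x y ^+ 2 <= mesh 1 by rewrite /mesh divr1.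
by move=> h3; clear -h1 h3 h4 ya; lra.
Qed.

End quantization.
Arguments mesh {R} d M m.

Section arithmetic.
Context {R : realFieldType}.

(** With J the distortion, I the first moment over the cell and a its mass, optimality against a
    shift by I leaves (2 - a) I^2 <= 0. *)
Lemma sqr_le0_of_shift (J I a : R) : a <= 1 ->
  J <= J + I ^+ 2 * a - 2 * I * I -> I ^+ 2 <= 0.
Proof.
move=> a1 h; have : I ^+ 2 * a <= I ^+ 2 * 1 by rewrite ler_wpM2l// sqr_ge0.
have := sqr_ge0 I; nra.
Qed.

Lemma deletion_cost (a b d e : R) : a <= d -> b <= e ->
  2 * a + 2 * b <= d + (d + 2 * e).
Proof. lra. Qed.

(** Here p1 = |x-y|^2, p2 and p3 are the squared distances of y and x to their projections, p4 = |y
    - proj x|^2, and p5 is the new cost at x. Then p3 >= p2/2 - p1, and 3/8 is 1/2 - 2/16. *)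
Lemma gain_pointwise (p1 p2 p3 p4 p5 : R) : 16 * p1 <= p2 -> p2 <= p4 ->
  p4 <= 2 * p1 + 2 * p3 -> p5 <= p1 -> p5 + 3 / 8 * p2 <= p3.
Proof. lra. Qed.

(** The gain 3/8 X cannot exceed the average deletion cost; all deletions together cost at most a +
    2 eta <= 3 eta, and 3 / (3/8) = 8. *)
Lemma gain_balance (s n1 n2 X a b eta : R) : n2 * X <= n1 * X ->
  n1 * (b + 3 / 8 * X) <= n1 * a -> n1 * a <= n1 * b + s ->
  s <= a + 2 * eta -> a <= eta -> n2 * X <= 8 * eta.
Proof. by rewrite mulrDr; lra. Qed.

End arithmetic.

(** * Stationarity and the gain inequality *)

Section optimality.
Context {R : realType} {d : nat}.
Local Notation V := 'rV[R]_d.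
Variables (mu : probability V R) (M : R).
Hypotheses (M0 : 0 < M) (muM : mu (~` box M) = 0%E) (d0 : (0 < d)%N).

Lemma integrable_box (f : V -> R) (B : R) : measurable_fun setT f ->
  (forall x, box M x -> `|f x| <= B) -> mu.-integrable setT (EFin \o f).
Proof.
move=> mf fB; apply: (integrable_off_null (N := ~` box M) (B := B)) => //.
  by apply: measurableC; exact: measurable_box.
by move=> x /contrapT; exact: fB.
Qed.

Lemma le_Rintegral_box (f g : V -> R) :
  mu.-integrable setT (EFin \o f) -> mu.-integrable setT (EFin \o g) ->
  (forall x, box M x -> f x <= g x) -> \int[mu]_x f x <= \int[mu]_x g x.
Proof.
move=> fi gi fg; rewrite /Rintegral -subr_ge0 -fineB ?integrable_fin_num//.
rewrite -integralB//; apply: fine_ge0.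
have i : mu.-integrable setT (EFin \o (fun x => g x - f x)).
  exact: (integrableB measurableT gi fi).
rewrite (_ : \int[mu]_x _ = \int[mu]_x (Num.max (g x - f x) 0)%:E)%E.
  by apply: integral_ge0 => x _; rewrite lee_fin le_max lexx orbT.
have mi : measurable_fun setT (fun x => g x - f x).
  by apply/measurable_EFinP; exact: (measurable_int mu i).
apply: ae_eq_integral => //; first exact: (measurable_int mu i).
  by apply/measurable_EFinP; exact: measurable_maxr.
exists (~` box M); split => //; first by apply: measurableC; exact: measurable_box.
move=> x /=; apply: contra_not => bx _; have := fg x bx; rewrite -subr_ge0 => h.
by rewrite max_l.
Qed.

Section optimal.
Variables (N : nat) (G : seq V) (proj : V -> V).
Hypotheses (oG : opt_quantizer N mu G) (pG : nn_proj G proj) (N0 : (0 < N)%N).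

Let del x := edist x (proj x) ^+ 2.

Let mdel : measurable_fun setT del.
Proof. by apply: measurable_funX; exact: measurable_proj_err pG. Qed.

Lemma measurable_proj_seq (s : seq V) : measurable (proj @^-1` [set` s]).
Proof.
rewrite -[X in measurable X]setTI; case: pG => mp _.
by apply: mp => //; exact: measurable_mem_seq.
Qed.

Lemma measurable_proj1 (g : V) : measurable (proj @^-1` [set g]).
Proof.
rewrite -[X in measurable X]setTI; case: pG => mp _.
by apply: mp => //; exact: measurable_set1_rV.
Qed.

Lemma integrable_proj_err : mu.-integrable setT (EFin \o del).
Proof.
apply: (@integrable_box _ (6 * mesh d M 1)) => // x bx.
rewrite ger0_norm ?sqr_ge0//.
exact: (opt_dist_bounded M0 muM d0 oG pG N0 bx).
Qed.

Lemma opt_Rintegral_le (s : seq V) (h : V -> R) : (size s <= N)%N ->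
  (forall x, 0 <= h x) -> mu.-integrable setT (EFin \o h) ->
  (forall x, box M x -> exists2 g, g \in s & edist x g ^+ 2 <= h x) ->
  \int[mu]_x del x <= \int[mu]_x h x.
Proof.
move=> sN h0 hi hs; apply: fine_le.
- by apply: integrable_fin_num => //; exact: integrable_proj_err.
- exact: integrable_fin_num.
- exact: (opt_quantizer_le muM oG pG sN h0 hs).
Qed.

Lemma edist_shift (x g : V) (i : 'I_d) (t : R) :
  edist x (g + t *: delta_mx ord0 i) ^+ 2 =
  edist x g ^+ 2 + t ^+ 2 - 2 * t * (x ord0 i - g ord0 i).
Proof.
rewrite !edist_sqr (bigD1 i)//= [in RHS](bigD1 i)//= !mxE !eqxx mulr1.
rewrite (eq_bigr (fun j => (x ord0 j - g ord0 j) ^+ 2)); first by ring.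
by move=> j ji; rewrite !mxE eqxx (negbTE ji) mulr0 addr0.
Qed.

(* Moving g by t e_i changes the distortion by at most
   t^2 mu(cell of g) - 2 t I with I the integral below; take t = I. *)
Lemma opt_stationary (g : V) (i : 'I_d) :
  \int[mu]_x (\1_(proj @^-1` [set g]) x * (x ord0 i - g ord0 i)) = 0.
Proof.
set A := proj @^-1` [set g].
have mA : measurable A := measurable_proj1 g.
set f := fun x : V => \1_A x * (x ord0 i - g ord0 i).
have mf : measurable_fun setT f.
  apply: measurable_funM => //; apply: measurable_funB => //.
  exact: measurable_coord.
have fi : mu.-integrable setT (EFin \o f).
  apply: (@integrable_box _ (M + `|g ord0 i|)) => // x bx.
  rewrite normrM (le_trans _ (_ : 1 * `|x ord0 i - g ord0 i| <= _))//.
    by rewrite ler_wpM2r// indicE; case: (_ \in _); rewrite ?normr1 ?normr0.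
  by rewrite mul1r (le_trans (ler_normB _ _))// lerD2r.
set I := \int[mu]_x f x.
have ci c : mu.-integrable setT (EFin \o (fun x => c * \1_A x : R)).
  apply: (@integrable_box _ `|c|) => [|x _]; first exact: measurable_funM.
  by rewrite normrM indicE; case: (_ \in _); rewrite ?normr1 ?normr0 ?mulr1 ?mulr0.
have fI : mu.-integrable setT (EFin \o (fun x => 2 * I * f x)).
  exact: (integrableZl measurableT (2 * I) fi).
have dI : mu.-integrable setT (EFin \o (fun x => del x + I ^+ 2 * \1_A x)).
  exact: (integrableD measurableT integrable_proj_err (ci (I ^+ 2))).
have hi : mu.-integrable setT (EFin \o (fun x => del x + I ^+ 2 * \1_A x - 2 * I * f x)).
  exact: (integrableB measurableT dI fI).
have hE x : del x + I ^+ 2 * \1_A x - 2 * I * f x =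
    if proj x == g then edist x (g + I *: delta_mx ord0 i) ^+ 2 else del x.
  rewrite /f indicE; case: eqP => xg.
    by rewrite mem_set//= /del xg edist_shift; ring.
  by rewrite memNset//=; ring.
pose mv (z : V) : V := if z == g then g + I *: delta_mx ord0 i else z.
have := opt_Rintegral_le (s := [seq mv z | z <- G])
  (h := fun x => del x + I ^+ 2 * \1_A x - 2 * I * f x) _ _ hi _.
have -> : \int[mu]_x (del x + I ^+ 2 * \1_A x - 2 * I * f x) =
   \int[mu]_x del x + I ^+ 2 * \int[mu]_x \1_A x - 2 * I * I.
  rewrite RintegralB// RintegralD//; last exact: integrable_proj_err.
  by rewrite !RintegralZl//; exact: integrable_indic.
have A1 : \int[mu]_x (\1_A x : R) <= 1.
  rewrite -[leRHS](_ : fine (\int[mu]_x 1%:E)%E = 1); last by rewrite integral_cst_prob.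
  apply: le_Rintegral_box; first exact: integrable_indic.
    by apply: finite_measure_integrable_cst.
  by move=> x _; rewrite indicE; case: (_ \in _).
have h1 : (size [seq mv z | z <- G] <= N)%N.
  by rewrite size_map; case: oG.
have h2 (x : V) : 0 <= del x + I ^+ 2 * \1_A x - 2 * I * f x.
  by rewrite hE; case: ifP => _; exact: sqr_ge0.
move=> /(_ h1 h2); set J := \int[mu]_x del x; set a := \int[mu]_x \1_A x in A1 *.
have h3 (x : V) : box M x -> exists2 z,
   z \in [seq mv z | z <- G] &
   edist x z ^+ 2 <= del x + I ^+ 2 * \1_A x - 2 * I * f x.
  move=> _; rewrite hE.
  exists (if proj x == g then g + I *: delta_mx ord0 i else proj x).
    by apply/mapP; exists (proj x) => //; case: pG => _ /(_ x)[].
  by case: ifP.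
move=> /(_ h3) h.
have I2 : I ^+ 2 = 0.
  by apply/eqP; rewrite eq_le sqr_ge0 andbT; exact: sqr_le0_of_shift A1 h.
by apply/eqP; rewrite -(sqrf_eq0 I) I2.
Qed.

(* Compare with the quantizer obtained by adding y and deleting a point whose
   clamped image shares its cell of the m-grid with another one: by pigeonhole
   at least m^d points qualify, so that some deletion costs O(mesh m / m^d). *)
Lemma opt_gain (m : nat) (y : V) : (0 < m)%N -> (2 * m ^ d <= N)%N ->
  (m ^ d)%:R * (edist y (proj y) ^+ 2 *
    fine (mu [set x | 16 * edist x y ^+ 2 <= edist y (proj y) ^+ 2])) <= 8 * mesh d M m.
Proof.
move=> m0 mN; have [cell cellP] := box_grid (d := d) M0 m0.
(* Indices run up to [N] even if [G] is shorter; the missing entries are 0 by default and only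
   enlarge the competitor within its allowed size. *)
pose K (i : 'I_N) := cell (clamp M G`_i).
pose rep c := [pick i | K i == c].
(* The indices that are not the picked one of their cell. Picked indices number at most m^d, which
   leaves N - m^d >= m^d candidates for deletion, each with a twin in its cell. *)
pose S : {pred 'I_N} := [pred i | rep (K i) != Some i].
have SC : (#|[predC S]| <= m ^ d)%N.
  rewrite -[leqRHS](_ : #|{ffun 'I_d -> 'I_m}| = _)%N; last by rewrite card_ffun !card_ord.
  rewrite -(@card_in_image _ _ K [predC S]) ?max_card// => i j.
  rewrite !inE !negbK => /eqP ri /eqP rj Kij.
  by have := ri; rewrite Kij rj => -[].
have mS : (m ^ d <= #|S|)%N.
  rewrite -(leq_add2r #|[predC S]|) (cardC S) card_ord.
  by apply: leq_trans mN; rewrite mul2n -addnn leq_add2l.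
have SP i : i \in S -> exists2 j, j != i & K j = K i.
  rewrite inE /rep; case: pickP => [j /eqP Kj|/(_ i)]; last by rewrite eqxx.
  by move=> ji; exists j => //; apply: contra ji => /eqP ->.
set eta := mesh d M m.
have eta0 : 0 <= eta by rewrite mulr_ge0// sqr_ge0.
(* Cells are labelled by the first index of the projection in [G], hence stay disjoint if [G]
   repeats a point. *)
pose E (i : nat) := proj @^-1` [set` [seq g <- G | index g G == i]].
have mE i : measurable (E i) := measurable_proj_seq _.
have projG x : proj x \in G by case: pG => _ /(_ x)[].
have EP i x : \1_(E i) x = (index (proj x) G == i)%:R :> R.
  rewrite indicE /E; congr (_%:R); congr nat_of_bool.
  by apply/idP/idP; rewrite inE /= mem_filter projG andbT.
pose mn (x : V) := Num.min (del x) (edist x y ^+ 2).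
have mmn : measurable_fun setT mn.
  apply: measurable_minr => //; apply: measurable_funX.
  by apply: measurable_edist => //; exact: measurable_cst.
have mn0 x : 0 <= mn x by rewrite le_min !sqr_ge0.
have mni : mu.-integrable setT (EFin \o mn).
  apply: (le_integrable _ _ _ integrable_proj_err) => //; first exact/measurable_EFinP.
  by move=> x _; rewrite /= lee_fin !ger0_norm ?sqr_ge0// ge_min lexx.
(* Extra cost on the deleted cell: rerouting to the twin costs at most 2 [del] + 2 [eta], and one
   [del] is already counted in [mn]. *)
pose co (x : V) := del x + 2 * eta.
have coi : mu.-integrable setT (EFin \o co).
  have ci : mu.-integrable setT (EFin \o cst (2 * eta)).
    exact: finite_measure_integrable_cst.
  exact: (integrableD measurableT integrable_proj_err ci).
have co0 x : 0 <= co x by rewrite addr_ge0 ?sqr_ge0// mulr_ge0.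
have Eci i : mu.-integrable setT (EFin \o (fun x => \1_(E i) x * co x)).
  apply: (le_integrable _ _ _ coi) => //.
    apply/measurable_EFinP; apply: measurable_funM => //.
    by apply/measurable_EFinP; exact: (measurable_int mu coi).
  move=> x _; rewrite /= lee_fin normrM [leRHS]ger0_norm//.
  by rewrite EP; case: (_ == _); rewrite ?normr1 ?normr0 ?mul0r// mul1r ger0_norm.
set a := \int[mu]_x del x.
set b := \int[mu]_x mn x.
have step i : i \in S -> a <= b + \int[mu]_x (\1_(E i) x * co x).
  move=> iS; have [j ji Kij] := SP i iS.
  rewrite -RintegralD//.
  apply: (@opt_Rintegral_le (y :: [seq clamp M G`_k | k : 'I_N <- enum (predC1 i)])).
  - by rewrite /= size_map -cardE cardC1 card_ord prednK.
  - by move=> x; rewrite addr_ge0// mulr_ge0// EP.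
  - exact: (integrableD measurableT mni (Eci i)).
  move=> x bx; rewrite EP.
  have kN : (index (proj x) G < N)%N.
    by apply: (@leq_trans (size G)); [rewrite index_mem|case: oG].
  have cl (k : 'I_N) : k != i -> clamp M G`_k \in y :: [seq clamp M G`_k | k : 'I_N <- enum (predC1 i)].
    move=> ki; rewrite inE; apply/orP; right; apply/mapP; exists k => //.
    by rewrite mem_enum !inE.
  have Gk : G`_(index (proj x) G) = proj x by rewrite nth_index.
  have [xy|yx] := leP (edist x y ^+ 2) (del x).
    exists y; first by rewrite inE eqxx.
    by rewrite /mn min_r// lerDl mulr_ge0.
  rewrite /mn min_l ?(ltW yx)//; case: eqP => xi.
    exists (clamp M G`_j); first exact: cl.
    apply: le_trans (edist_sqr_quasi x (clamp M G`_i) _) _.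
    have h1 : edist x (clamp M G`_i) ^+ 2 <= del x.
      by rewrite -xi Gk; exact: edist_clamp.
    have h2 : edist (clamp M G`_i) (clamp M G`_j) ^+ 2 <= eta.
      by apply: cellP; [exact: clamp_box|exact: clamp_box|].
    by rewrite mul1r /co; exact: deletion_cost.
  exists (clamp M G`_(Ordinal kN)).
    by apply: cl; apply/eqP => h; apply: xi; rewrite -h.
  by rewrite mul0r addr0 /= Gk; exact: edist_clamp.
(* Disjoint cells turn the sum of all deletion costs into one integral of [co]; the average cost is
   therefore divided by the number of candidates. *)
have sum_le : \sum_(i in S) \int[mu]_x (\1_(E i) x * co x) <= a + 2 * eta.
  rewrite -[leRHS](_ : \int[mu]_x co x = _); last first.
    rewrite RintegralD//; last 2 first.
    - exact: integrable_proj_err.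
    - exact: finite_measure_integrable_cst.
    by congr (_ + _); rewrite /Rintegral integral_cst_prob.
  have -> : \sum_(i in S) \int[mu]_x (\1_(E i) x * co x) =
      \int[mu]_x (\sum_(i in S) (\1_(E i) x * co x)).
    rewrite /Rintegral; under [in RHS]eq_integral do rewrite -sumEFin.
    rewrite integral_sum//; last by move=> i; exact: Eci.
    by rewrite sum_fine// => i _; apply: integrable_fin_num => //; exact: Eci.
  apply: le_Rintegral_box => //.
    rewrite (_ : _ \o _ = (fun x => \sum_(i in S) (\1_(E i) x * co x)%:E)%E).
      by apply: integrable_sum => // i _; exact: Eci.
    by apply/funext => x /=; rewrite sumEFin.
  move=> x _; rewrite -mulr_suml -[leRHS]mul1r ler_wpM2r//.
  under eq_bigr do rewrite EP.
  have [|h] := boolP [exists i : 'I_N, (index (proj x) G == i) && (i \in S)].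
    move=> /existsP[i /andP[/eqP xi iS]]; rewrite (bigD1 i)//= xi eqxx big1 ?addr0//.
    move=> j /andP[jS ji]; case: eqP => // ij.
    by case/negP: ji; apply/eqP/val_inj; rewrite /= ij.
  rewrite big1// => i iS; case: eqP => // xi.
  by move/negP: h; case; apply/existsP; exists i; rewrite xi eqxx.
set B := [set x | _ <= _].
have mB : measurable B.
  rewrite (_ : B = (fun x => 16 * edist x y ^+ 2) @^-1` `]-oo, (edist y (proj y) ^+ 2)]); last first.
    by apply/seteqP; split => x; rewrite /B /= in_itv.
  have mm : measurable_fun setT (fun x => 16 * edist x y ^+ 2).
    apply: measurable_funM => //; apply: measurable_funX.
    by apply: measurable_edist => //; exact: measurable_cst.
  by rewrite -[X in measurable X]setTI; apply: mm => //; exact: measurable_itv.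
have gain : b + 3 / 8 * (del y * fine (mu B)) <= a.
  have -> : fine (mu B) = \int[mu]_x \1_B x by rewrite /Rintegral integral_indicE.
  rewrite mulrA -RintegralZl//; last exact: integrable_indic.
  have Bi : mu.-integrable setT (EFin \o (fun x => 3 / 8 * del y * \1_B x)).
    exact: (integrableZl measurableT (3 / 8 * del y) (integrable_indic mu mB)).
  rewrite -RintegralD//.
  apply: le_Rintegral_box; [exact: (integrableD measurableT mni Bi)|exact: integrable_proj_err|move=> x bx].
  rewrite indicE; have [xB|xB] := boolP (x \in B); last first.
    by rewrite mulr0 addr0 ge_min lexx.
  move: xB; rewrite inE /B /= => xB; rewrite mulr1.
  have h1 : del y <= edist y (proj x) ^+ 2.
    by rewrite ler_pXn2r ?nnegrE ?edist_nonneg//; exact: (nn_proj_le y pG (projG x)).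
  have h2 := edist_sqr_quasi y x (proj x); rewrite (edistC y x) in h2.
  have h3 : mn x <= edist x y ^+ 2 by rewrite ge_min lexx orbT.
  exact: gain_pointwise xB h1 h2 h3.
have aeta : a <= eta.
  rewrite /a /Rintegral -[leRHS]/(fine eta%:E); apply: fine_le => //.
    by apply: integrable_fin_num => //; exact: integrable_proj_err.
  have := opt_err_mesh M0 muM oG pG m0; apply.
  by apply: leq_trans mN; rewrite mul2n -addnn leq_addr.
have : \sum_(i in S) a <= \sum_(i in S) (b + \int[mu]_x (\1_(E i) x * co x)).
  by apply: ler_sum => i; exact: step.
rewrite big_split/= !sumr_const -[leLHS]mulr_natl -[X in _ <= X + _]mulr_natl => h.
have mS' : (m ^ d)%:R <= #|S|%:R :> R by rewrite ler_nat.
have X0 : 0 <= del y * fine (mu B) by rewrite mulr_ge0 ?sqr_ge0// fine_ge0.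
have h3 : (m ^ d)%:R * (del y * fine (mu B)) <= #|S|%:R * (del y * fine (mu B)).
  by rewrite ler_wpM2r.
have S0 : 0 <= #|S|%:R :> R by [].
apply: gain_balance h3 _ h sum_le aeta.
by rewrite ler_wpM2l.
Qed.

End optimal.
End optimality.

(** * Distortion mismatch *)

Section mismatch_arithmetic.
Context {R : realType}.

Lemma dyadic_bracket (h x : R) (m : nat) : h < x -> x <= 2 ^+ m * h ->
  exists2 k, (k < m)%N & 2 ^+ k * h < x <= 2 ^+ k.+1 * h.
Proof.
move=> hx; elim: m => [|m IH] xm; first by move: xm; rewrite expr0 mul1r leNgt hx.
have [xm'|mx] := leP x (2 ^+ m * h).
  by have [k km kP] := IH xm'; exists k => //; exact: leq_trans km _.
by exists m => //; rewrite mx.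
Qed.

Lemma geometric_sum_le (r : R) (m : nat) : 0 <= r < 1 ->
  \sum_(k < m) r ^+ k <= (1 - r)^-1.
Proof.
move=> /andP[r0 r1]; rewrite -[leRHS]mul1r ler_pdivlMr ?subr_gt0//.
have -> : (\sum_(k < m) r ^+ k) * (1 - r) = 1 - r ^+ m.
  by rewrite -[1 - r]opprB mulrN mulrC -subrX1 opprB.
by rewrite lerBlDr lerDl exprn_ge0.
Qed.

(** The grid size is of order N^(1/e); the factor 2 is the one required by the pigeonhole argument
    of [opt_gain]. *)
Lemma exists_max_expn (e N : nat) : (0 < e)%N -> (2 <= N)%N ->
  exists m, [/\ (0 < m)%N, (2 * m ^ e <= N)%N & (N < 2 * m.+1 ^ e)%N].
Proof.
move=> e0 N2.
have h0 : exists m, (2 * m ^ e <= N)%N by exists 1; rewrite exp1n.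
have hb m : (2 * m ^ e <= N)%N -> (m <= N)%N.
  move=> h; apply: leq_trans h; rewrite -[X in (X <= _)%N](expn1 m).
  case: m => // m; apply: (@leq_trans (m.+1 ^ e)); first by rewrite leq_pexp2l.
  by rewrite leq_pmull.
have := ex_maxnP h0 hb; case=> m mN mmax; exists m; split => //.
  by apply: mmax; rewrite exp1n.
rewrite ltnNge; apply/negP => /mmax; by rewrite ltnn.
Qed.

Lemma diameter_scale (a b e : R) : 0 <= e -> 0 <= a -> a <= b ->
  6 * (a * e) <= b * (16 * e).
Proof.
move=> e0 a0 ab; have := ler_wpM2r e0 ab; have := mulr_ge0 a0 e0; lra.
Qed.

Lemma ball_mass_bound (c k b e : R) : 0 < e ->
  c * (k * (16 * e) * b) <= 8 * e -> b * (c * k) <= 1.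
Proof.
move=> e0 h; rewrite leNgt; apply/negP => X1.
have : e * 1 < e * (b * (c * k)) by rewrite ltr_pM2l.
lra.
Qed.

Lemma powR_expn (x p : R) (n : nat) : 0 <= x -> (x ^+ n) `^ p = (x `^ p) ^+ n.
Proof.
move=> x0; elim: n => [|n IH]; first by rewrite !expr0 powR1.
by rewrite !exprS powRM ?exprn_ge0// IH.
Qed.

(** Where p < 2 + d enters: the ratio of the dyadic geometric series is below 1. *)
Lemma powR2_lt (e : nat) (p : R) : p < 2 + e%:R -> 2 `^ p < 2 ^+ (e + 2) :> R.
Proof.
move=> pe; rewrite -powR_mulrn// /powR pnatr_eq0/= ltr_expR ltr_pM2r.
  by rewrite natrD addrC.
by rewrite ln_gt0// ltr1n.
Qed.

End mismatch_arithmetic.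

Section mismatch.
Context {R : realType} {d : nat}.
Local Notation V := 'rV[R]_d.
Variables (mu : probability V R) (M : R).
Hypotheses (M0 : 0 < M) (muM : mu (~` box M) = 0%E) (d0 : (0 < d)%N).

Lemma mesh_gt0 (m : nat) : (0 < m)%N -> 0 < mesh d M m.
Proof.
by move=> m0; rewrite /mesh mulr_gt0 ?ltr0n// exprn_gt0// divr_gt0 ?mulr_gt0// ltr0n.
Qed.

Lemma mesh_scale (m : nat) : (0 < m)%N -> mesh d M 1 = m%:R ^+ 2 * mesh d M m.
Proof.
by move=> m0; rewrite /mesh; field; rewrite pnatr_eq0 -lt0n.
Qed.

Section optimal.
Variables (N m : nat) (G : seq V) (proj : V -> V).
Hypotheses (oG : opt_quantizer N mu G) (pG : nn_proj G proj).
Hypotheses (m0 : (0 < m)%N) (mN : (2 * m ^ d <= N)%N).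

Let N0 : (0 < N)%N.
Proof. by apply: leq_trans mN; rewrite muln_gt0 expn_gt0 m0. Qed.

(** Four diagonals of a grid cell. The factor 16 is that of [nearby], the ball of radius D/4: a cell
    at the matching scale that contains a far point y then lies in [nearby y]. *)
Let h := Num.sqrt (16 * mesh d M m).

Let h2 : h ^+ 2 = 16 * mesh d M m.
Proof. by rewrite sqr_sqrtr// mulr_ge0// ltW// mesh_gt0. Qed.

Let h0 : 0 < h.
Proof. by rewrite sqrtr_gt0 mulr_gt0// mesh_gt0. Qed.

(** This ends the dyadic scales: the uniform bound 6 mesh 1 = 6 m^2 mesh m is below (2^k h)^2 = 16 *
    4^k mesh m once m <= 2^k. *)
Lemma opt_dist_le_scale (x : V) (k : nat) : (m <= 2 ^ k)%N -> box M x ->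
  edist x (proj x) <= 2 ^+ k * h.
Proof.
move=> mk bx; rewrite -(@ler_pXn2r _ 2) ?nnegrE ?edist_nonneg//; last first.
  by rewrite mulr_ge0 ?exprn_ge0 ?ltW.
apply: le_trans (opt_dist_bounded M0 muM d0 oG pG N0 bx) _.
rewrite (mesh_scale m0) exprMn h2; apply: diameter_scale.
- by rewrite ltW// mesh_gt0.
- exact: exprn_ge0.
- by rewrite ler_pXn2r ?nnegrE// ?exprn_ge0// -natrX ler_nat.
Qed.

Let far (k : nat) := [set x : V | 2 ^+ k * h < edist x (proj x)].

Lemma measurable_far k : measurable (far k).
Proof.
rewrite (_ : far k = (fun x => edist x (proj x)) @^-1` `]2 ^+ k * h, +oo[); last first.
  by apply/seteqP; split => x; rewrite /far /= in_itv/= andbT.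
rewrite -[X in measurable X]setTI.
by apply: (measurable_proj_err pG) => //; exact: measurable_itv.
Qed.

Let nearby (y : V) := [set x | 16 * edist x y ^+ 2 <= edist y (proj y) ^+ 2].

Let mnearby y : measurable (nearby y).
Proof.
rewrite (_ : nearby y = (fun x => 16 * edist x y ^+ 2) @^-1` `]-oo, (edist y (proj y) ^+ 2)]); last first.
  by apply/seteqP; split => x; rewrite /nearby /= in_itv.
have mm : measurable_fun setT (fun x => 16 * edist x y ^+ 2).
  apply: measurable_funM => //; apply: measurable_funX.
  by apply: measurable_edist => //; exact: measurable_cst.
by rewrite -[X in measurable X]setTI; apply: mm => //; exact: measurable_itv.
Qed.

Let nearby_le (k : nat) (y : V) : far k y ->
  fine (mu (nearby y)) <= ((m ^ d)%:R * (2 ^+ k) ^+ 2)^-1.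
Proof.
move=> fy; have := opt_gain M0 muM d0 oG pG N0 y m0 mN.
rewrite -/(nearby y).
have md : 0 < (m ^ d)%:R :> R by rewrite ltr0n expn_gt0 m0.
have dy : (2 ^+ k * h) ^+ 2 <= edist y (proj y) ^+ 2.
  by rewrite ler_pXn2r ?nnegrE ?edist_nonneg ?mulr_ge0 ?exprn_ge0 ?(ltW h0)// ltW.
set B := fine _; have B0 : 0 <= B by rewrite fine_ge0.
move=> hg; rewrite -[leRHS]mul1r ler_pdivlMr; last by rewrite mulr_gt0 ?exprn_gt0.
apply: (ball_mass_bound (mesh_gt0 m0)); rewrite -h2 -exprMn.
by apply: le_trans hg; rewrite ler_pM2l// ler_wpM2r.
Qed.

(** For 2^k < m, cover the box by a grid with m' = m / 2^k + 1 cells per side, whose diagonal is at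
    most 2^k times the fine one. The cell of a far point y lies in [nearby y], of mass at most 1 /
    (m^d 4^k), and there are at most (2m / 2^k)^d cells. *)
Lemma opt_weak_type (k : nat) : fine (mu (far k)) <= 2 ^+ d * (2 ^+ (d + 2))^-1 ^+ k.
Proof.
have rhs0 : 0 <= 2 ^+ d * (2 ^+ (d + 2))^-1 ^+ k :> R.
  by rewrite mulr_ge0// exprn_ge0// invr_ge0 exprn_ge0.
have mfar := measurable_far k.
have [mk|km] := leqP m (2 ^ k).
  rewrite (_ : mu (far k) = 0%E)//; apply/eqP; rewrite -measure_le0 -muM le_measure ?inE//.
    by apply: measurableC; exact: measurable_box.
  move=> x; rewrite /far /= => fx bx.
  by have := opt_dist_le_scale mk bx; rewrite leNgt fx.
pose m' := (m %/ 2 ^ k).+1.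
have k0 : (0 < 2 ^ k)%N by rewrite expn_gt0.
have m'k : (m' * 2 ^ k <= 2 * m)%N.
  rewrite /m' mulSn mul2n -addnn leq_add//; first exact: ltnW.
  exact: leq_divM.
have mm' : (m <= m' * 2 ^ k)%N by rewrite ltnW// ltn_ceil.
have [cell cellP] := box_grid (d := d) M0 (ltn0Sn (m %/ 2 ^ k)).
have meshm' : mesh d M m' <= (2 ^+ k) ^+ 2 * mesh d M m.
  have m'0 : 0 < m'%:R ^+ 2 :> R by rewrite exprn_gt0// ltr0n.
  rewrite -(ler_pM2l m'0) -[leLHS](mesh_scale (ltn0Sn _)) (mesh_scale m0) [leRHS]mulrA.
  rewrite ler_pM2r ?mesh_gt0// -exprMn ler_pXn2r ?nnegrE ?mulr_ge0 ?exprn_ge0//.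
  by rewrite -natrX -natrM ler_nat.
(* One far point per coarse cell that has any. In the other cells the choice is arbitrary, which is
   why [F] tests whether [y c] is far. *)
have /choice[y yP] (c : {ffun 'I_d -> 'I_m'}) : exists y, forall x,
    far k x -> box M x -> cell x = c -> [/\ far k y, box M y & cell y = c].
  have [[z [fz bz zc]]|hn] := pselect (exists z, [/\ far k z, box M z & cell z = c]).
    by exists z.
  by exists 0 => x fx bx xc; exfalso; apply: hn; exists x.
pose F c := if `[< far k (y c) >] then nearby (y c) else set0.
have mF c : measurable (F c) by rewrite /F; case: ifP.
have Fb c : (mu (F c) <= (((m ^ d)%:R * (2 ^+ k) ^+ 2)^-1)%:E)%E.
  have b0 : 0 <= ((m ^ d)%:R * (2 ^+ k) ^+ 2)^-1 :> R.
    by rewrite invr_ge0 mulr_ge0// exprn_ge0// exprn_ge0.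
  rewrite /F; case: asboolP => fy; last by rewrite measure0 lee_fin.
  by rewrite -[leLHS]fineK ?fin_num_measure// lee_fin; exact: nearby_le.
have cover : far k `<=` (~` box M) `|` \big[setU/set0]_(c : {ffun 'I_d -> 'I_m'}) F c.
  move=> x fx; have [bx|] := pselect (box M x); last by left.
  right; have [fy by_ yc] := yP (cell x) x fx bx erefl.
  rewrite (bigD1 (cell x))//=; left; rewrite /F asboolT// /nearby /=.
  have xy : edist x (y (cell x)) ^+ 2 <= mesh d M m' by apply: cellP.
  apply: (@le_trans _ _ ((2 ^+ k * h) ^+ 2)).
    by rewrite exprMn h2 [leRHS]mulrCA ler_pM2l// (le_trans xy).
  by rewrite ler_pXn2r ?nnegrE ?edist_nonneg ?mulr_ge0 ?exprn_ge0 ?(ltW h0)// ltW.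
rewrite -lee_fin fineK ?fin_num_measure//.
have mbig : measurable (\big[setU/set0]_(c : {ffun 'I_d -> 'I_m'}) F c).
  exact: bigsetU_measurable.
have mbC : measurable (~` box M : set V) by apply: measurableC; exact: measurable_box.
apply: (@le_trans _ _ (mu ((~` box M) `|` \big[setU/set0]_(c : {ffun 'I_d -> 'I_m'}) F c))).
  by rewrite le_measure ?inE//; exact: measurableU.
apply: le_trans (measureU2 _ mbC mbig) _.
rewrite [X in (X + _)%E](_ : _ = 0%E)//; rewrite add0e.
apply: le_trans (measure_bigsetU_le _ _ mF) _.
apply: (@le_trans _ _ (\sum_(c : {ffun 'I_d -> 'I_m'}) (((m ^ d)%:R * (2 ^+ k) ^+ 2)^-1)%:E)%E).
  by apply: lee_sum => c _; exact: Fb.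
rewrite sumEFin lee_fin sumr_const card_ffun !card_ord -[leLHS]mulr_natl.
have md : 0 < (m ^ d)%:R :> R by rewrite ltr0n expn_gt0 m0.
rewrite ler_pdivrMr ?mulr_gt0 ?exprn_gt0//.
have k0' : (2 : R) ^+ k != 0 by rewrite expf_neq0.
have -> : (2 : R) ^+ d * (2 ^+ (d + 2))^-1 ^+ k * ((m ^ d)%:R * (2 ^+ k) ^+ 2) =
    2 ^+ d * (m ^ d)%:R / (2 ^+ k) ^+ d.
  rewrite exprVn exprAC exprD.
  have a0 : (2 ^+ k) ^+ d != 0 :> R by rewrite expf_neq0.
  have b0 : (2 ^+ k) ^+ 2 != 0 :> R by rewrite expf_neq0.
  move: ((2 ^+ k) ^+ d : R) ((2 ^+ k) ^+ 2 : R) a0 b0 => a b a0 b0.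
  by field; rewrite a0 b0.
rewrite ler_pdivlMr ?exprn_gt0// -!natrX -!natrM ler_nat -!expnMn.
by rewrite leq_exp2r.
Qed.

(** Dyadic decomposition of the p-th moment above the scale [h]; the first m scales suffice because
    m <= 2^m. Scale k contributes at most h^p 2^p 2^d rho^k. *)
Lemma opt_powR_scale (p : R) : 2 < p < 2 + d%:R ->
  (\int[mu]_x (edist x (proj x) `^ p)%:E <=
   (h `^ p * (1 + 2 `^ p * 2 ^+ d * (1 - 2 `^ p / 2 ^+ (d + 2))^-1))%:E)%E.
Proof.
move=> /andP[p2 pd]; have p0 : 0 <= p by rewrite ltW// (lt_trans _ p2).
set rho := 2 `^ p / 2 ^+ (d + 2).
have rho1 : 0 <= rho < 1.
  rewrite divr_ge0 ?powR_ge0 ?exprn_ge0//= ltr_pdivrMr ?exprn_gt0// mul1r.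
  exact: powR2_lt.
pose b (x : V) := h `^ p + \sum_(k < m) (2 ^+ k.+1 * h) `^ p * \1_(far k) x.
have b0 x : 0 <= b x.
  rewrite addr_ge0 ?powR_ge0// sumr_ge0// => k _.
  by rewrite mulr_ge0 ?powR_ge0.
have key x : box M x -> edist x (proj x) `^ p <= b x.
  move=> bx; have [dh|hd] := leP (edist x (proj x)) h.
    rewrite (@le_trans _ _ (h `^ p))//.
      by rewrite ge0_ler_powR ?nnegrE ?edist_nonneg// ltW.
    rewrite lerDl sumr_ge0// => k _; by rewrite mulr_ge0 ?powR_ge0.
  have dm : edist x (proj x) <= 2 ^+ m * h.
    by apply: opt_dist_le_scale => //; rewrite ltnW// ltn_expl.
  have [k km /andP[k1 k2]] := dyadic_bracket hd dm.
  apply: (@le_trans _ _ ((2 ^+ k.+1 * h) `^ p)).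
    by rewrite ge0_ler_powR ?nnegrE ?edist_nonneg// mulr_ge0 ?exprn_ge0// ltW.
  rewrite /b (bigD1 (Ordinal km))//= indicE mem_set// mulr1 addrCA lerDl.
  by rewrite addr_ge0 ?powR_ge0// sumr_ge0// => j _; rewrite mulr_ge0 ?powR_ge0.
apply: (@le_trans _ _ (\int[mu]_x (b x)%:E)%E).
  apply: (le_integral_off_null _ muM).
  - by apply: measurableC; exact: measurable_box.
  - by move=> x; rewrite lee_fin powR_ge0.
  - by move=> x; rewrite lee_fin.
  - by move=> x /contrapT/key; rewrite lee_fin.
under eq_integral do rewrite EFinD -sumEFin.
rewrite ge0_integralD//; last 3 first.
- by move=> x _; rewrite lee_fin powR_ge0.
- by move=> x _; apply: sume_ge0 => k _; rewrite lee_fin mulr_ge0 ?powR_ge0.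
- apply: emeasurable_sum => k; apply/measurable_EFinP; apply: measurable_funM => //.
  by apply: measurable_indic; exact: measurable_far.
rewrite integral_cst_prob ge0_integral_sum//; last 2 first.
- move=> k; apply/measurable_EFinP; apply: measurable_funM => //.
  by apply: measurable_indic; exact: measurable_far.
- by move=> k x _; rewrite lee_fin mulr_ge0 ?powR_ge0.
rewrite mulrDr mulr1 EFinD leeD2l//.
apply: (@le_trans _ _ (\sum_(k < m) (h `^ p * (2 `^ p * 2 ^+ d) * rho ^+ k)%:E)%E).
  apply: lee_sum => k _; rewrite integral_scale_indic; last exact: measurable_far.
  rewrite lee_fin.
  apply: le_trans (ler_wpM2l (powR_ge0 _ _) (opt_weak_type k)) _.
  rewrite powRM ?exprn_ge0 ?(ltW h0)// powR_expn// exprS /rho expr_div_n exprVn.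
  by rewrite le_eqVlt; apply/orP; left; apply/eqP; ring.
rewrite sumEFin lee_fin -mulr_sumr -!mulrA.
by rewrite ler_wpM2l ?powR_ge0// !ler_wpM2l ?powR_ge0 ?exprn_ge0// geometric_sum_le.
Qed.

End optimal.

Lemma distortion_mismatch (p : R) : 2 < p < 2 + d%:R ->
  exists C : R, forall (N : nat) (G : seq V) (proj : V -> V), (0 < N)%N ->
    opt_quantizer N mu G -> nn_proj G proj ->
    (\int[mu]_x (edist x (proj x) `^ p)%:E <= (C * N%:R `^ (- p / d%:R))%:E)%E.
Proof.
move=> pd; have p0 : 0 <= p by case/andP: pd => p2 _; rewrite ltW// (lt_trans _ p2).
pose c0 := Num.sqrt (16 * mesh d M 1).
pose K := 1 + 2 `^ p * 2 ^+ d * (1 - 2 `^ p / 2 ^+ (d + 2))^-1.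
(* The factor 2^(d+1) comes from N < 2 (m+1)^d <= 2^(d+1) m^d. [C2] serves N = 1, where no m >= 1
   satisfies 2 m^d <= N. *)
pose C1 := c0 `^ p * K * (2 ^+ d.+1) `^ (p / d%:R).
pose C2 := (Num.sqrt (6 * mesh d M 1)) `^ p.
have d0' : 0 < d%:R :> R by rewrite ltr0n.
have K0 : 0 <= K.
  rewrite addr_ge0// mulr_ge0 ?mulr_ge0 ?powR_ge0 ?exprn_ge0// invr_ge0 subr_ge0.
  rewrite ler_pdivrMr ?exprn_gt0// mul1r ltW// powR2_lt//.
  by case/andP: pd.
have C10 : 0 <= C1 by rewrite !mulr_ge0 ?powR_ge0.
exists (C1 + C2) => N G proj N0 oG pG.
have [N2|N1] := leqP 2 N; last first.
  have -> : N = 1%N by apply/eqP; rewrite eqn_leq N0 -ltnS N1.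
  rewrite powR1 mulr1; apply: (@le_trans _ _ (\int[mu]_x C2%:E)%E); last first.
    by rewrite integral_cst_prob lee_fin lerDr.
  apply: (le_integral_off_null _ muM).
  - by apply: measurableC; exact: measurable_box.
  - by move=> x; rewrite lee_fin powR_ge0.
  - by move=> x; rewrite lee_fin powR_ge0.
  move=> x /contrapT bx; rewrite lee_fin ge0_ler_powR ?nnegrE ?edist_nonneg ?sqrtr_ge0//.
  rewrite -(@ler_pXn2r _ 2) ?nnegrE ?edist_nonneg ?sqrtr_ge0// [leRHS]sqr_sqrtr.
    exact: (opt_dist_bounded M0 muM d0 oG pG N0 bx).
  by rewrite mulr_ge0// ltW// mesh_gt0.
have [m [m0 mN Nm]] := exists_max_expn d0 N2.
apply: le_trans (opt_powR_scale oG pG m0 mN pd) _; rewrite lee_fin.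
have m0' : 0 < m%:R :> R by rewrite ltr0n.
have N0' : 0 < N%:R :> R by rewrite ltr0n.
have hE : Num.sqrt (16 * mesh d M m) = c0 / m%:R.
  have -> : c0 = m%:R * Num.sqrt (16 * mesh d M m).
    by rewrite /c0 (mesh_scale m0) mulrCA [LHS]sqrtrM ?exprn_ge0// sqrtr_sqr ger0_norm.
  by rewrite mulrAC mulfV ?mul1r// gt_eqF.
have Npow : m%:R `^ (- p) <= (2 ^+ d.+1) `^ (p / d%:R) * N%:R `^ (- p / d%:R).
  rewrite mulNr !powRN -[leLHS]mul1r ler_pdivlMr ?powR_gt0// mulrAC ler_pdivrMr ?powR_gt0//.
  rewrite mul1r; have -> : m%:R `^ p = (m%:R ^+ d) `^ (p / d%:R).
    by rewrite -powR_mulrn ?ltW// -powRrM mulrCA mulfV ?mulr1// gt_eqF.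
  rewrite -powRM ?exprn_ge0//; apply: ge0_ler_powR; rewrite ?nnegrE ?divr_ge0 ?mulr_ge0 ?exprn_ge0//.
  rewrite -!natrX -natrM ler_nat; apply: leq_trans (ltnW Nm) _.
  by rewrite expnS -mulnA leq_mul2l/= -expnMn leq_exp2r// mul2n -addnn -addn1 leq_add2l.
have minv : (m%:R^-1) `^ p = m%:R `^ (- p) :> R.
  by rewrite -(@powR_inv1 _ m%:R) ?ltW// -powRrM mulN1r.
rewrite hE powRM ?sqrtr_ge0 ?invr_ge0// minv -/K.
apply: (@le_trans _ _ (C1 * N%:R `^ (- p / d%:R))); last first.
  by rewrite ler_wpM2r ?powR_ge0// lerDl powR_ge0.
rewrite /C1 -!mulrA ler_wpM2l ?powR_ge0// mulrC ler_wpM2l//.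
Qed.

End mismatch.

(** * Lipschitz approximation and conditional expectation *)

Section lipschitz_operations.
Context {R : realType}.

Lemma max_dist (a b a' b' : R) :
  `|Num.max a b - Num.max a' b'| <= `|a - a'| + `|b - b'|.
Proof.
have h1 := ler_norm (a - a'); have h2 := ler_norm (b - b').
have h3 : a' - a <= `|a - a'| by rewrite distrC ler_norm.
have h4 : b' - b <= `|b - b'| by rewrite distrC ler_norm.
move: h1 h2 h3 h4; move: (`|a - a'|) (`|b - b'|) => u v h1 h2 h3 h4.
rewrite ler_norml; case: (leP a b) => ab; case: (leP a' b') => ab';
  by apply/andP; split; lra.
Qed.

Definition clip (t : R) : R := Num.max 0 (Num.min 1 t).

Lemma clip01 (t : R) : 0 <= clip t <= 1.
Proof. by rewrite /clip le_max lexx /= ge_max ler01 ge_min lexx. Qed.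

Lemma clip_dist (s t : R) : `|clip s - clip t| <= `|s - t|.
Proof.
rewrite /clip; apply: le_trans (max_dist _ _ _ _) _; rewrite subrr normr0 add0r.
have minE (u : R) : Num.min 1 u = - Num.max (-1) (- u).
  by rewrite oppr_max !opprK.
rewrite !minE opprK addrC; apply: le_trans (max_dist _ _ _ _) _.
by rewrite subrr normr0 add0r opprK addrC.
Qed.

Lemma sum_ltn (n j : nat) : (\sum_(k < n) (k < j : nat) = minn n j)%N.
Proof.
elim: n => [|n IH]; first by rewrite big_ord0 min0n.
by rewrite big_ord_recr /= IH; case: (ltnP n j); lia.
Qed.

(** The sum counts the levels (k+1)/n not above t, so it is the floor of n t. Up to 1/n, a
    [0, 1]-valued function is thus an average of n indicators. *)
Lemma layer_cake (n : nat) (t : R) : (0 < n)%N -> 0 <= t <= 1 ->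
  `|t - n%:R^-1 * \sum_(k < n) (k.+1%:R <= n%:R * t)%R%:R| <= n%:R^-1.
Proof.
move=> n0 /andP[t0 t1]; have n0' : 0 < n%:R :> R by rewrite ltr0n.
have nt0 : 0 <= n%:R * t by rewrite mulr_ge0// ltW.
have /andP[h1 h2] := truncn_itv nt0; set j := Num.truncn (n%:R * t) in h1 h2.
have jn : (j <= n)%N.
  by rewrite -(ler_nat R) (le_trans h1)// ler_piMr// ltW.
have -> : \sum_(k < n) (k.+1%:R <= n%:R * t)%R%:R = j%:R :> R.
  rewrite -natr_sum; congr (_%:R).
  transitivity (\sum_(k < n) (k < j : nat))%N.
    by apply: eq_bigr => k _; rewrite -truncn_gt_nat.
  by rewrite sum_ltn (minn_idPr jn).
have -> : t - n%:R^-1 * j%:R = n%:R^-1 * (n%:R * t - j%:R).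
  by rewrite mulrBr mulrA mulVf ?mul1r// gt_eqF.
rewrite normrM ger0_norm ?invr_ge0// ler_piMr ?invr_ge0//.
by rewrite ger0_norm ?subr_ge0// lerBlDl natr1 ltW.
Qed.

Lemma lt_of_sub_lt (a u v s t : R) : u - v <= s -> s <= t -> t < u - a -> a < v.
Proof. lra. Qed.

End lipschitz_operations.

Section lipschitz_approximation.
Context {R : realType} {d : nat}.
Local Notation V := 'rV[R]_d.

Lemma measurable_lip (f : V -> R) (L : R) : 0 <= L ->
  (forall x y, `|f x - f y| <= L * `|x - y|) -> measurable_fun setT f.
Proof.
move=> L0 pL; apply: (measurability _ (RGenOInfty.measurableE R)).
move=> _ [_ [a ->] <-]; rewrite setTI; apply: open_measurable_rV.
rewrite openE => x /=; rewrite in_itv/= andbT => afx.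
have L1 : 0 < L + 1 by rewrite ltr_wpDl.
apply/nbhs_ballP; exists ((f x - a) / (L + 1)) => /=.
  by rewrite divr_gt0// subr_gt0.
move=> y; rewrite mx_norm_ball /ball_/= ltr_pdivlMr// => xy.
rewrite in_itv/= andbT.
have h : f x - f y <= L * `|x - y| by apply: le_trans (ler_norm _) (pL x y).
have h' : L * `|x - y| <= `|x - y| * (L + 1) by rewrite mulrC ler_wpM2l// lerDl.
exact: lt_of_sub_lt h h' xy.
Qed.

Variable mu : probability V R.

(** Lipschitz rather than merely continuous: a linear modulus lets the mean quantization error
    control the effect of replacing x by its projection. *)
Definition lipschitz01 (phi : V -> R) (L : R) :=
  [/\ forall x, 0 <= phi x <= 1, 0 <= L &
      forall x y, `|phi x - phi y| <= L * `|x - y|].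

Lemma measurable_lipschitz01 (phi : V -> R) (L : R) :
  lipschitz01 phi L -> measurable_fun setT phi.
Proof. by case=> _ L0; exact: measurable_lip. Qed.

Definition L1_approx (f : V -> R) := forall e : R, 0 < e ->
  exists phi L, lipschitz01 phi L /\ (\int[mu]_x `|f x - phi x|%:E <= e%:E)%E.

(** These sets contain the balls and form a sigma-algebra, hence are all the Borel sets. *)
Let approx_set (A : set V) := measurable A /\ L1_approx (\1_A).

Lemma L1_dist_le (A : set V) (f g : V -> R) (e1 e2 : R) :
  measurable A -> measurable_fun setT f ->
  (forall x, `|g x| <= \1_A x + `|f x|) ->
  (mu A <= e1%:E)%E -> (\int[mu]_x `|f x|%:E <= e2%:E)%E ->
  (\int[mu]_x `|g x|%:E <= (e1 + e2)%:E)%E.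
Proof.
move=> mA mf gf hA hf.
apply: (@le_trans _ _ (\int[mu]_x ((\1_A x)%:E + `|f x|%:E))%E).
  by apply: le_integral_nonneg => x; rewrite ?lee_fin// -EFinD lee_fin.
rewrite ge0_integralD//; last 2 first.
- by apply/measurable_EFinP; apply: measurable_indic.
- by apply/measurable_EFinP; apply: measurableT_comp.
by rewrite integral_indicE// EFinD leeD.
Qed.

Lemma exists_small_measure (F : (set V)^nat) (e : R) : 0 < e ->
  (forall n, measurable (F n)) -> {homo F : n m / (n <= m)%N >-> (m <= n)%O} ->
  \bigcap_n F n = set0 -> exists n, (mu (F n) <= e%:E)%E.
Proof.
move=> e0 mF dF F0.
have := @nonincreasing_cvg_mu _ _ _ mu F _ mF _ dF; rewrite F0 measure0.
have FT : (mu (F 0%N) < +oo)%E by apply: (@le_lt_trans _ _ 1%E); [exact: probability_le1|exact: ltry].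
move=> /(_ FT measurable0) /fine_cvgP[_ /cvgrPdist_lt /(_ e e0)[n _ /(_ n (leqnn n))]].
rewrite /= sub0r normrN ger0_norm ?fine_ge0// => h; exists n.
by rewrite -[leLHS]fineK ?fin_num_measure// lee_fin ltW.
Qed.

Let approx_set0 : approx_set set0.
Proof.
split => // e e0; exists (fun=> 0), 0; split.
  split => // [x|x y]; first by rewrite lexx ler01.
  by rewrite subrr normr0 mul0r.
rewrite (eq_integral (cst 0%E)) ?integral0 ?lee_fin ?ltW// => x _.
by rewrite indic0 subrr normr0.
Qed.

Let approx_setC A : approx_set A -> approx_set (~` A).
Proof.
move=> [mA hA]; split; first exact: measurableC.
move=> e /hA[phi [L [[p01 L0 pL] pe]]]; exists (fun x => 1 - phi x), L; split.
  split => //.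
    by move=> x; have /andP[a b] := p01 x; rewrite subr_ge0 b lerBlDr lerDl.
  by move=> x y; rewrite opprB addrC addrA subrK distrC; exact: pL.
apply: le_trans pe; apply: le_integral_nonneg => x; rewrite ?lee_fin//.
rewrite le_eqVlt; apply/orP; left; apply/eqP; rewrite -[RHS]normrN; congr (`|_|).
by rewrite !indicE in_setC; case: (x \in A) => /=; ring.
Qed.

Let approx_setU A B : approx_set A -> approx_set B -> approx_set (A `|` B).
Proof.
move=> [mA hA] [mB hB]; split; first exact: measurableU.
move=> e e0; have e20 : 0 < e / 2 by rewrite divr_gt0.
have [p [L [lp pe]]] := hA _ e20; have [q [K [lq qe]]] := hB _ e20.
have mp := measurable_lipschitz01 lp; have mq := measurable_lipschitz01 lq.
have [p01 L0 pL] := lp; have [q01 K0 qK] := lq.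
exists (fun x => Num.max (p x) (q x)), (L + K); split.
  split.
  - move=> x; have /andP[a b] := p01 x; have /andP[a' b'] := q01 x.
    by rewrite le_max a /= ge_max b b'.
  - exact: addr_ge0.
  - by move=> x y; rewrite (le_trans (max_dist _ _ _ _))// mulrDl lerD.
rewrite [e](splitr e).
apply: (@le_trans _ _ (\int[mu]_x (`|\1_A x - p x|%:E + `|\1_B x - q x|%:E))%E).
  apply: le_integral_nonneg => x; first by rewrite lee_fin.
  rewrite -EFinD lee_fin.
  have -> : \1_(A `|` B) x = Num.max (\1_A x) (\1_B x) :> R.
    rewrite !indicE in_setU; case: (x \in A); case: (x \in B) => /=.
    + by rewrite maxxx.
    + by rewrite max_l.
    + by rewrite max_r.
    + by rewrite maxxx.
  exact: max_dist.
rewrite ge0_integralD//; last 2 first.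
- by apply/measurable_EFinP; apply: measurableT_comp => //; apply: measurable_funB.
- by apply/measurable_EFinP; apply: measurableT_comp => //; apply: measurable_funB.
by rewrite EFinD leeD.
Qed.

(** Finite unions exhaust the countable one up to small measure, so the approximant of a finite
    union serves. *)
Let approx_bigcup (F : (set V)^nat) : (forall n, approx_set (F n)) ->
  approx_set (\bigcup_n F n).
Proof.
move=> aF.
have aU n : approx_set (\big[setU/set0]_(k < n) F k).
  elim: n => [|n IH]; first by rewrite big_ord0; exact: approx_set0.
  by rewrite big_ord_recr; exact: approx_setU.
set U := \bigcup_n F n.
have mU : measurable U by apply: bigcup_measurable => n _; case: (aF n).
split => // e e0; have e20 : 0 < e / 2 by rewrite divr_gt0.
have [|||n Dn] := @exists_small_measure (fun n => U `\` \big[setU/set0]_(k < n) F k) _ e20.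
- by move=> n; apply: measurableD => //; case: (aU n).
- move=> n m nm; apply/subsetPset => x [Ux nx]; split => // h; apply: nx.
  move: h; rewrite -!bigcup_mkord => -[k kn Fk]; exists k => //.
  exact: leq_trans kn nm.
- apply/seteqP; split => x //= h; have [n _ Fx] := (h 0%N Logic.I).1.
  have [_] := h n.+1 Logic.I; apply.
  exact: (@bigsetU_sup _ n n.+1 F (ltnSn n) x Fx).
have [mUn hUn] := aU n; have [p [L [lp pe]]] := hUn _ e20.
exists p, L; split => //; rewrite [e](splitr e).
apply: L1_dist_le Dn pe => //.
- exact: measurableD.
- by apply: measurable_funB; [exact: measurable_indic|exact: measurable_lipschitz01 lp].
move=> x; set Un := \big[setU/set0]_(k < n) F k.
have -> : \1_U x - p x = (\1_U x - \1_Un x) + (\1_Un x - p x) by ring.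
rewrite (le_trans (ler_normD _ _))// lerD2r.
have UnU : Un `<=` U by exact: bigsetU_bigcup.
rewrite !indicE in_setD; case: (boolP (x \in Un)) => xn /=.
  by rewrite (mem_set (UnU _ (set_mem xn))) subrr normr0.
by rewrite subr0 andbT ger0_norm.
Qed.

(** A ramp of slope n + 1 inside the ball differs from the indicator only on the inner shell [D n],
    and these shells decrease to the empty set because the ball is open. *)
Let approx_ball (q : V) (r : R) : approx_set (ball q r).
Proof.
have bE : ball q r = [set x | 0 < r - `|x - q|].
  by apply/seteqP; split => x; rewrite mx_norm_ball /ball_/= subr_gt0 distrC.
split; first by apply: open_measurable_rV; exact: ball_open.
move=> e e0.
pose D n := [set x : V | 0 < r - `|x - q| < n.+1%:R^-1].
have lipd (x y : V) : `|(r - `|x - q|) - (r - `|y - q|)| <= 1 * `|x - y|.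
  rewrite mul1r opprB addrC addrA subrK distrC.
  apply: le_trans (ler_dist_dist _ _) _.
  by rewrite opprB addrA subrK.
have md : measurable_fun setT (fun x : V => r - `|x - q|).
  exact: (measurable_lip ler01 lipd).
have mD n : measurable (D n).
  rewrite (_ : D n = (fun x : V => r - `|x - q|) @^-1` `]0, n.+1%:R^-1[); last first.
    by apply/seteqP; split => x; rewrite /D /= in_itv.
  by rewrite -[X in measurable X]setTI; apply: md => //; exact: measurable_itv.
have [||n Dn] := @exists_small_measure D e e0 mD.
- move=> n m nm; apply/subsetPset => x /andP[h1 h2]; apply/andP; split => //.
  by apply: lt_le_trans h2 _; rewrite lef_pV2 ?posrE// ler_nat.
- apply/seteqP; split => x //= h; have /andP[h1 _] := h 0%N Logic.I.
  have /ltr_add_invr[n] := h1; rewrite add0r => hn.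
  by have /andP[_ h2] := h n Logic.I; have := lt_trans hn h2; rewrite ltxx.
exists (fun x => clip (n.+1%:R * (r - `|x - q|))), n.+1%:R; split.
  split => // [x|x y]; first exact: clip01.
  apply: le_trans (clip_dist _ _) _; rewrite -mulrBr normrM ger0_norm// ler_wpM2l//.
  by have := lipd x y; rewrite mul1r.
rewrite -[e]addr0; apply: (@L1_dist_le (D n) (cst 0)) => //; last first.
  by rewrite (eq_integral (cst 0%E)) ?integral0// => x _; rewrite /= normr0.
move=> x; rewrite /= normr0 addr0 !indicE bE /D /clip.
have [x0|x0] := leP (r - `|x - q|) 0.
  rewrite memNset /=; last by rewrite ltNge x0.
  rewrite (@min_r _ _ 1) ?max_l ?subr0 ?normr0//.
    by rewrite mulr_ge0_le0.
  by rewrite (@le_trans _ _ 0)// mulr_ge0_le0.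
rewrite mem_set//=; have [xn|nx] := ltP (r - `|x - q|) n.+1%:R^-1.
  have -> : (x \in [set x1 : V | 0 < r - `|x1 - q| < n.+1%:R^-1]) = true.
    by apply/mem_set => /=; rewrite x0.
  have /andP[c0 c1] := clip01 (n.+1%:R * (r - `|x - q|)).
  by rewrite ger0_norm ?subr_ge0// lerBlDr lerDl.
rewrite min_l; last by rewrite -ler_pdivrMl// mulr1.
by rewrite max_r// subrr normr0.
Qed.

Lemma L1_approx_measurable (A : set V) : measurable A -> L1_approx (\1_A).
Proof.
move=> mA; suff : approx_set A by case.
apply: smallest_sub mA; first split.
- exact: approx_set0.
- by move=> B; rewrite setTD; exact: approx_setC.
- exact: approx_bigcup.
move=> B oB; have [b [b0 bP]] := @rational_balls R d.
pose F k := if `[< ball (b k).1 (b k).2 `<=` B >] then ball (b k).1 (b k).2 else set0.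
have -> : B = \bigcup_k F k.
  apply/seteqP; split => x.
    by move=> /(bP B x oB)[k [kx kB]]; exists k => //; rewrite /F asboolT.
  by move=> [k _]; rewrite /F; case: asboolP => // kB /kB.
apply: approx_bigcup => k; rewrite /F; case: asboolP => _; first exact: approx_ball.
exact: approx_set0.
Qed.

Lemma L1_approx_fun (w : V -> R) : measurable_fun setT w ->
  (forall x, 0 <= w x <= 1) -> L1_approx w.
Proof.
move=> mw w01 e e0; have e20 : 0 < e / 2 by rewrite divr_gt0.
have /ltr_add_invr[m] := e20; rewrite add0r; set n := m.+1 => ne.
have n0 : (0 < n)%N by [].
have n0' : 0 < n%:R :> R by rewrite ltr0n.
pose A (k : nat) := [set x | k.+1%:R <= n%:R * w x].
have mA k : measurable (A k).
  rewrite (_ : A k = (fun x => n%:R * w x) @^-1` `[k.+1%:R, +oo[); last first.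
    by apply/seteqP; split => x; rewrite /A /= in_itv/= andbT.
  rewrite -[X in measurable X]setTI.
  have mm : measurable_fun setT (fun x => n%:R * w x) by exact: measurable_funM.
  by apply: mm => //; exact: measurable_itv.
have /choice[p pP] (k : nat) := L1_approx_measurable (mA k) e20.
have /choice[L LP] := pP.
pose phi x := n%:R^-1 * \sum_(k < n) p k x.
exists phi, (n%:R^-1 * \sum_(k < n) L k); split.
  split.
  - move=> x; rewrite mulr_ge0 ?invr_ge0//=; last first.
      by apply: sumr_ge0 => k _; case: (LP k) => -[/(_ x)/andP[]].
    rewrite /phi mulrC ler_pdivrMr// mul1r.
    rewrite (le_trans (ler_sum _ (G := fun=> 1) _))//.
      by move=> k _; case: (LP k) => -[/(_ x)/andP[]].
    by rewrite sumr_const card_ord.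
  - rewrite mulr_ge0 ?invr_ge0// sumr_ge0// => k _; by case: (LP k) => -[].
  - move=> x y; rewrite -mulrBr normrM ger0_norm ?invr_ge0// -mulrA ler_wpM2l ?invr_ge0//.
    rewrite -sumrB (le_trans (ler_norm_sum _ _ _))// mulr_suml ler_sum// => k _.
    by case: (LP k) => -[_ _ h] _; exact: h.
apply: (@le_trans _ _ (\int[mu]_x ((n%:R^-1)%:E +
    \sum_(k < n) (n%:R^-1)%:E * `|\1_(A k) x - p k x|%:E))%E).
  apply: le_integral_nonneg => x; rewrite ?lee_fin//.
  under eq_bigr do rewrite -EFinM.
  rewrite sumEFin -EFinD lee_fin.
  have -> : w x - phi x = (w x - n%:R^-1 * \sum_(k < n) \1_(A k) x) +
     n%:R^-1 * \sum_(k < n) (\1_(A k) x - p k x).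
    by rewrite sumrB mulrBr /phi; ring.
  rewrite (le_trans (ler_normD _ _))// lerD//.
    have -> : \sum_(k < n) \1_(A k) x = \sum_(k < n) (k.+1%:R <= n%:R * w x)%R%:R :> R.
      apply: eq_bigr => k _; rewrite indicE; congr (_%:R); congr nat_of_bool.
      by apply/idP/idP; rewrite inE.
    exact: layer_cake.
  rewrite normrM ger0_norm ?invr_ge0// -mulr_sumr ler_wpM2l ?invr_ge0//.
  exact: ler_norm_sum.
have mk k : measurable_fun setT (fun x => `|\1_(A k) x - p k x|%:E).
  apply/measurable_EFinP; apply: measurableT_comp => //; apply: measurable_funB => //.
  by case: (LP k) => /measurable_lipschitz01.
rewrite ge0_integralD//; last 2 first.
- by move=> x _; apply: sume_ge0 => k _; rewrite -EFinM lee_fin mulr_ge0 ?invr_ge0.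
- by apply: emeasurable_sum => k; apply: measurable_funeM.
rewrite integral_cst_prob ge0_integral_sum//; last by move=> k; apply: measurable_funeM.
rewrite [e](splitr e) EFinD leeD ?lee_fin ?(ltW ne)//.
apply: (@le_trans _ _ (\sum_(k < n) (n%:R^-1 * (e / 2))%:E)%E).
  apply: lee_sum => k _; rewrite ge0_integralZl ?lee_fin ?invr_ge0//.
  by rewrite EFinM lee_pmul2l//; [case: (LP k)|rewrite lte_fin invr_gt0].
rewrite sumEFin lee_fin sumr_const card_ord -mulrnAl -[_ *+ n]mulr_natr mulVf ?mul1r//.
by rewrite gt_eqF.
Qed.

End lipschitz_approximation.

Section real_integral.
Context {R : realType} d (T : measurableType d) (m : probability T R).
Local Notation integ f := (m.-integrable setT (EFin \o f)).

Lemma Rintegral_sum (I : Type) (s : seq I) (f : I -> T -> R) :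
  (forall i, integ (f i)) ->
  \int[m]_x (\sum_(i <- s) f i x) = \sum_(i <- s) \int[m]_x f i x.
Proof.
move=> fi; rewrite /Rintegral; under eq_integral do rewrite -sumEFin.
rewrite integral_sum// -sum_fine// => i _.
by apply: integrable_fin_num => //; exact: fi.
Qed.

Lemma integrable_sumR (I : Type) (s : seq I) (f : I -> T -> R) :
  (forall i, integ (f i)) -> integ (fun x => \sum_(i <- s) f i x).
Proof.
move=> fi; rewrite (_ : _ \o _ = (fun x => \sum_(i <- s) (f i x)%:E)%E).
  by apply: integrable_sum => // i _; exact: fi.
by apply/funext => x /=; rewrite sumEFin.
Qed.

Lemma integrable_indicM (A : set T) (f : T -> R) : measurable A -> integ f ->
  integ (fun x => \1_A x * f x).
Proof.
move=> mA fi; apply: (le_integrable _ _ _ fi) => //.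
  apply/measurable_EFinP; apply: measurable_funM => //.
  by apply/measurable_EFinP; exact: (measurable_int m fi).
move=> x _; rewrite /= lee_fin normrM indicE.
by case: (_ \in _); rewrite ?normr1 ?mul1r// normr0 mul0r.
Qed.

Lemma integrable_bounded (f : T -> R) (B : R) : measurable_fun setT f ->
  (forall x, `|f x| <= B) -> integ f.
Proof.
by move=> mf fB; apply: (@integrable_off_null _ _ _ m set0 f B) => // x _.
Qed.

Lemma integrableN_R (f g : T -> R) : integ f -> integ g -> integ (fun x => f x - g x).
Proof. by move=> fi gi; exact: (integrableB measurableT fi gi). Qed.

Lemma integrableD_R (f g : T -> R) : integ f -> integ g -> integ (fun x => f x + g x).
Proof. by move=> fi gi; exact: (integrableD measurableT fi gi). Qed.

Lemma integrableZ_R (c : R) (f : T -> R) : integ f -> integ (fun x => c * f x).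
Proof. by move=> fi; exact: (integrableZl measurableT c fi). Qed.

Lemma integrable_abs_R (f : T -> R) : integ f -> integ (fun x => `|f x|).
Proof. by move=> fi; exact: (integrable_norm fi). Qed.

Lemma integral_Rintegral (f : T -> R) : integ f ->
  (\int[m]_x (f x)%:E = (\int[m]_x f x)%:E)%E.
Proof. by move=> fi; rewrite /Rintegral fineK//; exact: integrable_fin_num. Qed.

Lemma Rintegral_cst_prob (c : R) : \int[m]_x c = c.
Proof. by rewrite /Rintegral integral_cst_prob. Qed.

Lemma Rintegral_indic (A : set T) : measurable A -> \int[m]_x \1_A x = fine (m A).
Proof. by move=> mA; rewrite /Rintegral integral_indicE. Qed.

End real_integral.

Section conditional_expectation.
Context {R : realType} {d : nat}.
Local Notation V := 'rV[R]_d.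
Variables (mu : probability V R) (M : R).
Hypotheses (M0 : 0 < M) (muM : mu (~` box M) = 0%E) (d0 : (0 < d)%N).
Local Notation integ f := (mu.-integrable setT (EFin \o f)).

Section proj.
Variables (N : nat) (G : seq V) (proj : V -> V).
Hypotheses (oG : opt_quantizer N mu G) (pG : nn_proj G proj) (N0 : (0 < N)%N).
Let E g := proj @^-1` [set g].
Let mE g : measurable (E g) := measurable_proj1 pG g.

Lemma indic_proj_sum (x : V) (F : V -> R) :
  F (proj x) = \sum_(g <- undup G) \1_(E g) x * F g.
Proof.
have pu : proj x \in undup G by rewrite mem_undup; case: pG => _ /(_ x)[].
rewrite (bigD1_seq (proj x)) ?undup_uniq//= indicE mem_set// mul1r big1 ?addr0//.
by move=> g gx; rewrite indicE memNset ?mul0r// /E /= => /esym h; rewrite h eqxx in gx.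
Qed.

Lemma Rintegral_cells (F : V -> R) : integ F ->
  \int[mu]_x F x = \sum_(g <- undup G) \int[mu]_x (\1_(E g) x * F x).
Proof.
move=> Fi; rewrite -Rintegral_sum; last by move=> g; exact: integrable_indicM.
apply: eq_Rintegral => x _; rewrite -mulr_suml.
have := indic_proj_sum x (fun=> 1); under eq_bigr do rewrite mulr1.
by move=> <-; rewrite mul1r.
Qed.

Lemma integrable_proj_comp (F : V -> R) : integ (fun x => F (proj x)).
Proof.
rewrite (_ : (fun x => F (proj x)) = fun x => \sum_(g <- undup G) \1_(E g) x * F g).
  apply: integrable_sumR => g; apply: integrable_indicM => //.
  exact: finite_measure_integrable_cst.
by apply/funext => x; exact: indic_proj_sum.
Qed.

Lemma integrable_edist_proj : integ (fun x => edist x (proj x)).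
Proof.
apply: (integrable_box muM (B := 1 + 6 * mesh d M 1)).
  exact: measurable_proj_err pG.
move=> x bx; rewrite ger0_norm ?edist_nonneg//.
have h := opt_dist_bounded M0 muM d0 oG pG N0 bx.
have := sqr_ge0 (edist x (proj x) - 1).
have : 0 <= edist x (proj x) ^+ 2 by exact: sqr_ge0.
move: (edist x (proj x)) (mesh d M 1) h => t c; nra.
Qed.

(* Both w - phi and phi - phi o proj are paid twice: averaging over the cells
   of proj contracts L1. *)
Lemma cond_exp_dist (w b phi : V -> R) (L : R) : integ w -> lipschitz01 phi L ->
  (forall g, g \in G -> b g * fine (mu (E g)) = \int[mu]_x (\1_(E g) x * w x)) ->
  \int[mu]_x `|w x - b (proj x)| <=
    2 * \int[mu]_x `|w x - phi x| + 2 * (L * \int[mu]_x edist x (proj x)).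
Proof.
move=> wi lp hb; have [p01 L0 pL] := lp.
have pi_ : integ phi.
  apply: (integrable_bounded mu (B := 1)); first exact: measurable_lipschitz01 lp.
  by move=> x; have /andP[h0 h1] := p01 x; rewrite ger0_norm.
have ppi := integrable_proj_comp phi; have bpi := integrable_proj_comp b.
have ei := integrable_edist_proj.
have i1 := integrable_abs_R (integrableN_R wi pi_).
have i2 := integrable_abs_R (integrableN_R pi_ ppi).
have i3 := integrable_abs_R (integrableN_R ppi bpi).
have i4 := integrable_abs_R (integrableN_R ppi wi).
set D1 := \int[mu]_x `|w x - phi x|; set D2 := \int[mu]_x `|phi x - phi (proj x)|.
have D2le : D2 <= L * \int[mu]_x edist x (proj x).
  rewrite -RintegralZl//; apply: le_Rintegral => //; first exact: integrableZ_R.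
  move=> x _; apply: le_trans (pL _ _) _; rewrite ler_wpM2l//.
  exact: norm_le_edist.
have D4le : \int[mu]_x `|phi (proj x) - w x| <= D1 + D2.
  rewrite -RintegralD//; apply: le_Rintegral => //; first exact: integrableD_R.
  move=> x _; rewrite distrC.
  rewrite (_ : w x - phi (proj x) = (w x - phi x) + (phi x - phi (proj x))); last by ring.
  exact: ler_normD.
have D3le : \int[mu]_x `|phi (proj x) - b (proj x)| <= \int[mu]_x `|phi (proj x) - w x|.
  rewrite (Rintegral_cells i3) (Rintegral_cells i4).
  rewrite big_seq [leRHS]big_seq; apply: ler_sum => g; rewrite mem_undup => gG.
  have -> : \int[mu]_x (\1_(E g) x * `|phi (proj x) - b (proj x)|) =
     `|\int[mu]_x (\1_(E g) x * (phi (proj x) - w x))|.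
    transitivity (\int[mu]_x (`|phi g - b g| * \1_(E g) x)).
      apply: eq_Rintegral => x _; rewrite mulrC indicE.
      have [/set_mem /= ->//|] := boolP (x \in E g).
      by rewrite !mulr0.
    rewrite RintegralZl//; last exact: integrable_indic.
    rewrite Rintegral_indic// -[X in _ * X = _]ger0_norm ?fine_ge0// -normrM; congr (`|_|).
    rewrite mulrBl hb//.
    transitivity (\int[mu]_x (\1_(E g) x * phi (proj x)) - \int[mu]_x (\1_(E g) x * w x)).
      congr (_ - _); rewrite -Rintegral_indic// -RintegralZl//; last exact: integrable_indic.
      apply: eq_Rintegral => x _; rewrite mulrC indicE.
      have [/set_mem /= ->//|] := boolP (x \in E g).
      by rewrite !mul0r.
    rewrite -RintegralB//; try exact: integrable_indicM.
    by apply: eq_Rintegral => x _; rewrite mulrBr.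
  have i5 := integrable_indicM (mE g) (integrableN_R ppi wi).
  apply: le_trans (le_normr_Rintegral measurableT i5) _.
  apply: le_Rintegral => //; first exact: integrable_abs_R.
    exact: integrable_indicM.
  by move=> x _; rewrite normrM (@ger0_norm _ (\1_(E g) x)).
apply: (@le_trans _ _ (D1 + (D2 + \int[mu]_x `|phi (proj x) - b (proj x)|))).
  rewrite -RintegralD// -RintegralD//; last exact: integrableD_R.
  apply: le_Rintegral => //.
  - exact/integrable_abs_R/integrableN_R.
  - by apply: integrableD_R => //; exact: integrableD_R.
  move=> x _; rewrite (_ : w x - b (proj x) =
    (w x - phi x) + ((phi x - phi (proj x)) + (phi (proj x) - b (proj x)))); last by ring.
  by rewrite (le_trans (ler_normD _ _))// lerD2l ler_normD.
move: D2le D4le D3le; move: (\int[mu]_x edist x (proj x)) => e.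
move: (\int[mu]_x _) (\int[mu]_x _) D1 D2 => a c D1 D2; lra.
Qed.

End proj.

(** The Lipschitz approximant is fixed before the quantizer, so [eta] does not depend on the latter.
    With D the distance to the projection, D <= t + D^2 / t has mean at most 2t once the distortion
    is below t^2; the total is then at most 2 (e/4) + 4 L t <= e. *)
Lemma cond_exp_cvg (w : V -> R) (e : R) : measurable_fun setT w ->
  (forall x, 0 <= w x <= 1) -> 0 < e -> exists2 eta, 0 < eta &
  forall N G proj b, (0 < N)%N -> opt_quantizer N mu G -> nn_proj G proj ->
  \int[mu]_x (edist x (proj x) ^+ 2) <= eta ->
  (forall g, g \in G -> b g * fine (mu (proj @^-1` [set g])) =
     \int[mu]_x (\1_(proj @^-1` [set g]) x * w x)) ->
  \int[mu]_x `|w x - b (proj x)| <= e.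
Proof.
move=> mw w01 e0; have wi : integ w.
  apply: (integrable_bounded mu (B := 1)) => // x.
  by have /andP[h0 h1] := w01 x; rewrite ger0_norm.
have e4 : 0 < e / 4 by rewrite divr_gt0.
have [phi [L [lp pe]]] := L1_approx_fun mu mw w01 e4.
have L0 : 0 <= L by case: lp.
pose t := e / (8 * (L + 1)).
have L1 : 0 < L + 1 by rewrite ltr_wpDl.
have t0 : 0 < t by rewrite divr_gt0// mulr_gt0.
exists (t ^+ 2); first exact: exprn_gt0.
move=> N G proj b N0 oG pG ht hb.
have := cond_exp_dist oG pG N0 wi lp hb.
have ei := integrable_edist_proj oG pG N0.
have e2i : integ (fun x => edist x (proj x) ^+ 2) := integrable_proj_err M0 muM d0 oG pG N0.
have h1 : \int[mu]_x edist x (proj x) <= t + t^-1 * \int[mu]_x (edist x (proj x) ^+ 2).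
  rewrite -RintegralZl// -[X in X + _](Rintegral_cst_prob mu) -RintegralD//; last 2 first.
  - exact: finite_measure_integrable_cst.
  - exact: integrableZ_R.
  apply: le_Rintegral => //.
    apply: integrableD_R; first exact: finite_measure_integrable_cst.
    exact: integrableZ_R.
  move=> x _; have [xt|tx] := leP (edist x (proj x)) t.
    by rewrite (le_trans xt)// lerDl mulr_ge0 ?sqr_ge0// invr_ge0 ltW.
  rewrite (@le_trans _ _ (t^-1 * edist x (proj x) ^+ 2))//; last by rewrite lerDr ltW.
  rewrite expr2 mulrA ler_peMl ?edist_nonneg//.
  by rewrite mulrC ler_pdivlMr// mul1r ltW.
have h2 : t^-1 * \int[mu]_x (edist x (proj x) ^+ 2) <= t.
  by rewrite mulrC ler_pdivrMr// -expr2.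
have h3 : \int[mu]_x `|w x - phi x| <= e / 4.
  have pi_ : integ phi.
    apply: (integrable_bounded mu (B := 1)); first exact: measurable_lipschitz01 lp.
    by move=> x; case: lp => /(_ x)/andP[p0 p1] _ _; rewrite ger0_norm.
  by move: pe; rewrite integral_Rintegral ?lee_fin//; exact/integrable_abs_R/integrableN_R.
have h4 : L * t <= e / 8.
  rewrite /t mulrCA ler_wpM2l ?(ltW e0)// invfM mulrCA ler_piMr ?invr_ge0//.
  by rewrite ler_pdivrMr// mul1r lerDl.
have h5 : L * \int[mu]_x edist x (proj x) <= L * (t + t).
  by rewrite ler_wpM2l// (le_trans h1)// lerD2l.
move: h3 h4 h5; move: (\int[mu]_x edist x (proj x)) => I1.
move: (\int[mu]_x _) (\int[mu]_x _) => I2 I3; rewrite mulrDr; lra.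
Qed.

End conditional_expectation.

(** * Power inequalities and transport of weights *)

Section power_inequalities.
Context {R : realType}.

(** The shares a/(a+b) and b/(a+b) lie in [0, 1], where t <= t^r. *)
Lemma powR_subadditive (r a b : R) : 0 < r <= 1 -> 0 <= a -> 0 <= b ->
  (a + b) `^ r <= a `^ r + b `^ r.
Proof.
move=> /andP[r0 r1] a0 b0; have [ab0|ab0] := eqVneq (a + b) 0.
  by rewrite ab0 powR0 ?gt_eqF// addr_ge0 ?powR_ge0.
have s0 : 0 < a + b by rewrite lt_neqAle eq_sym ab0 addr_ge0.
have key (x : R) : 0 <= x -> x <= a + b -> x / (a + b) * (a + b) `^ r <= x `^ r.
  move=> x0 xs; have y0 : 0 <= x / (a + b) by rewrite divr_ge0// ltW.
  have y1 : x / (a + b) <= 1 by rewrite ler_pdivrMr// mul1r.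
  have {2}-> : x = x / (a + b) * (a + b) by rewrite -mulrA mulVf ?mulr1.
  rewrite [leRHS]powRM ?(ltW s0)// ler_wpM2r ?powR_ge0//.
  move: y0; rewrite le_eqVlt => /predU1P[<-|y0]; first exact: powR_ge0.
  by rewrite -[leLHS](powRr1 (ltW y0)) ger_powR ?y0.
have -> : (a + b) `^ r = a / (a + b) * (a + b) `^ r + b / (a + b) * (a + b) `^ r.
  by rewrite -!mulrDl mulfV ?mul1r.
by apply: lerD; apply: key; rewrite ?lerDl ?lerDr.
Qed.

(* Young's inequality x^s <= s x + 1 - s with s = 1/r, at the powers of
   2a/(a+b) and 2b/(a+b). *)
Lemma powR_convex (r a b : R) : 1 < r -> 0 <= a -> 0 <= b ->
  (a + b) `^ r <= 2 `^ (r - 1) * (a `^ r + b `^ r).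
Proof.
move=> r1 a0 b0; have r0 : 0 < r by rewrite (lt_trans ltr01).
have [ab0|ab0] := eqVneq (a + b) 0.
  by rewrite ab0 powR0 ?gt_eqF// mulr_ge0 ?addr_ge0 ?powR_ge0.
have s0 : 0 < a + b by rewrite lt_neqAle eq_sym ab0 addr_ge0.
have key (x : R) : 0 <= x -> 2 * x / (a + b) <= r^-1 * (2 * x / (a + b)) `^ r + (1 - r^-1).
  move=> x0; have y0 : 0 <= 2 * x / (a + b) by rewrite divr_ge0 ?mulr_ge0// ltW.
  have := @powR_young R r^-1 ((2 * x / (a + b)) `^ r).
  rewrite invr_gt0 r0 invf_lt1// r1 powR_ge0 => /(_ erefl erefl).
  by rewrite -powRrM mulfV ?gt_eqF// powRr1.
have h1 := key a a0; have h2 := key b b0.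
have h3 : 2 * a / (a + b) + 2 * b / (a + b) = 2.
  by rewrite -mulrDl -mulrDr -mulrA mulfV ?mulr1.
have E (x : R) : 0 <= x -> (2 * x / (a + b)) `^ r = 2 `^ r * x `^ r / (a + b) `^ r.
  move=> x0; rewrite powRM ?mulr_ge0 ?invr_ge0 ?(ltW s0)// powRM//.
  by congr (_ * _); rewrite -(powR_inv1 (ltW s0)) -powRrM mulN1r powRN.
have h4 : 2 <= (2 * a / (a + b)) `^ r + (2 * b / (a + b)) `^ r.
  have ri0 : 0 < r^-1 by rewrite invr_gt0.
  move: h1 h2 h3 ri0; move: (2 * a / (a + b)) (2 * b / (a + b)) (r^-1) => u v s.
  move: (u `^ r) (v `^ r) => U W h1 h2 h3 s0'.
  rewrite -subr_ge0 -(pmulr_rge0 _ s0'); lra.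
have p0 : 0 < (a + b) `^ r by rewrite powR_gt0.
move: h4; rewrite !E// -mulrDl ler_pdivlMr// -mulrDr => h4.
have h5 : 2 `^ r = 2 * 2 `^ (r - 1) :> R by rewrite mulr_powRB1.
by move: h4; rewrite h5 -mulrA ler_pM2l.
Qed.

Lemma sqrt_powR (x p : R) : 0 <= x -> Num.sqrt x `^ p = x `^ (p / 2).
Proof. by move=> x0; rewrite -powR12_sqrt// -powRrM mulrC. Qed.

Lemma sqr_powR (s p : R) : 0 <= s -> (s ^+ 2) `^ (p / 2) = s `^ p.
Proof.
by move=> s0; rewrite -powR_mulrn// -powRrM mulrCA mulfV ?mulr1// pnatr_eq0.
Qed.

Lemma hypot_powR_le2 (p s t : R) : 0 < p <= 2 -> 0 <= s -> 0 <= t ->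
  Num.sqrt (s ^+ 2 + t ^+ 2) `^ p <= s `^ p + t `^ p.
Proof.
move=> /andP[p0 p2] s0 t0; rewrite sqrt_powR ?addr_ge0 ?sqr_ge0//.
rewrite -(sqr_powR p s0) -(sqr_powR p t0).
apply: powR_subadditive; rewrite ?sqr_ge0//.
by rewrite divr_gt0//= ler_pdivrMr// mul1r.
Qed.

(** Convexity of t^(p/2) at the squares; its constant 2^(p/2 - 1) is the 2^((p-2)/2) of the
    theorem. *)
Lemma hypot_powR_ge2 (p s t : R) : 2 < p -> 0 <= s -> 0 <= t ->
  Num.sqrt (s ^+ 2 + t ^+ 2) `^ p <= 2 `^ ((p - 2) / 2) * (s `^ p + t `^ p).
Proof.
move=> p2 s0 t0; rewrite sqrt_powR ?addr_ge0 ?sqr_ge0//.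
rewrite -(sqr_powR p s0) -(sqr_powR p t0).
have -> : (p - 2) / 2 = p / 2 - 1 by rewrite mulrBl mulfV// pnatr_eq0.
apply: powR_convex; rewrite ?sqr_ge0//.
by rewrite ltr_pdivlMr// mul1r.
Qed.

(* Keep the common mass min(w_i, b_i) in place and spread the remaining mass
   proportionally to the deficits b_j - min(w_j, b_j). *)
Lemma exists_transport (n : nat) (w b : nat -> R) :
  (forall i, 0 <= w i) -> (forall i, 0 <= b i) ->
  \sum_(i < n) w i = 1 -> \sum_(i < n) b i = 1 ->
  exists T : nat -> nat -> R, [/\ forall i j, 0 <= T i j,
    forall i, (i < n)%N -> \sum_(j < n) T i j = 1,
    forall j, (j < n)%N -> \sum_(i < n) w i * T i j = b j &
    \sum_(i < n) w i * (1 - T i i) <= \sum_(i < n) `|w i - b i|].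
Proof.
move=> w0 b0 w1 b1.
pose mn i := Num.min (w i) (b i).
have mn0 i : 0 <= mn i by rewrite le_min w0 b0.
pose be i := b i - mn i.
have be0 i : 0 <= be i by rewrite subr_ge0 ge_min lexx orbT.
pose r := \sum_(j < n) be j.
have rE : \sum_(i < n) (w i - mn i) = r.
  by rewrite /r /be !sumrB w1 b1.
(* The fraction of [w i] that stays in place. Its value 1 at [w i = 0] makes every fraction 1 when
   [r = 0], so that the term divided by [r] then vanishes. *)
pose al i := if w i == 0 then 1 else mn i / w i.
have wal i : w i * al i = mn i.
  rewrite /al; case: eqP => [wi|/eqP wi]; last by rewrite mulrCA mulfV// mulr1.
  by rewrite wi mul0r /mn wi min_l.
have al0 i : 0 <= al i by rewrite /al; case: ifP => // _; rewrite divr_ge0.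
have al1 i : al i <= 1.
  rewrite /al; case: eqP => // /eqP wi; have wi0 : 0 < w i by rewrite lt_neqAle eq_sym wi w0.
  by rewrite ler_pdivrMr// mul1r ge_min lexx.
have r0 : 0 <= r by apply: sumr_ge0.
have ralE i : (i < n)%N -> r = 0 -> al i = 1.
  move=> ni rr; have : w i - mn i = 0.
    have h : forall j : 'I_n, true -> 0 <= w j - mn j by move=> j _; rewrite subr_ge0 ge_min lexx.
    have := psumr_eq0P h; rewrite rE => /(_ rr (Ordinal ni)); exact.
  rewrite -wal -{1}(mulr1 (w i)) -mulrBr => /eqP; rewrite mulf_eq0 subr_eq0.
  by rewrite /al; case: (w i == 0) => //= /eqP <-.
have ber0 j : 0 <= be j / r by rewrite divr_ge0.
exists (fun i j => (i == j)%:R * al i + (1 - al i) * (be j / r)); split.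
- by move=> i j; apply: addr_ge0; apply: mulr_ge0; rewrite ?subr_ge0 ?al0 ?al1 ?ber0 ?ler0n.
- move=> i ni; rewrite big_split/= -mulr_sumr -mulr_suml -/r.
  rewrite (bigD1 (Ordinal ni))//= eqxx mul1r big1 ?addr0; last first.
    by move=> j ji; rewrite -val_eqE /= in ji; rewrite eq_sym (negbTE ji) mul0r.
  have [rr|rr] := eqVneq r 0; first by rewrite (ralE i)// subrr mul0r addr0.
  by rewrite mulfV// mulr1 addrC subrK.
- move=> j nj; under eq_bigr do rewrite mulrDr.
  rewrite big_split/= (bigD1 (Ordinal nj))//= eqxx mul1r wal big1 ?addr0; last first.
    by move=> i ij; rewrite -val_eqE /= in ij; rewrite (negbTE ij) mul0r mulr0.
  under eq_bigr do rewrite mulrA mulrBr mulr1 wal.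
  rewrite -mulr_suml rE; have [rr|rr] := eqVneq r 0.
    rewrite rr mul0r addr0; move: (psumr_eq0P (fun (i : 'I_n) (_ : true) => be0 i) rr) => /(_ (Ordinal nj) isT).
    by rewrite /be /= => /eqP; rewrite subr_eq0 => /eqP.
  by rewrite mulrCA mulfV// mulr1 /be addrC subrK.
- apply: ler_sum => i _; rewrite eqxx mul1r.
  apply: (@le_trans _ _ (w i * (1 - al i))).
    by rewrite ler_wpM2l// lerD2l lerN2 lerDl mulr_ge0 ?subr_ge0 ?al1 ?ber0.
  rewrite mulrBr mulr1 wal /mn; case: (leP (w i) (b i)) => h; first by rewrite subrr.
  exact: ler_norm.
Qed.

Lemma limn_esup_le (u : (\bar R)^nat) (c : \bar R) (N : nat) :
  (forall n, (N <= n)%N -> (u n <= c)%E) -> (limn_esup u <= c)%E.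
Proof.
move=> uc; apply: (@le_trans _ _ (ereal_sup (u @` [set n | (N <= n)%N]))).
  apply: ereal_inf_lbound; exists [set n | (N <= n)%N] => //.
  by exists N.
by apply: ge_ereal_sup => _ [n Nn <-]; exact: uc.
Qed.

End power_inequalities.

(** * Image measures, marginals and bounded supports *)

Section image_and_marginals.
Context {R : realType}.
Local Open Scope ereal_scope.

Lemma exists_image_measure d1 d2 (T1 : measurableType d1) (T2 : measurableType d2)
    (m : probability T1 R) (phi : T1 -> T2) : measurable_fun setT phi ->
  exists P : probability T2 R,
    (forall A, measurable A -> P A = m (phi @^-1` A)) /\
    (forall f : T2 -> \bar R, measurable_fun setT f -> (forall y, 0 <= f y) ->
      \int[P]_y f y = \int[m]_x f (phi x)).
Proof.
move=> mphi.
have [||||P PE] := @exists_mixture R _ _ T1 T2 m 1 (fun _ _ => 1%R) (fun _ => phi) => //.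
- by move=> t; rewrite big_ord1.
have PA A : measurable A -> P A = m (phi @^-1` A).
  move=> mA; have mpA : measurable (phi @^-1` A).
    by rewrite -[X in measurable X]setTI; exact: mphi.
  have := PE (\1_A) (measurable_indic mA) (fun y => ler0n _ _).
  rewrite integral_indicE// => ->.
  by rewrite -integral_indicE//; apply: eq_integral => t _; rewrite big_ord1 mul1r.
exists P; split => // f mf f0.
transitivity (\int[pushforward m phi]_y f y).
  by apply: eq_measure_integral => A mA _; exact: PA.
by rewrite ge0_integral_pushforward// => y _.
Qed.

Lemma image_measure_integral d1 d2 (T1 : measurableType d1) (T2 : measurableType d2)
    (m : probability T1 R) (P : probability T2 R) (phi : T1 -> T2) (f : T2 -> \bar R) :
  measurable_fun setT phi -> (forall A, measurable A -> P A = m (phi @^-1` A)) ->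
  measurable_fun setT f -> (forall y, 0 <= f y) ->
  \int[P]_y f y = \int[m]_x f (phi x).
Proof.
move=> mphi PA mf f0; transitivity (\int[pushforward m phi]_y f y).
  by apply: eq_measure_integral => A mA _; exact: PA.
by rewrite ge0_integral_pushforward// => y _.
Qed.

Lemma coupling_integral1 d1 d2 (T1 : measurableType d1) (T2 : measurableType d2)
    (a : probability T1 R) (b : probability T2 R) (g : probability (T1 * T2)%type R)
    (f : T1 -> \bar R) : is_coupling a b g ->
  measurable_fun setT f -> (forall y, 0 <= f y) ->
  \int[g]_z f z.1 = \int[a]_x f x.
Proof.
move=> [ga _] mf f0; apply/esym; apply: (image_measure_integral (phi := fst)) => //.
by move=> A mA; rewrite -ga//; congr (g _); apply/seteqP; split => z //= [].
Qed.

Lemma coupling_integral2 d1 d2 (T1 : measurableType d1) (T2 : measurableType d2)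
    (a : probability T1 R) (b : probability T2 R) (g : probability (T1 * T2)%type R)
    (f : T2 -> \bar R) : is_coupling a b g ->
  measurable_fun setT f -> (forall y, 0 <= f y) ->
  \int[g]_z f z.2 = \int[b]_x f x.
Proof.
move=> [_ gb] mf f0; apply/esym; apply: (image_measure_integral (phi := snd)) => //.
by move=> A mA; rewrite -gb//; congr (g _); apply/seteqP; split => z //= [].
Qed.

End image_and_marginals.

Section bounded_support.
Context {R : realType} {d : nat}.
Local Notation V := 'rV[R]_d.

(** Test on the convex functions max(|x_i| - M, 0): their integral under [nu] vanishes, hence also
    under [mu]. *)
Lemma cvx_le_box (mu nu : probability V R) (M : R) : cvx_le mu nu ->
  nu (~` box M) = 0%E -> mu (~` box M) = 0%E.
Proof.
move=> munu nuM.
have key (i : 'I_d) : mu [set x : V | M < `|x ord0 i|] = 0%E.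
  pose phi (x : V) := Num.max (`|x ord0 i| - M) 0.
  have mphi : measurable_fun setT phi.
    apply: measurable_maxr => //; apply: measurable_funB => //.
    by apply: measurableT_comp => //; exact: measurable_coord.
  have phi0 x : 0 <= phi x by rewrite le_max lexx orbT.
  have cphi : convex_fun phi.
    move=> x y t /andP[t0 t1]; have t1' : 0 <= 1 - t by rewrite subr_ge0.
    have h1 : t * (`|x ord0 i| - M) <= t * phi x by rewrite ler_wpM2l// le_max lexx.
    have h2 : (1 - t) * (`|y ord0 i| - M) <= (1 - t) * phi y by rewrite ler_wpM2l// le_max lexx.
    rewrite {1}/phi ge_max; apply/andP; split; last by rewrite addr_ge0// mulr_ge0.
    rewrite !mxE; apply: le_trans (lerD h1 h2).
    have := ler_normD (t * x ord0 i) ((1 - t) * y ord0 i).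
    by rewrite !normrM (ger0_norm t0) (ger0_norm t1') !mulrBr mulrBl mul1r; lra.
  have : (\int[mu]_x `|(phi x)%:E| = 0)%E.
    apply/eqP; rewrite eq_le; apply/andP; split; last exact: integral_ge0.
    rewrite (eq_integral (fun x => (phi x)%:E)); last by move=> x _; rewrite /= ger0_norm.
    apply: le_trans (munu _ cphi) _; apply: (@le_trans _ _ (\int[nu]_x 0%:E)%E); last by rewrite integral_cst_prob.
    apply: (le_integral_off_null _ nuM) => [|x|x|x]; rewrite ?lee_fin//.
      by apply: measurableC; exact: measurable_box.
    by move=> /contrapT/(_ i) xM; rewrite ge_max lexx andbT subr_le0.
  move=> /ae_eq_integral_abs; have mE : measurable_fun setT (EFin \o phi) by exact/measurable_EFinP.
  move=> /(_ measurableT mE) [B [mB B0 sB]].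
  apply/eqP; rewrite -measure_le0 -B0 le_measure ?inE//; first exact: measurable_coord_gt.
  move=> x /= xM; apply: sB => /= /(_ Logic.I) [] /eqP.
  by rewrite gt_eqF// lt_max subr_gt0 xM.
apply/eqP; rewrite -measure_le0 boxCE.
apply: le_trans (measure_bigsetU_le _ _ _) _; first by move=> i; exact: measurable_coord_gt.
by rewrite big1// => i _; exact: key.
Qed.

Lemma compact_supp_box (nu : probability V R) : compact (supp nu) ->
  exists2 M : R, 0 < M & supp nu `<=` box M.
Proof.
move=> cs; have [B [_ hB]] := compact_bounded cs.
exists (Num.max B 0 + 1); first by rewrite ltr_wpDl// le_max lexx orbT.
move=> x sx i; apply: le_trans (coord_le_norm x i) _.
apply: (hB (Num.max B 0 + 1) _ x sx).
by rewrite ltr_pwDr// le_max lexx.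
Qed.

End bounded_support.

(** * Wasserstein bounds *)

Section mixtures.
Context {R : realType}.
Local Open Scope ereal_scope.

Lemma Wp_powR_le d (T : measurableType d) (dist : T -> T -> R) (q : R)
    (a b : probability T R) (D : probability (T * T)%type R) :
  (0 < q)%R -> is_coupling a b D ->
  Wp dist q a b `^ q <= \int[D]_z (dist z.1 z.2 `^ q)%:E.
Proof.
move=> q0 cD; rewrite /Wp -poweRrM mulVf ?gt_eqF// poweRe1; last first.
  by apply: le_ereal_inf_tmp => _ [D' _ <-]; apply: integral_ge0 => z _; rewrite lee_fin powR_ge0.
by apply: ereal_inf_lbound; exists D.
Qed.

End mixtures.

Section quantized_coupling.
Context {R : realType} {d : nat}.
Local Notation V := 'rV[R]_d.
Variables (mu nu : probability V R) (pi : probability (V * V)%type R).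
Hypothesis cpl : is_coupling mu nu pi.
Variables (Gd : seq V) (P : V -> R -> V) (n : nat) (g : nat -> V) (w : nat -> V -> R).
Hypotheses (mw : forall j, measurable_fun setT (w j)) (w0 : forall j y, 0 <= w j y)
  (w1 : forall y, \sum_(j < n) w j y = 1).
Hypothesis nuS : nu (~` conv Gd) = 0%E.
Hypothesis PB : forall y, conv Gd y -> forall B, measurable B ->
  lebesgue_measure [set u : R | unit_itv u /\ B (P y u)] =
  (\sum_(j < n) w j y * \1_B (g j))%:E.
Hypothesis PF : forall y, conv Gd y -> forall F : V -> R,
  (\int[lebesgue_measure]_(u in unit_itv) (F (P y u))%:E)%E =
  (\sum_(j < n) w j y * F (g j))%:E.

Let mw2 j : measurable_fun setT (fun z : V * V => w j z.2).
Proof. exact: (measurableT_comp (mw j) measurable_snd). Qed.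

Let mSC : measurable (~` conv Gd).
Proof. by apply: measurableC; exact: measurable_conv. Qed.

Let piSC : pi (setT `*` ~` conv Gd) = 0%E.
Proof. by rewrite cpl.2. Qed.

Section law.
Variables (proj : V -> V) (pibar : probability (V * V)%type R).
Hypotheses (mproj : measurable_fun setT proj) (ppb : is_pibar pi proj Gd P pibar).

Let phi j (z : V * V) := (proj z.1, g j).

Let mphi j : measurable_fun setT (phi j).
Proof.
apply/measurable_fun_pairP; split => /=.
- exact: (measurableT_comp mproj measurable_fst).
- exact: measurable_cst.
Qed.

(** The Dirac branch of [qker] is met only for y off the hull, a set that [pi] does not charge; what
    remains is a finite mixture. *)
Lemma pibarE (C : set (V * V)) : measurable C ->
  pibar C = (\int[pi]_z (\sum_(j < n) w j z.2 * \1_C (proj z.1, g j))%:E)%E.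
Proof.
move=> mC; rewrite ppb//; apply: (eq_integral_off_null _ piSC).
- by apply: measurableX.
- by move=> z; rewrite /qker; case: asboolP => _; rewrite ?measure_ge0// lee_fin indicE ler0n.
- by move=> z; rewrite lee_fin; apply: sumr_ge0 => j _; rewrite mulr_ge0// indicE ler0n.
move=> z /= zS; have cz : conv Gd z.2.
  by apply: contrapT => h; apply: zS.
rewrite /qker asboolT// PB//.
by rewrite -[X in measurable X]setTI; apply: (pair1_measurable (proj z.1)).
Qed.

Lemma Wp2_pibar_le (q : R) : 0 < q ->
  (Wp2 q pibar pi `^ q <= \int[pi]_z (\sum_(j < n) w j z.2 *
     Num.sqrt (edist z.1 (proj z.1) ^+ 2 + edist z.2 (g j) ^+ 2) `^ q)%:E)%E.
Proof.
move=> q0; have mphi' j : measurable_fun setT (fun z => (phi j z, z)).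
  by apply/measurable_fun_pairP; split => /=; [exact: mphi | exact: measurable_id].
have [D DE] := exists_mixture pi (W := fun j z => w j z.2) mw2
  (fun j z => w0 j z.2) (fun z => w1 z.2) mphi'.
have cD : is_coupling pibar pi D.
  split => A mA.
    have mA' : measurable (A `*` [set: V * V]) by exact: measurableX.
    rewrite -integral_indicE// (DE _ (measurable_indic mA') (fun y => ler0n _ _)).
    rewrite pibarE//; apply: eq_integral => z _; congr EFin; apply: eq_bigr => j _.
    by rewrite !indicE in_setX in_setT andbT.
  have mA' : measurable ([set: V * V] `*` A) by exact: measurableX.
  rewrite -integral_indicE// (DE _ (measurable_indic mA') (fun y => ler0n _ _)).
  rewrite -integral_indicE//; apply: eq_integral => z _; congr EFin.
  have E j : \1_(setT `*` A) (phi j z, z) = \1_A z :> R.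
    by rewrite !indicE in_setX in_setT.
  by under eq_bigr do rewrite E; rewrite -mulr_suml w1 mul1r.
have m2 : measurable_fun setT (fun y : (V * V) * (V * V) => edist2 y.1 y.2).
  have m11 : measurable_fun setT (fun y : (V * V) * (V * V) => y.1.1).
    exact: (measurableT_comp measurable_fst measurable_fst).
  have m12 : measurable_fun setT (fun y : (V * V) * (V * V) => y.1.2).
    exact: (measurableT_comp measurable_snd measurable_fst).
  have m21 : measurable_fun setT (fun y : (V * V) * (V * V) => y.2.1).
    exact: (measurableT_comp measurable_fst measurable_snd).
  have m22 : measurable_fun setT (fun y : (V * V) * (V * V) => y.2.2).
    exact: (measurableT_comp measurable_snd measurable_snd).
  have ms : measurable_fun setT (fun y : (V * V) * (V * V) =>
      edist y.1.1 y.2.1 ^+ 2 + edist y.1.2 y.2.2 ^+ 2).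
    by apply: measurable_funD; apply: measurable_funX; apply: measurable_edist.
  exact: (measurableT_comp (continuous_measurable_fun (@sqrt_continuous R)) ms).
apply: (le_trans (Wp_powR_le _ q0 cD)).
rewrite (DE (fun y => edist2 y.1 y.2 `^ q)); first last.
- by move=> y; exact: powR_ge0.
- exact: (measurableT_comp (measurable_powR q) m2).
rewrite le_eqVlt; apply/orP; left; apply/eqP; apply: eq_integral => z _.
rewrite /edist2 /=; apply: (f_equal (@EFin R)).
apply: eq_bigr => j _.
by rewrite [edist z.1 _]edistC [edist z.2 _]edistC.
Qed.

End law.

(** The q-th power of the dual error, integrated against [pi] rather than [nu]: in this form it adds
    to the primal cost and disintegrates along the kernel. *)
Definition dual_err (q : R) : \bar R :=
  \int[pi]_z (\sum_(j < n) w j z.2 * edist z.2 (g j) `^ q)%:E.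

Lemma measurable_dual_cost (q : R) : measurable_fun setT
  (fun z : V * V => \sum_(j < n) w j z.2 * edist z.2 (g j) `^ q).
Proof.
apply: measurable_sum => j; apply: measurable_funM => //.
apply: (measurableT_comp (measurable_powR q)); apply: measurable_edist => //.
Qed.

Lemma dual_cost_ge0 (q : R) (y : V) : 0 <= \sum_(j < n) w j y * edist y (g j) `^ q.
Proof. by apply: sumr_ge0 => j _; rewrite mulr_ge0// powR_ge0. Qed.

Lemma dual_err_nu (q : R) :
  (dual_err q = \int[nu]_y (\sum_(j < n) w j y * edist y (g j) `^ q)%:E)%E.
Proof.
rewrite -(coupling_integral2 (f := fun y =>
  (\sum_(j < n) w j y * edist y (g j) `^ q)%:E) cpl)//; last first.
  by move=> y; rewrite lee_fin dual_cost_ge0.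
apply/measurable_EFinP; apply: measurable_sum => j; apply: measurable_funM => //.
by apply: (measurableT_comp (measurable_powR q)); exact: measurable_edist.
Qed.

Lemma opt_dual_quant_err (q : R) (K : nat) :
  opt_dual_quant q K nu Gd P -> dpK q K nu = (dual_err q `^ q^-1)%E.
Proof.
move=> [_ [_ [_ ->]]]; congr (_ `^ _)%E; rewrite dual_err_nu.
apply: (eq_integral_off_null mSC nuS).
- by move=> y; apply: integral_ge0 => u _; rewrite lee_fin powR_ge0.
- by move=> y; rewrite lee_fin dual_cost_ge0.
by move=> y /contrapT cy; rewrite (PF cy (fun x => edist y x `^ q)).
Qed.

Lemma dual_err_ge0 (q : R) : (0 <= dual_err q)%E.
Proof. by apply: integral_ge0 => z _; rewrite lee_fin dual_cost_ge0. Qed.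

Lemma dpK_powR (q : R) (K : nat) : 0 < q ->
  opt_dual_quant q K nu Gd P -> (dpK q K nu `^ q = dual_err q)%E.
Proof.
move=> q0 /opt_dual_quant_err ->.
by rewrite -poweRrM mulVf ?gt_eqF// poweRe1// dual_err_ge0.
Qed.

(** Monotonicity of L^q norms under the joint law of (y, g_j). It lets W_2 be compared with a dual
    quantizer that is optimal at order p. *)
Lemma dual_err_powR_le (p q : R) : 0 < q <= p ->
  (dual_err q <= dual_err p `^ (q / p))%E.
Proof.
move=> /andP[q0 qp]; have p0 := lt_le_trans q0 qp.
have mphi j : measurable_fun setT (fun z : V * V => (z.2, g j)).
  by apply/measurable_fun_pairP; split => /=; [exact: measurable_snd | exact: measurable_cst].
have [D DE] := exists_mixture pi (W := fun j z => w j z.2) mw2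
  (fun j z => w0 j z.2) (fun z => w1 z.2) mphi.
have md r : measurable_fun setT (fun y : V * V => edist y.1 y.2 `^ r).
  by apply: (measurableT_comp (measurable_powR r)); exact: measurable_edist.
rewrite /dual_err -(DE (fun y => edist y.1 y.2 `^ q))//; last by move=> y; exact: powR_ge0.
rewrite -(DE (fun y => edist y.1 y.2 `^ p))//; last by move=> y; exact: powR_ge0.
rewrite (eq_integral (fun y => ((edist y.1 y.2 `^ p) `^ (q / p))%:E)); last first.
  by move=> y _; rewrite -powRrM mulrCA mulfV ?gt_eqF// mulr1.
apply: integral_powR_le => //; last by rewrite divr_gt0//= ler_pdivrMr// mul1r.
by move=> y; exact: powR_ge0.
Qed.

Section bounds.
Variables (N K : nat) (G : seq V) (proj : V -> V) (pibar : probability (V * V)%type R).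
Hypotheses (oG : opt_quantizer N mu G) (pG : nn_proj G proj).
Hypothesis ppb : is_pibar pi proj Gd P pibar.

Let msP (q : R) : measurable_fun setT (fun x => edist x (proj x) `^ q).
Proof. exact: (measurableT_comp (measurable_powR q) (measurable_proj_err pG)). Qed.

(** The constant is a parameter so that one argument serves both regimes: c = 1 for q <= 2, and c =
    2^((q-2)/2) above. *)
Lemma Wp2_pibar_split (q c : R) : 0 < q -> 0 <= c ->
  (forall s t, 0 <= s -> 0 <= t ->
     Num.sqrt (s ^+ 2 + t ^+ 2) `^ q <= c * (s `^ q + t `^ q)) ->
  (Wp2 q pibar pi `^ q <=
   c%:E * (\int[mu]_x (edist x (proj x) `^ q)%:E + dual_err q))%E.
Proof.
move=> q0 c0 hc; apply: (le_trans (Wp2_pibar_le pG.1 ppb q0)).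
rewrite -(coupling_integral1 (f := fun x => (edist x (proj x) `^ q)%:E) cpl); first last.
- by move=> y; rewrite lee_fin powR_ge0.
- by apply/measurable_EFinP.
have m1 : measurable_fun setT (fun z : V * V => (edist z.1 (proj z.1) `^ q)%:E).
  by apply/measurable_EFinP; exact: (measurableT_comp (msP q) measurable_fst).
have m2 : measurable_fun setT (fun z : V * V =>
    (\sum_(j < n) w j z.2 * edist z.2 (g j) `^ q)%:E).
  by apply/measurable_EFinP; exact: measurable_dual_cost.
have h1 z : [set: V * V] z -> (0 <= (edist z.1 (proj z.1) `^ q)%:E)%E.
  by move=> _; rewrite lee_fin powR_ge0.
have h2 z : [set: V * V] z -> (0 <= (\sum_(j < n) w j z.2 * edist z.2 (g j) `^ q)%:E)%E.
  by move=> _; rewrite lee_fin dual_cost_ge0.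
rewrite /dual_err -(ge0_integralD _ _ h1 m1 h2 m2)//.
rewrite -ge0_integralZl//; first last.
- by move=> z _; rewrite adde_ge0 ?h1 ?h2.
- exact: emeasurable_funD.
apply: le_integral_nonneg => z.
  by rewrite lee_fin; apply: sumr_ge0 => j _; rewrite mulr_ge0// powR_ge0.
rewrite -EFinD -EFinM lee_fin.
have -> : c * (edist z.1 (proj z.1) `^ q + \sum_(j < n) w j z.2 * edist z.2 (g j) `^ q)
   = \sum_(j < n) w j z.2 * (c * (edist z.1 (proj z.1) `^ q + edist z.2 (g j) `^ q)).
  rewrite mulrDr mulr_sumr -[X in X + _]mul1r -(w1 z.2) mulr_suml -big_split/=.
  by apply: eq_bigr => j _; rewrite mulrDr mulrDr; congr (_ + _); rewrite mulrCA.
by apply: ler_sum => j _; rewrite ler_wpM2l// hc// edist_nonneg.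
Qed.

Lemma e2N_proj_err : (e2N N mu = (\int[mu]_x (edist x (proj x) ^+ 2)%:E) `^ 2^-1)%E.
Proof. by rewrite /e2N -oG.2 (nn_proj_err mu pG). Qed.

(** For the primal term, Jensen at the exponent p/2 <= 1, applied to the squared distance, brings in
    the quadratic error. *)
Lemma Wp2_pibar_le2 (p : R) : 0 < p <= 2 -> opt_dual_quant p K nu Gd P ->
  (Wp2 p pibar pi `^ p <= e2N N mu `^ p + dpK p K nu `^ p)%E.
Proof.
move=> /andP[p0 p2] od; rewrite (dpK_powR p0 od) e2N_proj_err -poweRrM.
have h s t : 0 <= s -> 0 <= t ->
    Num.sqrt (s ^+ 2 + t ^+ 2) `^ p <= 1 * (s `^ p + t `^ p).
  by move=> s0 t0; rewrite mul1r; apply: hypot_powR_le2 => //; rewrite p0.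
apply: (le_trans (Wp2_pibar_split p0 ler01 h)); rewrite mul1e leeD2r//.
rewrite (eq_integral (fun x => ((edist x (proj x) ^+ 2) `^ (p / 2))%:E)); last first.
  by move=> x _; rewrite sqr_powR// edist_nonneg.
rewrite mulrC.
have r1 : 0 < 2^-1 * p <= 1 by rewrite mulrC divr_gt0//= ler_pdivrMr// mul1r.
apply: integral_powR_le => //.
- by apply: measurable_funX; exact: measurable_proj_err pG.
- by move=> x; exact: sqr_ge0.
Qed.

Lemma Wp2_pibar_ge2 (p C : R) : 2 < p -> opt_dual_quant p K nu Gd P ->
  (\int[mu]_x (edist x (proj x) `^ p)%:E <= C%:E)%E ->
  (Wp2 p pibar pi `^ p <=
   (2 `^ ((p - 2) / 2) * C)%:E + (2 `^ ((p - 2) / 2))%:E * dpK p K nu `^ p)%E.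
Proof.
move=> p2 od hC; have p0 : 0 < p by rewrite (lt_trans _ p2).
rewrite (dpK_powR p0 od).
apply: (le_trans (Wp2_pibar_split p0 (powR_ge0 _ _)
  (fun s t s0 t0 => hypot_powR_ge2 p2 s0 t0))).
rewrite ge0_muleDr ?dual_err_ge0//; last first.
  by apply: integral_ge0 => x _; rewrite lee_fin powR_ge0.
by rewrite leeD2r// EFinM lee_pmul2l// ?lte_fin ?powR_gt0.
Qed.

Lemma Wp2_pibar_order2 (p : R) : 2 <= p -> opt_dual_quant p K nu Gd P ->
  (Wp2 2 pibar pi `^ 2 <= e2N N mu `^ 2 + dpK p K nu `^ 2)%E.
Proof.
move=> p2 od; have p0 : 0 < p by rewrite (lt_le_trans _ p2).
have h s t : 0 <= s -> 0 <= t ->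
    Num.sqrt (s ^+ 2 + t ^+ 2) `^ 2 <= 1 * (s `^ 2 + t `^ 2) :> R.
  by move=> s0 t0; rewrite mul1r; apply: hypot_powR_le2 => //; rewrite ltr0n lexx.
apply: (le_trans (Wp2_pibar_split (ltr0n _ 2) ler01 h)).
rewrite mul1e (opt_dual_quant_err od) e2N_proj_err -!poweRrM mulVf ?pnatr_eq0//.
rewrite poweRe1; last first.
  by apply: integral_ge0 => x _; rewrite lee_fin sqr_ge0.
apply: leeD; last by rewrite mulrC dual_err_powR_le// ltr0n.
by apply: le_integral_nonneg => x; rewrite lee_fin ?powR_ge0// powR_mulrn// edist_nonneg.
Qed.

End bounds.
End quantized_coupling.

(** * The martingale coupling *)

Section finite_support.
Context {R : realType} d (T : measurableType d).

Lemma exists_finite_probability (n : nat) (c : nat -> R) (x : nat -> T) :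
  (forall j, 0 <= c j) -> \sum_(j < n) c j = 1 ->
  exists P : probability T R, forall f : T -> R, measurable_fun setT f ->
    (forall y, 0 <= f y) -> (\int[P]_y (f y)%:E = (\sum_(j < n) c j * f (x j))%:E)%E.
Proof.
move=> c0 c1.
have [P PE] := exists_mixture (\d_tt : probability unit R) (W := fun j _ => c j)
  (phi := fun j _ => x j) (fun j => measurable_cst _) (fun j _ => c0 j)
  (fun _ => c1) (fun j => measurable_cst _).
by exists P => f mf f0; rewrite PE// integral_cst_prob.
Qed.

Variables (n : nat) (c : nat -> R) (x : nat -> T) (P : probability T R).
Hypothesis PE : forall f : T -> R, measurable_fun setT f -> (forall y, 0 <= f y) ->
  (\int[P]_y (f y)%:E = (\sum_(j < n) c j * f (x j))%:E)%E.

Lemma finite_probabilityE (A : set T) : measurable A ->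
  P A = (\sum_(j < n) c j * \1_A (x j))%:E.
Proof.
move=> mA; rewrite -integral_indicE//.
exact: (PE (measurable_indic mA) (fun y => ler0n _ _)).
Qed.

Lemma finite_probability_integrable (f : T -> R) : measurable_fun setT f ->
  P.-integrable setT (EFin \o f).
Proof.
move=> mf; apply/integrableP; split; first exact/measurable_EFinP.
under eq_integral do rewrite /=.
by rewrite (PE (f := fun y => `|f y|)) ?ltry//; exact: measurableT_comp.
Qed.

Lemma finite_probability_integral (f : T -> R) : measurable_fun setT f ->
  (\int[P]_y (f y)%:E = (\sum_(j < n) c j * f (x j))%:E)%E.
Proof.
move=> mf; have fi := finite_probability_integrable mf.
have ai := integrable_abs_R fi.
have ma : measurable_fun setT (fun y => `|f y|) by exact: measurableT_comp.
(* A signed [f] is the difference of the nonnegative functions f + |f| and |f|. *)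
rewrite (eq_integral (fun y => (f y + `|f y|)%:E - `|f y|%:E)%E); last first.
  by move=> y _; rewrite -EFinB addrK.
rewrite (integralB measurableT (integrableD_R fi ai) ai).
rewrite (PE (f := fun y => f y + `|f y|)); first last.
- by move=> y; rewrite -lerBlDl sub0r -normrN ler_norm.
- exact: measurable_funD.
rewrite (PE (f := fun y => `|f y|))// -EFinB -sumrB; congr EFin.
by apply: eq_bigr => j _; rewrite -mulrBr addrK.
Qed.

End finite_support.

Lemma integral_eq0_ae {R : realType} d (T : measurableType d) (m : probability T R)
    (f : T -> \bar R) : measurable_fun setT f -> (forall x, (0 <= f x)%E) ->
  (\int[m]_x f x = 0)%E -> {ae m, forall x, f x = 0%E}.
Proof.
move=> mf f0 If; have : (\int[m]_x `|f x| = 0)%E.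
  by rewrite -If; apply: eq_integral => x _; rewrite gee0_abs.
by move=> /(ae_eq_integral_abs _ measurableT mf); apply: filterS => x /(_ Logic.I).
Qed.

Section conditional_weights.
Context {R : realType} {d : nat}.
Local Notation V := 'rV[R]_d.
Variables (mu nu : probability V R) (pi : probability (V * V)%type R) (M : R).
Hypotheses (d0 : (0 < d)%N) (M0 : 0 < M) (muM : mu (~` box M) = 0%E).
Hypothesis cpl : is_coupling mu nu pi.
Variables (k : V -> probability V R) (Gd : seq V) (P : V -> R -> V).
Hypotheses (kpi : disintegrates mu k pi)
  (kb : {ae mu, forall x, barycenter_is (k x) x}).
Variables (n : nat) (g : nat -> V) (w : nat -> V -> R).
Hypotheses (mw : forall j, measurable_fun setT (w j)) (w0 : forall j y, 0 <= w j y)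
  (w1 : forall y, \sum_(j < n) w j y = 1).
Hypothesis nuS : nu (~` conv Gd) = 0%E.
Hypothesis gw : forall y, conv Gd y ->
  forall i, \sum_(j < n) w j y * (g j) ord0 i = y ord0 i.
Hypothesis PB : forall y, conv Gd y -> forall B, measurable B ->
  lebesgue_measure [set u : R | unit_itv u /\ B (P y u)] =
  (\sum_(j < n) w j y * \1_B (g j))%:E.
Local Notation integ f := (mu.-integrable setT (EFin \o f)).

(** The conditional expectation of w_j(Y) given X = x, for (X, Y) of law [pi]. *)
Definition wbar j x : R := fine (\int[k x]_y (w j y)%:E)%E.

Lemma weight_le1 j y : (j < n)%N -> w j y <= 1.
Proof.
move=> jn; rewrite -(w1 y) (bigD1 (Ordinal jn))//= lerDl.
by apply: sumr_ge0 => i _; exact: w0.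
Qed.

Lemma weight_integrable (m : probability V R) j : (j < n)%N ->
  m.-integrable setT (EFin \o w j).
Proof.
move=> jn; apply: (integrable_bounded m (B := 1)) => // y.
by rewrite ger0_norm// weight_le1.
Qed.

Lemma wbar_ge0 j x : 0 <= wbar j x.
Proof. by apply: fine_ge0; apply: integral_ge0 => y _; rewrite lee_fin. Qed.

Lemma wbar_sum (c : nat -> R) x :
  (\int[k x]_y (\sum_(j < n) w j y * c j)%:E = (\sum_(j < n) wbar j x * c j)%:E)%E.
Proof.
have wi (j : 'I_n) : (k x).-integrable setT (EFin \o (fun y => c j * w j y)).
  by apply: integrableZ_R; exact: weight_integrable.
under eq_integral do under eq_bigr do rewrite mulrC.
rewrite integral_Rintegral; last by apply: integrable_sumR.
rewrite Rintegral_sum//; congr EFin; apply: eq_bigr => j _.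
by rewrite RintegralZl//; [rewrite mulrC|exact: weight_integrable].
Qed.

Lemma wbar_sum1 x : \sum_(j < n) wbar j x = 1.
Proof.
apply: EFin_inj; rewrite -(integral_cst_prob (k x) 1).
transitivity (\sum_(j < n) wbar j x * 1)%:E.
  by under [in RHS]eq_bigr do rewrite mulr1.
rewrite -(wbar_sum (fun=> 1)); apply: eq_integral => y _.
by under eq_bigr do rewrite mulr1; rewrite w1.
Qed.

Lemma wbar_01 j x : (j < n)%N -> 0 <= wbar j x <= 1.
Proof.
move=> jn; rewrite wbar_ge0/= -(wbar_sum1 x) (bigD1 (Ordinal jn))//= lerDl.
by apply: sumr_ge0 => i _; exact: wbar_ge0.
Qed.

Lemma measurable_wbar j : measurable_fun setT (wbar j).
Proof.
apply: (measurableT_comp (f := fine)); first exact: fine_measurable.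
apply: (disintegrates_measurable kpi (f := fun z => (w j z.2)%:E)).
  by apply/measurable_EFinP; exact: (measurableT_comp (mw j) measurable_snd).
by move=> z; rewrite lee_fin.
Qed.

Lemma wbar_integrable j : (j < n)%N -> integ (wbar j).
Proof.
move=> jn; apply: (integrable_bounded mu (B := 1)); first exact: measurable_wbar.
by move=> x; have /andP[h0 h1] := wbar_01 x jn; rewrite ger0_norm.
Qed.

Lemma kernel_conv_ae : {ae mu, forall x, k x (~` conv Gd) = 0%E}.
Proof.
have mS : measurable (~` conv Gd) by apply: measurableC; exact: measurable_conv.
apply: integral_eq0_ae => //; first exact: kpi.1.
by rewrite -kpi.2// cpl.2.
Qed.

(* Where the kernel k_x has barycentre x and lives on conv Gd, averaging the
   barycentre identity of the splitting weights against k_x returns x. *)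
Lemma wbar_barycenter_ae (i : 'I_d) :
  {ae mu, forall x, \sum_(j < n) wbar j x * (g j) ord0 i = x ord0 i}.
Proof.
have mS : measurable (~` conv Gd) by apply: measurableC; exact: measurable_conv.
apply: filterS (filterI kb kernel_conv_ae) => x [bx cx].
apply: EFin_inj; rewrite -(wbar_sum (fun j => (g j) ord0 i)) -(bx i).2.
apply: ae_eq_integral => //.
- apply/measurable_EFinP; apply: measurable_sum => j.
  exact: measurable_funM.
- by apply/measurable_EFinP; exact: measurable_coord.
exists (~` conv Gd); split => // y /= yS cy; apply: yS => _.
by rewrite gw.
Qed.

Section quantizer.
Variables (N : nat) (G : seq V) (proj : V -> V).
Hypotheses (oG : opt_quantizer N mu G) (pG : nn_proj G proj) (N0 : (0 < N)%N).
Local Notation E x := (proj @^-1` [set x]).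

(* On mu-null cells any probability weights would do. *)
Definition cell_weight j x0 : R :=
  if fine (mu (E x0)) == 0 then (j == 0)%:R
  else \int[mu]_x (\1_(E x0) x * wbar j x) / fine (mu (E x0)).

Let mE x0 : measurable (E x0). Proof. exact: measurable_proj1 pG x0. Qed.

Let muE0 x0 : 0 <= fine (mu (E x0)). Proof. exact: fine_ge0. Qed.

Lemma cell_weight_ge0 j x0 : 0 <= cell_weight j x0.
Proof.
rewrite /cell_weight; case: ifP => _; rewrite ?ler0n// divr_ge0//.
by apply: Rintegral_ge0 => x _; rewrite mulr_ge0 ?wbar_ge0// indicE ler0n.
Qed.

(** On a null cell the right side vanishes too, since 0 <= [wbar] <= 1, so the convention made there
    does no harm. *)
Lemma cell_weightE j x0 : (j < n)%N ->
  cell_weight j x0 * fine (mu (E x0)) = \int[mu]_x (\1_(E x0) x * wbar j x).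
Proof.
move=> jn; rewrite /cell_weight; case: eqP => [m0|/eqP m0]; last first.
  by rewrite -mulrA mulVf ?mulr1.
rewrite m0 mulr0; apply/eqP; rewrite eq_sym eq_le; apply/andP; split; last first.
  by apply: Rintegral_ge0 => x _; rewrite mulr_ge0 ?wbar_ge0// indicE ler0n.
rewrite -m0 -Rintegral_indic//; apply: le_Rintegral => //.
- by apply: integrable_indicM => //; exact: wbar_integrable.
- by apply: (integrable_bounded mu (B := 1)) => // x; rewrite indicE; case: (_ \in _);
  rewrite ?normr1 ?normr0 ?lexx.
by move=> x _; have /andP[h0 h1] := wbar_01 x jn; rewrite ler_piMr// indicE ler0n.
Qed.

Lemma cell_weight_sum1 x0 : \sum_(j < n) cell_weight j x0 = 1.
Proof.
rewrite /cell_weight; case: eqP => [_|/eqP m0].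
  case: n w1 => [|n'] w1'; first by have := w1' 0; rewrite big_ord0 => /esym/eqP; rewrite oner_eq0.
  by rewrite big_ord_recl/= big1 ?addr0.
rewrite -mulr_suml -Rintegral_sum; last first.
  by move=> j; apply: integrable_indicM => //; exact: wbar_integrable.
rewrite -[RHS](mulfV m0) -(Rintegral_indic mu (mE x0)); congr (fine _ / _).
by apply: eq_integral => x _; rewrite -mulr_sumr wbar_sum1 mulr1.
Qed.

(** Off the finite set [G] the cell is empty and the default weight applies: the function differs
    from a constant at finitely many points only. *)
Lemma measurable_cell_weight j : measurable_fun setT (cell_weight j).
Proof.
have -> : cell_weight j = (fun x0 => (j == 0)%:R + \sum_(a <- undup G)
    \1_[set a] x0 * (cell_weight j a - (j == 0)%:R)).
  apply/funext => x0; have [xG|xG] := boolP (x0 \in G).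
    rewrite (bigD1_seq x0) ?mem_undup ?undup_uniq//= indicE in_set1 eqxx mul1r big1 ?addr0.
      by rewrite addrC subrK.
    by move=> a ax; rewrite indicE in_set1 eq_sym (negbTE ax) mul0r.
  rewrite big1_seq ?addr0; last first.
    move=> a /=; rewrite mem_undup => aG; rewrite indicE in_set1.
    by case: eqP => [xa|]; rewrite ?mul0r//; move: xG; rewrite xa aG.
  rewrite /cell_weight (_ : E x0 = set0) ?measure0 ?eqxx//.
  by apply/seteqP; split => // x /= px; move: xG; rewrite -px (pG.2 x).1.
apply: measurable_funD => //; apply: measurable_sum => a; apply: measurable_funM => //.
by apply: measurable_indic; exact: measurable_set1_rV.
Qed.

Let cellE a x (F : V -> R) : \1_(E a) x * F (proj x) = \1_(E a) x * F a.
Proof.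
rewrite indicE; case: (boolP (x \in E a)) => [|_]; last by rewrite !mul0r.
by rewrite inE /= => ->.
Qed.

(** The tower property: [cell_weight j (proj x)] is the conditional expectation of [wbar j] given
    the cell, tested on functions of the cell. *)
Lemma cell_average (c : nat -> V -> R) :
  \int[mu]_x (\sum_(j < n) wbar j x * c j (proj x)) =
  \int[mu]_x (\sum_(j < n) cell_weight j (proj x) * c j (proj x)).
Proof.
have i1 (j : 'I_n) : integ (fun x => wbar j x * c j (proj x)).
  rewrite (_ : (fun x => _) = (fun x => \sum_(a <- undup G) \1_(E a) x * (c j a * wbar j x))).
    apply: integrable_sumR => a; apply: integrable_indicM => //.
    by apply: integrableZ_R; exact: wbar_integrable.
  apply/funext => x; rewrite (indic_proj_sum pG x (c j)) mulr_sumr.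
  by apply: eq_bigr => a _; rewrite mulrC mulrA.
have i2 (j : 'I_n) : integ (fun x => cell_weight j (proj x) * c j (proj x)).
  exact: (integrable_proj_comp mu pG (fun y => cell_weight j y * c j y)).
rewrite !Rintegral_sum//; apply: eq_bigr => j _.
rewrite (Rintegral_cells pG (i1 j)) (Rintegral_cells pG (i2 j)).
apply: eq_bigr => a _.
transitivity (c j a * \int[mu]_x (\1_(E a) x * wbar j x)).
  rewrite -RintegralZl//; last by apply: integrable_indicM => //; exact: wbar_integrable.
  congr fine; apply: eq_integral => x _; congr EFin.
  by rewrite [wbar j x * _]mulrC mulrA cellE -mulrA mulrCA.
rewrite -cell_weightE// mulrA -(Rintegral_indic mu (mE a)) -RintegralZl//; last first.
  by apply: (integrable_bounded mu (B := 1)) => // x; rewrite indicE; case: (_ \in _);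
  rewrite ?normr1 ?normr0 ?lexx.
congr fine; apply: eq_integral => x _; congr EFin.
by rewrite (cellE a x (fun y => cell_weight j y * c j y)) mulrC [c j a * _]mulrC.
Qed.

Lemma exists_cell_kernel : exists k1 : V -> probability V R,
  forall x0 (f : V -> R), measurable_fun setT f -> (forall y, 0 <= f y) ->
  (\int[k1 x0]_y (f y)%:E = (\sum_(j < n) cell_weight j x0 * f (g j))%:E)%E.
Proof.
have h x0 := exists_finite_probability g (fun j => cell_weight_ge0 j x0) (cell_weight_sum1 x0).
by have [k1 hk1] := choice h; exists k1.
Qed.

Variables (pibar : probability (V * V)%type R) (muhat : probability V R).
Hypotheses (ppb : is_pibar pi proj Gd P pibar) (imu : is_image_measure mu proj muhat).
Variable k1 : V -> probability V R.
Hypothesis k1E : forall x0 (f : V -> R), measurable_fun setT f -> (forall y, 0 <= f y) ->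
  (\int[k1 x0]_y (f y)%:E = (\sum_(j < n) cell_weight j x0 * f (g j))%:E)%E.

(** Integrating the mixture along the kernels of [pi] produces [wbar]; the tower property replaces
    it by cell weights, which depend on the projection alone and so pass to [muhat]. *)
Lemma pibar_rectangle (A B : set V) : measurable A -> measurable B ->
  pibar (A `*` B) = (\int[muhat]_(x0 in A) k1 x0 B)%E.
Proof.
move=> mA mB.
have k1B x0 := finite_probabilityE (c := cell_weight^~ x0) (k1E x0) mB.
rewrite integral_mkcond.
rewrite (eq_integral (fun x0 =>
    (\sum_(j < n) cell_weight j x0 * (\1_A x0 * \1_B (g j)))%:E)); last first.
  move=> x0 _; rewrite /patch k1B indicE; case: (x0 \in A) => /=.
    by under [in RHS]eq_bigr do rewrite mul1r.
  by rewrite big1// => j _; rewrite mul0r mulr0.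
rewrite (image_measure_integral pG.1 imu); first last.
- move=> y; rewrite lee_fin; apply: sumr_ge0 => j _.
  by rewrite mulr_ge0 ?cell_weight_ge0// mulr_ge0// indicE ler0n.
- apply/measurable_EFinP; apply: measurable_sum => j; apply: measurable_funM.
    exact: measurable_cell_weight.
  by apply: measurable_funM.
rewrite (pibarE cpl w0 nuS PB ppb); last exact: measurableX.
pose f (z : V * V) := (\sum_(j < n) w j z.2 * (\1_A (proj z.1) * \1_B (g j)))%:E.
transitivity (\int[pi]_z f z)%E.
  apply: eq_integral => z _; congr EFin; apply: eq_bigr => j _.
  by rewrite !indicE in_setX -natrM mulnb.
rewrite (disintegrates_integral kpi); first last.
- move=> z; rewrite lee_fin; apply: sumr_ge0 => j _.
  by rewrite mulr_ge0// mulr_ge0// indicE ler0n.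
- apply/measurable_EFinP; apply: measurable_sum => j; apply: measurable_funM.
    exact: (measurableT_comp (mw j) measurable_snd).
  apply: measurable_funM => //; apply: (measurableT_comp (measurable_indic mA)).
  exact: (measurableT_comp pG.1 measurable_fst).
under eq_integral do rewrite /f /= (wbar_sum (fun j => \1_A (proj _) * \1_B (g j))).
have cA := cell_average (fun j x0 => \1_A x0 * \1_B (g j)).
rewrite !integral_Rintegral; first by rewrite cA.
- exact: (integrable_proj_comp mu pG
    (fun y => \sum_(j < n) cell_weight j y * (\1_A y * \1_B (g j)))).
apply: integrable_sumR => j.
rewrite (_ : (fun x => _) = (fun x => \1_(proj @^-1` A) x * (\1_B (g j) * wbar j x))).
  apply: integrable_indicM; first by rewrite -[X in measurable X]setTI; exact: pG.1.
  by apply: integrableZ_R; exact: wbar_integrable.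
by apply/funext => x; rewrite mulrA mulrC.
Qed.

Lemma pibar_disintegrates : disintegrates muhat k1 pibar.
Proof.
split; last exact: pibar_rectangle.
move=> B mB; have k1B x0 := finite_probabilityE (c := cell_weight^~ x0) (k1E x0) mB.
rewrite (_ : (fun x0 => k1 x0 B) = (fun x0 =>
  (\sum_(j < n) cell_weight j x0 * \1_B (g j))%:E)); last exact/funext.
apply/measurable_EFinP; apply: measurable_sum => j; apply: measurable_funM => //.
exact: measurable_cell_weight.
Qed.

(** Average over the cell: the martingale property of [pi] turns the weighted mean of the g_j into
    x, and stationarity turns the mean of x into x0. *)
Lemma cell_weight_barycenter (x0 : V) (i : 'I_d) : fine (mu (E x0)) != 0 ->
  \sum_(j < n) cell_weight j x0 * (g j) ord0 i = x0 ord0 i.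
Proof.
move=> m0; apply: (mulIf m0); rewrite mulr_suml.
transitivity (\int[mu]_x (\1_(E x0) x * \sum_(j < n) wbar j x * (g j) ord0 i)).
  under [in RHS]eq_Rintegral do rewrite mulr_sumr.
  rewrite Rintegral_sum; last first.
    move=> j; apply: integrable_indicM => //.
    rewrite (_ : (fun x => _) = (fun x => (g j) ord0 i * wbar j x)).
      by apply: integrableZ_R; exact: wbar_integrable.
    by apply/funext => x; rewrite mulrC.
  apply: eq_bigr => j _; rewrite mulrAC cell_weightE// mulrC -RintegralZl//.
    by apply: eq_Rintegral => x _; rewrite mulrC -mulrA.
  by apply: integrable_indicM => //; exact: wbar_integrable.
have ci : integ (fun x => x ord0 i).
  apply: (integrable_box muM (B := M)); first exact: measurable_coord.
  by move=> x; exact.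
transitivity (\int[mu]_x (\1_(E x0) x * x ord0 i)).
  congr fine; apply: ae_eq_integral => //.
  - apply/measurable_EFinP; apply: measurable_funM => //; apply: measurable_sum => j.
    by apply: measurable_funM => //; exact: measurable_wbar.
  - by apply/measurable_EFinP; apply: measurable_funM => //; exact: measurable_coord.
  by apply: filterS (wbar_barycenter_ae i) => x hx _; rewrite hx.
have := opt_stationary M0 muM d0 oG pG N0 x0 i.
have i1 : integ (\1_(E x0)).
  apply: (integrable_bounded mu (B := 1)); first exact: measurable_indic.
  by move=> x; rewrite indicE; case: (_ \in _); rewrite ?normr1 ?normr0.
under eq_Rintegral do rewrite mulrBr [_ * x0 ord0 i]mulrC.
rewrite RintegralB//; [|exact: integrable_indicM|exact: integrableZ_R].
by rewrite RintegralZl// Rintegral_indic// => /eqP; rewrite subr_eq0 => /eqP.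
Qed.

Lemma pibar_barycenter : {ae muhat, forall x, barycenter_is (k1 x) x}.
Proof.
pose s := [seq a <- G | fine (mu (E a)) != 0].
(* All points except the quantizer points with a charged cell; its mass under [muhat] is carried by
   finitely many null cells. *)
exists (~` [set` s]); split.
- by apply: measurableC; exact: measurable_mem_seq.
- have mS : measurable (~` [set` s]) by apply: measurableC; exact: measurable_mem_seq.
  rewrite imu//; apply/eqP; rewrite -measure_le0.
  apply: (@le_trans _ _ (mu (\big[setU/set0]_(a <- [seq a <- G | fine (mu (E a)) == 0]) E a))).
    apply: le_measure; rewrite ?inE.
    + by rewrite -[X in measurable X]setTI; exact: pG.1.
    + by apply: bigsetU_measurable => a _.
    move=> x /= /negP xs; rewrite -bigcup_seq; exists (proj x) => //=.
    by move: xs; rewrite !mem_filter (pG.2 x).1 !andbT negbK.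
  apply: (le_trans (measure_bigsetU_le _ _ _)); first by move=> a.
  rewrite big_seq big1// => a; rewrite mem_filter => /andP[/eqP ma _].
  by have h := fineK (fin_num_measure mu _ (mE a)); rewrite ma in h; rewrite -[LHS]h.
move=> x0 /= h; apply: contrapT => /= /contrapT; rewrite mem_filter => /andP[m0 _].
apply: h => i; split.
  by apply: (finite_probability_integrable (c := cell_weight^~ x0) (k1E x0)); exact: measurable_coord.
rewrite (finite_probability_integral (c := cell_weight^~ x0) (k1E x0)); last exact: measurable_coord.
by rewrite cell_weight_barycenter.
Qed.

Lemma pibar_mart_coupling (nucheck : probability V R) :
  is_split_law nu P nucheck -> mart_coupling muhat nucheck pibar.
Proof.
move=> snu; split; last first.
  by exists k1; split; [exact: pibar_disintegrates | exact: pibar_barycenter].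
have mS : measurable (~` conv Gd) by apply: measurableC; exact: measurable_conv.
split => [A mA|B mB].
  rewrite (pibarE cpl w0 nuS PB ppb); last exact: measurableX.
  rewrite imu// -cpl.1; last by rewrite -[X in measurable X]setTI; exact: pG.1.
  rewrite -integral_indicE; last first.
    by apply: measurableX => //; rewrite -[X in measurable X]setTI; exact: pG.1.
  apply: eq_integral => z _; congr EFin.
  have h j : \1_(A `*` setT) (proj z.1, g j) = \1_(proj @^-1` A `*` setT) z :> R.
    by rewrite !indicE !in_setX !in_setT !andbT.
  by under eq_bigr do rewrite h; rewrite -mulr_suml w1 mul1r.
rewrite (pibarE cpl w0 nuS PB ppb); last exact: measurableX.
rewrite snu//; transitivity (\int[nu]_y (\sum_(j < n) w j y * \1_B (g j))%:E)%E.
  rewrite -(coupling_integral2 cpl (f := fun y => (\sum_(j < n) w j y * \1_B (g j))%:E)).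
  - apply: eq_integral => z _; congr EFin; apply: eq_bigr => j _.
    by rewrite !indicE in_setX in_setT.
  - by apply/measurable_EFinP; apply: measurable_sum => j; exact: measurable_funM.
  - by move=> y; rewrite lee_fin; apply: sumr_ge0 => j _; rewrite mulr_ge0// indicE ler0n.
apply: (eq_integral_off_null mS nuS).
- by move=> y; rewrite lee_fin; apply: sumr_ge0 => j _; rewrite mulr_ge0// indicE ler0n.
- by move=> y; exact: measure_ge0.
by move=> y /contrapT cy; rewrite PB.
Qed.

(** From y choose g_i with probability w_i(y), then move on to g_j with probability T i j. Mass that
    stays at g_i pays no more than the dual cost, mass that moves pays at most [D]. Composing the
    moves, instead of applying a triangle inequality to p-th powers, keeps the constant 1 before the
    dual cost. *)
Lemma Wp1_cell_kernel_le (p D : R) (x0 x : V) : 0 < p -> 0 <= D ->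
  (forall y j, conv Gd y -> (j < n)%N -> edist y (g j) `^ p <= D) ->
  k x (~` conv Gd) = 0%E ->
  (Wp1 p (k1 x0) (k x) `^ p <=
   \int[k x]_y (\sum_(j < n) w j y * edist y (g j) `^ p)%:E +
   (D * \sum_(j < n) `|wbar j x - cell_weight j x0|)%:E)%E.
Proof.
move=> p0 D0 hD kx.
have [T [T0 Trow Tcol Tdiag]] := exists_transport (wbar_ge0^~ x)
  (cell_weight_ge0^~ x0) (wbar_sum1 x) (cell_weight_sum1 x0).
have T1 (i : 'I_n) : 0 <= 1 - T i i.
  by rewrite subr_ge0 -(Trow i)// (bigD1 i)//= lerDl sumr_ge0.
pose W j y := \sum_(i < n) w i y * T i j.
have mW j : measurable_fun setT (W j).
  by apply: measurable_sum => i; apply: measurable_funM.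
have W0 j y : 0 <= W j y by apply: sumr_ge0 => i _; rewrite mulr_ge0.
have WE (c : nat -> R) y : \sum_(j < n) W j y * c j =
    \sum_(i < n) w i y * \sum_(j < n) T i j * c j.
  under eq_bigr do rewrite mulr_suml; rewrite exchange_big /=.
  by apply: eq_bigr => i _; rewrite mulr_sumr; apply: eq_bigr => j _; rewrite mulrA.
have W1 y : \sum_(j < n) W j y = 1.
  rewrite -(w1 y) exchange_big /=; apply: eq_bigr => i _.
  by rewrite -mulr_sumr Trow// mulr1.
have mphi j : measurable_fun setT (fun y : V => (g j, y)).
  by apply/measurable_fun_pairP; split => /=; [exact: measurable_cst | exact: measurable_id].
have [C CE] := exists_mixture (k x) mW W0 W1 mphi.
have cC : is_coupling (k1 x0) (k x) C.
  split => A mA.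
    have mA' : measurable (A `*` [set: V]) by exact: measurableX.
    rewrite -integral_indicE// (CE _ (measurable_indic mA') (fun y => ler0n _ _)).
    rewrite (finite_probabilityE (c := cell_weight^~ x0) (k1E x0) mA).
    transitivity (\int[k x]_y (\sum_(i < n) w i y * \sum_(j < n) T i j * \1_A (g j))%:E)%E.
      apply: eq_integral => y _; rewrite -(WE (fun j => \1_A (g j))); congr EFin; apply: eq_bigr => j _.
      by rewrite !indicE in_setX in_setT andbT.
    rewrite (wbar_sum (fun i => \sum_(j < n) T i j * \1_A (g j))); congr EFin.
    under eq_bigr do rewrite mulr_sumr; rewrite exchange_big /=.
    apply: eq_bigr => j _; rewrite -(Tcol j)// mulr_suml.
    by apply: eq_bigr => i _; rewrite mulrA.
  have mA' : measurable ([set: V] `*` A) by exact: measurableX.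
  rewrite -integral_indicE// (CE _ (measurable_indic mA') (fun y => ler0n _ _)).
  rewrite -integral_indicE//; apply: eq_integral => y _; congr EFin.
  have h j : \1_(setT `*` A) (g j, y) = \1_A y :> R by rewrite !indicE in_setX in_setT.
  by under eq_bigr do rewrite h; rewrite -mulr_suml W1 mul1r.
apply: (le_trans (Wp_powR_le _ p0 cC)).
have md : measurable_fun setT (fun z : V * V => edist z.1 z.2 `^ p).
  by apply: (measurableT_comp (measurable_powR p)); exact: measurable_edist.
rewrite (CE _ md (fun z => powR_ge0 _ _)).
have mS : measurable (~` conv Gd) by apply: measurableC; exact: measurable_conv.
have c0 y : 0 <= \sum_(j < n) w j y * edist y (g j) `^ p.
  by apply: sumr_ge0 => j _; rewrite mulr_ge0 ?powR_ge0.
have e0 y : 0 <= \sum_(i < n) w i y * (D * (1 - T i i)).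
  by apply: sumr_ge0 => i _; rewrite mulr_ge0 ?mulr_ge0.
apply: (@le_trans _ _ (\int[k x]_y ((\sum_(j < n) w j y * edist y (g j) `^ p)%:E +
    (\sum_(i < n) w i y * (D * (1 - T i i)))%:E))%E).
  apply: (le_integral_off_null mS kx).
  - by move=> y; rewrite lee_fin; apply: sumr_ge0 => j _; rewrite mulr_ge0 ?powR_ge0.
  - by move=> y; rewrite adde_ge0 ?lee_fin.
  move=> y /contrapT cy; rewrite -EFinD lee_fin.
  rewrite (WE (fun j => edist (g j) y `^ p)) -big_split /=; apply: ler_sum => i _.
  rewrite -mulrDr ler_wpM2l// (bigD1 i)//= [edist (g i) _]edistC; apply: lerD.
    by rewrite ler_piMl ?powR_ge0// -subr_ge0.
  have <- : \sum_(j < n | j != i) T i j = 1 - T i i.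
    by apply/eqP; rewrite eq_sym subr_eq -(Trow i)// (bigD1 i)//= addrC.
  rewrite mulr_sumr; apply: ler_sum => j _; rewrite mulrC ler_wpM2r//.
  by rewrite edistC hD.
rewrite ge0_integralD//; first last.
- by apply/measurable_EFinP; apply: measurable_sum => i; exact: measurable_funM.
- by move=> y _; rewrite lee_fin.
- apply/measurable_EFinP; apply: measurable_sum => j; apply: measurable_funM => //.
  by apply: (measurableT_comp (measurable_powR p)); exact: measurable_edist.
- by move=> y _; rewrite lee_fin.
rewrite leeD2l// (wbar_sum (fun i => D * (1 - T i i))) lee_fin.
rewrite (le_trans _ (ler_wpM2l D0 Tdiag))// mulr_sumr.
by apply: ler_sum => i _; rewrite mulrCA.
Qed.

(* D dominates the transport cost of the mass on which the two kernels differ. *)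
Lemma AWp_pibar_le (p D e1 e2 : R) : 0 < p -> 0 <= D ->
  (forall y j, conv Gd y -> (j < n)%N -> edist y (g j) `^ p <= D) ->
  (\int[mu]_x (edist x (proj x) `^ p)%:E <= e1%:E)%E ->
  (forall j, (j < n)%N -> \int[mu]_x `|wbar j x - cell_weight j (proj x)| <= e2) ->
  (AWp p pibar pi <=
   (e1%:E + (dual_err pi n g w p + (D * (n%:R * e2))%:E)) `^ p^-1)%E.
Proof.
move=> p0 D0 hD h1 h2.
have mpr : measurable_fun setT (fun x => (proj x, x)).
  by apply/measurable_fun_pairP; split => /=; [exact: pG.1 | exact: measurable_id].
have [m [mE' mI]] := exists_image_measure mu mpr.
have cm : is_coupling muhat mu m.
  split => A mA.
    rewrite mE'; last exact: measurableX.
    by rewrite imu//; congr (mu _); apply/seteqP; split => x //= [].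
  rewrite mE'; last exact: measurableX.
  by congr (mu _); apply/seteqP; split => x //= [].
pose v := (\int[m]_z ((edist z.1 z.2 `^ p)%:E + Wp1 p (k1 z.1) (k z.2) `^ p))%E.
pose S := [set v | exists (mu1 mu2 : probability V R)
       (k1 k2 : V -> probability V R) (m : probability (V * V)%type R),
       disintegrates mu1 k1 pibar /\ disintegrates mu2 k2 pi /\
       is_coupling mu1 mu2 m /\
       v = (\int[m]_z (((edist z.1 z.2) `^ p)%:E + Wp1 p (k1 z.1) (k2 z.2) `^ p))%E].
have S0 : (0 <= ereal_inf S)%E.
  apply: le_ereal_inf_tmp => _ [mu1 [mu2 [l1 [l2 [m' [_ [_ [_ ->]]]]]]]].
  by apply: integral_ge0 => z _; rewrite adde_ge0 ?poweR_ge0// lee_fin powR_ge0.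
have Sv : (ereal_inf S <= v)%E.
  by apply: ereal_inf_lbound; exists muhat, mu, k1, k, m; split; first exact: pibar_disintegrates.
suff hv : (v <= e1%:E + (dual_err pi n g w p + (D * (n%:R * e2))%:E))%E.
  have hS := le_trans Sv hv.
  apply: gt0_ler_poweR; rewrite ?invr_ge0 ?(ltW p0)// in_itv/= ?leey ?andbT//.
  exact: le_trans hS.
pose DC x := (\int[k x]_y (\sum_(j < n) w j y * edist y (g j) `^ p)%:E)%E.
have mDC : measurable_fun setT DC.
  apply: (disintegrates_measurable kpi (f := fun z =>
    (\sum_(j < n) w j z.2 * edist z.2 (g j) `^ p)%:E)).
    by apply/measurable_EFinP; exact: measurable_dual_cost.
  by move=> z; rewrite lee_fin dual_cost_ge0.
have DC0 x : (0 <= DC x)%E by apply: integral_ge0 => y _; rewrite lee_fin dual_cost_ge0.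
pose L (z : V * V) := D * \sum_(j < n) `|wbar j z.2 - cell_weight j z.1|.
have L0 z : 0 <= L z by rewrite mulr_ge0// sumr_ge0.
have mL : measurable_fun setT L.
  apply: measurable_funM => //; apply: measurable_sum => j.
  apply: measurableT_comp => //; apply: measurable_funB.
    exact: (measurableT_comp (measurable_wbar j) measurable_snd).
  exact: (measurableT_comp (measurable_cell_weight j) measurable_fst).
have [B [mB B0 sB]] := kernel_conv_ae.
have mTB : measurable ([set: V] `*` B) by exact: measurableX.
have m0 : m ([set: V] `*` B) = 0%E by rewrite cm.2.
have md : measurable_fun setT (fun z : V * V => edist z.1 z.2 `^ p).
  by apply: (measurableT_comp (measurable_powR p)); exact: measurable_edist.
have mF : measurable_fun setT (fun z : V * V =>
    (edist z.1 z.2 `^ p)%:E + (DC z.2 + (L z)%:E))%E.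
  apply: emeasurable_funD; first exact/measurable_EFinP.
  apply: emeasurable_funD; last exact/measurable_EFinP.
  exact: (measurableT_comp mDC measurable_snd).
have F0 (z : V * V) : (0 <= (edist z.1 z.2 `^ p)%:E + (DC z.2 + (L z)%:E))%E.
  by apply: adde_ge0; [rewrite lee_fin powR_ge0 | apply: adde_ge0; rewrite ?lee_fin].
apply: (@le_trans _ _ (\int[m]_z ((edist z.1 z.2 `^ p)%:E + (DC z.2 + (L z)%:E)))%E).
  (* The kernel bound holds where [k z.2] lives on the hull, that is, off a set of second components
     that [mu] does not charge. *)
  apply: (le_integral_off_null mTB m0) => // z.
    by rewrite adde_ge0 ?poweR_ge0// lee_fin powR_ge0.
  move=> zB; rewrite leeD2l//; apply: Wp1_cell_kernel_le => //.
  by apply: contrapT => hz; apply: zB; split => //; exact: sB.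
rewrite mI//.
have i1 : measurable_fun setT (fun x => (edist x (proj x) `^ p)%:E).
  by apply/measurable_EFinP; exact: (measurableT_comp (measurable_powR p) (measurable_proj_err pG)).
have i2 : measurable_fun setT (fun x => (L (proj x, x))%:E).
  by apply/measurable_EFinP; exact: (measurableT_comp mL mpr).
under eq_integral do rewrite /= edistC.
rewrite ge0_integralD//; first last.
- by apply: emeasurable_funD.
- by move=> x _; rewrite adde_ge0// lee_fin.
- by move=> x _; rewrite lee_fin powR_ge0.
apply: leeD => //; rewrite ge0_integralD//; last by move=> x _; rewrite lee_fin.
apply: leeD.
  rewrite /dual_err (disintegrates_integral kpi)//.
    by apply/measurable_EFinP; exact: measurable_dual_cost.
  by move=> z; rewrite lee_fin dual_cost_ge0.
have ij (j : 'I_n) : integ (fun x => `|wbar j x - cell_weight j (proj x)|).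
  apply/integrable_abs_R/integrableN_R; first exact: wbar_integrable.
  exact: (integrable_proj_comp mu pG (cell_weight j)).
rewrite integral_Rintegral; last first.
  by apply: integrableZ_R; exact: (integrable_sumR _ ij).
rewrite lee_fin RintegralZl//; last exact: (integrable_sumR _ ij).
rewrite ler_wpM2l// Rintegral_sum// (le_trans (ler_sum _ (fun (j : 'I_n) _ => h2 j (ltn_ord j))))//.
by rewrite sumr_const card_ord mulr_natl.
Qed.

End quantizer.

(** * Convergence in the adapted distance *)

Lemma cell_weight_cvg (e : R) (l : nat) : 0 < e -> (l <= n)%N ->
  exists2 eta, 0 < eta & forall N G proj, (0 < N)%N ->
    opt_quantizer N mu G -> nn_proj G proj ->
    \int[mu]_x (edist x (proj x) ^+ 2) <= eta ->
    forall j, (j < l)%N -> \int[mu]_x `|wbar j x - cell_weight proj j (proj x)| <= e.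
Proof.
move=> e0; elim: l => [_|l IH ln]; first by exists 1.
have [eta1 eta10 h1] := IH (ltnW ln).
have [eta2 eta20 h2] := cond_exp_cvg M0 muM d0 (measurable_wbar l) (fun x => wbar_01 x ln) e0.
(* The weights are finite in number and are treated one at a time; the minimum of the thresholds
   serves them all. *)
exists (Num.min eta1 eta2); first by rewrite lt_min eta10.
move=> N G proj N0 oG pG; rewrite le_min => /andP[he1 he2] j.
rewrite ltnS leq_eqVlt => /predU1P[->|jl]; last exact: (h1 N G proj).
apply: (h2 N G proj (cell_weight proj l) N0 oG pG he2) => a _.
exact: (cell_weightE pG a ln).
Qed.

Lemma exists_mesh_le (e : R) : 0 < e -> exists2 m, (0 < m)%N & mesh d M m <= e.
Proof.
move=> e0; pose m := (Num.truncn (mesh d M 1 / e)).+1.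
have m1 : mesh d M 1 / e < m%:R by exact: truncnS_gt.
exists m => //; have mm : 0 < m%:R :> R by rewrite ltr0n.
have h : mesh d M 1 <= m%:R * e by rewrite -ler_pdivrMr// ltW.
move: h; rewrite (mesh_scale M (ltn0Sn _ : (0 < m)%N)) expr2 -mulrA ler_pM2l//.
apply: le_trans; rewrite ler_peMl// ?ler1n// ltW// mesh_gt0//.
Qed.

(** All p >= 1 at once: in the box the distance is uniformly bounded, so its p-th power is at most
    [D] times the distance, and the mean distance is at most the square root of the distortion. *)
Lemma proj_err_powR_le (p e : R) : 1 <= p -> 0 < e -> exists2 m, (0 < m)%N &
  forall N G proj, (0 < N)%N -> (m ^ d <= N)%N ->
    opt_quantizer N mu G -> nn_proj G proj ->
    \int[mu]_x (edist x (proj x) ^+ 2) <= e /\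
    (\int[mu]_x (edist x (proj x) `^ p)%:E <= e%:E)%E.
Proof.
move=> p1 e0; have p0 : 0 < p := lt_le_trans ltr01 p1.
pose D := (6 * mesh d M 1) `^ ((p - 1) / 2).
have D1 : 0 < D + 1 by rewrite ltr_wpDl ?powR_ge0.
pose e2 := Num.min e ((e / (D + 1)) ^+ 2).
have e20 : 0 < e2 by rewrite lt_min e0 exprn_gt0// divr_gt0.
have [m m0 hm] := exists_mesh_le e20.
exists m => // N G proj N0 mN oG pG.
have I2 := opt_err_mesh M0 muM oG pG m0 mN.
have i2 : integ (fun x => edist x (proj x) ^+ 2) := integrable_proj_err M0 muM d0 oG pG N0.
split.
  by rewrite -lee_fin -integral_Rintegral// (le_trans I2)// lee_fin (le_trans hm)// ge_min lexx.
have me := measurable_proj_err pG.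
have I1 : (\int[mu]_x (edist x (proj x))%:E <= (e / (D + 1))%:E)%E.
  rewrite (eq_integral (fun x => ((edist x (proj x) ^+ 2) `^ (1 / 2))%:E)); last first.
    by move=> x _; rewrite sqr_powR ?edist_nonneg// powRr1// edist_nonneg.
  apply: (@le_trans _ _ ((\int[mu]_x (edist x (proj x) ^+ 2)%:E) `^ (1 / 2))%E).
    apply: integral_powR_le; first exact: measurable_funX.
      by move=> x; exact: sqr_ge0.
    by rewrite divr_gt0//= ler_pdivrMr// mul1r ler1n.
  have q0 : 0 <= e / (D + 1) by rewrite divr_ge0// ltW.
  rewrite -(powRr1 q0) -(sqr_powR 1 q0) -poweR_EFin.
  apply: gt0_ler_poweR; rewrite ?in_itv/= ?leey ?andbT//.
  - by apply: integral_ge0 => x _; rewrite lee_fin sqr_ge0.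
  - by rewrite lee_fin sqr_ge0.
  by rewrite (le_trans I2)// lee_fin (le_trans hm)// ge_min lexx orbT.
apply: (@le_trans _ _ (\int[mu]_x (D%:E * (edist x (proj x))%:E))%E).
  apply: (le_integral_off_null _ muM) => [|x|x|x].
  - by apply: measurableC; exact: measurable_box.
  - by rewrite lee_fin powR_ge0.
  - by rewrite mule_ge0// lee_fin ?powR_ge0// edist_nonneg.
  move=> /contrapT bx; rewrite -EFinM lee_fin -(mulr_powRB1 (edist_nonneg _ _) p0) mulrC.
  rewrite ler_wpM2r ?edist_nonneg// -(sqr_powR (p - 1)) ?edist_nonneg//.
  apply: ge0_ler_powR; rewrite ?nnegrE ?sqr_ge0//.
  - by rewrite divr_ge0// subr_ge0.
  - by rewrite mulr_ge0// ltW// mesh_gt0.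
  exact: (opt_dist_bounded M0 muM d0 oG pG N0 bx).
rewrite ge0_integralZl//; first last.
- by rewrite lee_fin powR_ge0.
- by move=> x _; rewrite lee_fin edist_nonneg.
- exact/measurable_EFinP.
apply: (le_trans (lee_wpmul2l _ I1)); first by rewrite lee_fin powR_ge0.
rewrite -EFinM lee_fin mulrCA ler_piMr ?(ltW e0)// ler_pdivrMr// mul1r lerDl.
exact: ler01.
Qed.

Hypothesis gG : forall j, (j < n)%N -> g j \in Gd.

Lemma mem_conv (s : seq V) (a : V) : a \in s -> conv s a.
Proof.
move=> /(nthP 0)[i si <-]; exists (fun j => (j == Ordinal si)%:R); split.
  by move=> j; exact: ler0n.
split.
  by rewrite (bigD1 (Ordinal si))//= eqxx big1 ?addr0// => j /negbTE ->.
rewrite (bigD1 (Ordinal si))//= eqxx scale1r big1 ?addr0// => j /negbTE ->.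
by rewrite scale0r.
Qed.

(** Both y and the g_j lie in the hull, which is compact. *)
Lemma dual_cost_bounded (p : R) : 0 < p -> exists2 D, 0 <= D &
  forall y j, conv Gd y -> (j < n)%N -> edist y (g j) `^ p <= D.
Proof.
move=> p0; have [B [_ hB]] := compact_bounded (conv_compact (s := Gd)).
pose A := Num.max B 0 + 1.
have bA y : conv Gd y -> box A y.
  move=> cy i; apply: le_trans (coord_le_norm y i) _; apply: hB cy.
  by rewrite /A ltr_pwDr// le_max lexx.
exists ((d%:R * (2 * A) ^+ 2) `^ (p / 2)); first exact: powR_ge0.
move=> y j cy jn; rewrite -sqr_powR ?edist_nonneg//.
have h : edist y (g j) ^+ 2 <= d%:R * (2 * A) ^+ 2.
  by apply: edist_box; apply: bA => //; apply: mem_conv; exact: gG.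
apply: ge0_ler_powR; rewrite ?nnegrE ?sqr_ge0//; first by rewrite divr_ge0// ltW.
exact: le_trans (sqr_ge0 _) h.
Qed.

Lemma AWp_pibar_eventually (p e : R) : 1 <= p -> 0 < e ->
  exists2 N1, (0 < N1)%N & forall N G proj pibar, (N1 <= N)%N ->
    opt_quantizer N mu G -> nn_proj G proj -> is_pibar pi proj Gd P pibar ->
    (AWp p pibar pi <= (dual_err pi n g w p + e%:E) `^ p^-1)%E.
Proof.
move=> p1 e0; have p0 : 0 < p := lt_le_trans ltr01 p1.
have [D D0 hD] := dual_cost_bounded p0.
(* Half of [e] pays for the primal error; the n weight errors, multiplied by [D], share the other
   half. The added 1 keeps the denominator positive. *)
pose e2 := e / 2 / (D * n%:R + 1).
have Dn : 0 <= D * n%:R by rewrite mulr_ge0.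
have e20 : 0 < e2 by rewrite !divr_gt0// ltr_wpDl.
have [eta eta0 heta] := cell_weight_cvg e20 (leqnn n).
have e30 : 0 < Num.min eta (e / 2) by rewrite lt_min eta0 divr_gt0.
have [m m0 hm] := proj_err_powR_le p1 e30.
exists (m ^ d)%N; first by rewrite expn_gt0 m0.
move=> N G proj pibar mN oG pG ppb.
have N0 : (0 < N)%N by rewrite (leq_trans _ mN)// expn_gt0 m0.
have [he1 he2] := hm N G proj N0 mN oG pG.
have [muhat [imu _]] := exists_image_measure mu pG.1.
have [k1 k1E] := exists_cell_kernel pG.
have hb : \int[mu]_x (edist x (proj x) ^+ 2) <= eta by rewrite (le_trans he1)// ge_min lexx.
have he3 : (\int[mu]_x (edist x (proj x) `^ p)%:E <= (e / 2)%:E)%E.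
  by rewrite (le_trans he2)// lee_fin ge_min lexx orbT.
apply: (le_trans (AWp_pibar_le pG ppb imu k1E p0 D0 hD he3 (heta N G proj N0 oG pG hb))).
have DE0 : (0 <= dual_err pi n g w p)%E by exact: dual_err_ge0.
have h4 : D * (n%:R * e2) <= e / 2.
  rewrite mulrA /e2 mulrCA ler_piMr ?divr_ge0 ?(ltW e0)//.
  by rewrite ler_pdivrMr ?ltr_wpDl// mul1r lerDl.
have q0 : 0 <= D * (n%:R * e2) by rewrite mulr_ge0// mulr_ge0// ltW.
apply: gt0_ler_poweR; rewrite ?in_itv/= ?leey ?andbT ?invr_ge0 ?(ltW p0)//.
- by apply: adde_ge0; [rewrite lee_fin divr_ge0// ltW | exact: adde_ge0].
- by apply: adde_ge0 => //; rewrite lee_fin ltW.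
by rewrite addeCA leeD2l// -EFinD lee_fin [leRHS](splitr e) lerD2l.
Qed.

End conditional_weights.

(** * Support of the second marginal and conclusion *)

Section splitting_of_support.
Context {R : realType} {d : nat}.
Local Notation V := 'rV[R]_d.
Variable nu : probability V R.
Hypothesis cs : compact (supp nu).

Lemma compact_supp_full (A : set V) : measurable A -> supp nu `<=` A -> nu (~` A) = 0%E.
Proof.
move=> mA sA; have ms := compact_measurable_rV cs.
apply/eqP; rewrite -measure_le0 -(supp_full ms) le_measure ?inE//.
- exact: measurableC.
- exact: measurableC.
by move=> x /= xA xs; apply: xA; exact: sA.
Qed.

Lemma conv_nil : conv (Nil V) = set0.
Proof.
apply/seteqP; split => // y [w [_ [/eqP + _]]] /=.
by rewrite big_ord0 eq_sym oner_eq0.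
Qed.

Lemma dual_quant_weights (p : R) (K : nat) (Gd : seq V) (P : V -> R -> V) :
  opt_dual_quant p K nu Gd P ->
  nu (~` conv Gd) = 0%E /\
  exists (n : nat) (g : nat -> V) (w : nat -> V -> R),
  [/\ forall j, measurable_fun setT (w j), forall j y, 0 <= w j y,
      forall y, \sum_(j < n) w j y = 1,
      forall j, (j < n)%N -> g j \in Gd &
   forall y, conv Gd y ->
   [/\ forall i, \sum_(j < n) w j y * (g j) ord0 i = y ord0 i,
    forall B, measurable B ->
     lebesgue_measure [set u : R | unit_itv u /\ B (P y u)] =
     (\sum_(j < n) w j y * \1_B (g j))%:E &
    forall F : V -> R, (\int[lebesgue_measure]_(u in unit_itv) (F (P y u))%:E)%E =
     (\sum_(j < n) w j y * F (g j))%:E]].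
Proof.
move=> [_ [sG [sP _]]]; have nuS := compact_supp_full (measurable_conv Gd) sG.
split=> //; apply: splitting_weights => //.
(* An empty [Gd] has an empty hull, which would leave [nu] without mass. *)
apply/negP => /eqP G0; move: nuS; rewrite G0 conv_nil setC0 probability_setT.
by move/eqP; rewrite onee_eq0.
Qed.

End splitting_of_support.

Lemma poweR_eventually_le {R : realType} (p : R) (Q : \bar R) (u : (\bar R)^nat) :
  0 < p -> (0 <= Q)%E ->
  (forall e, 0 < e -> exists N, forall n, (N <= n)%N -> (u n <= (Q + e%:E) `^ p^-1)%E) ->
  (limn_esup u <= Q `^ p^-1)%E.
Proof.
move=> p0; case: Q => [q| |]//; rewrite ?lee_fin => q0 hu; last first.
  by rewrite poweRyr ?leey// invr_eq0 gt_eqF.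
(* [e'] is chosen so that the p-th root of q + e' is exactly q^(1/p) + e. *)
apply/lee_addgt0Pr => e e0; pose e' := (q `^ p^-1 + e) `^ p - q.
have e'0 : 0 < e'.
  rewrite subr_gt0 -{1}(powRr1 q0) -{1}(mulVf (lt0r_neq0 p0)) powRrM.
  by apply: gt0_ltr_powR => //; rewrite ?nnegrE ?powR_ge0 ?addr_ge0 ?powR_ge0 ?(ltW e0)// ltrDl.
have [N hN] := hu e' e'0; apply: (limn_esup_le (N := N)) => l Nl.
apply: (le_trans (hN l Nl)); have -> : (q%:E + e'%:E)%E = ((q `^ p^-1 + e) `^ p)%:E.
  by rewrite /e' -EFinD addrC subrK.
rewrite !poweR_EFin -powRrM.
by rewrite mulfV ?gt_eqF// powRr1// addr_ge0 ?powR_ge0 ?ltW.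
Qed.

Theorem theorem3 (R : realType) (d : nat) (p : R)
  (mu nu : probability 'rV[R]_d R)
  (pi : probability ('rV[R]_d * 'rV[R]_d)%type R) :
  (0 < d)%N -> 1 <= p ->
  cvx_le mu nu -> compact (supp nu) ->
  mart_coupling mu nu pi ->
  exists C : R,
    (forall (N K : nat) (G : seq 'rV[R]_d) (proj : 'rV[R]_d -> 'rV[R]_d)
        (Gd : seq 'rV[R]_d) (P : 'rV[R]_d -> R -> 'rV[R]_d)
        (muhat nucheck : probability 'rV[R]_d R)
        (pibar : probability ('rV[R]_d * 'rV[R]_d)%type R),
      (1 <= N)%N -> (d.+1 <= K)%N ->
      opt_quantizer N mu G -> nn_proj G proj ->
      opt_dual_quant p K nu Gd P ->
      is_image_measure mu proj muhat ->
      is_split_law nu P nucheck ->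
      is_pibar pi proj Gd P pibar ->
      [/\ mart_coupling muhat nucheck pibar,
          p <= 2 ->
            (Wp2 p pibar pi `^ p <= e2N N mu `^ p + dpK p K nu `^ p)%E,
          2 < p < 2 + d%:R ->
            (Wp2 p pibar pi `^ p <=
               (C * N%:R `^ (- p / d%:R))%:E
               + (2 `^ ((p - 2) / 2))%:E * dpK p K nu `^ p)%E
        & 2 <= p ->
            (Wp2 2 pibar pi `^ 2 <= e2N N mu `^ 2 + dpK p K nu `^ 2)%E]) /\
    (forall (K : nat) (Gd : seq 'rV[R]_d) (P : 'rV[R]_d -> R -> 'rV[R]_d)
        (G : nat -> seq 'rV[R]_d) (proj : nat -> 'rV[R]_d -> 'rV[R]_d)
        (pibar : nat -> probability ('rV[R]_d * 'rV[R]_d)%type R),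
      (d.+1 <= K)%N ->
      opt_dual_quant p K nu Gd P ->
      (forall N : nat, (1 <= N)%N ->
         [/\ opt_quantizer N mu (G N), nn_proj (G N) (proj N)
           & is_pibar pi (proj N) Gd P (pibar N)]) ->
      (limn_esup (fun N => AWp p (pibar N) pi) <= dpK p K nu)%E).
Proof.
move=> d0 p1 munu cs [cpl [k [kpi kb]]].
have p0 : 0 < p := lt_le_trans ltr01 p1.
have [M M0 sM] := compact_supp_box cs.
have nuM := compact_supp_full cs (measurable_box M) sM.
have muM := cvx_le_box munu nuM.
(* The constant is fixed before N, the quantizer and its projection; outside the range of p nothing
   is claimed and 0 serves. *)
have [C hC] : exists C : R, 2 < p < 2 + d%:R -> forall N G proj, (0 < N)%N ->
    opt_quantizer N mu G -> nn_proj G proj ->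
    (\int[mu]_x (edist x (proj x) `^ p)%:E <= (C * N%:R `^ (- p / d%:R))%:E)%E.
  have [h|h] := boolP (2 < p < 2 + d%:R); last by exists 0.
  by have [C hC] := distortion_mismatch M0 muM d0 h; exists C.
(* The factor 2^((p-2)/2) multiplies both errors; its primal copy is absorbed into the constant. *)
exists (2 `^ ((p - 2) / 2) * C); split.
  move=> N K G proj Gd P muhat nucheck pibar N0 _ oG pG od imu snu ppb.
  have [nuS [n [g [w [mw w0 w1 gG wP]]]]] := dual_quant_weights cs od.
  have gw y (cy : conv Gd y) : forall i, \sum_(j < n) w j y * (g j) ord0 i = y ord0 i.
    by case: (wP y cy).
  have PB y (cy : conv Gd y) : forall B, measurable B ->
      lebesgue_measure [set u : R | unit_itv u /\ B (P y u)] =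
      (\sum_(j < n) w j y * \1_B (g j))%:E.
    by case: (wP y cy).
  have PF y (cy : conv Gd y) : forall F : 'rV[R]_d -> R,
      (\int[lebesgue_measure]_(u in unit_itv) (F (P y u))%:E)%E =
      (\sum_(j < n) w j y * F (g j))%:E.
    by case: (wP y cy).
  split.
  - have [k1 k1E] := exists_cell_kernel kpi g mw w0 w1 pG.
    by apply: (pibar_mart_coupling d0 M0 muM cpl kpi kb mw w0 w1 nuS gw PB oG pG N0 ppb imu k1E).
  - move=> p2; apply: (Wp2_pibar_le2 cpl mw w0 w1 nuS PB PF oG pG ppb _ od).
    by rewrite p0.
  - move=> p2; have /andP[p2' _] := p2; rewrite -mulrA.
    exact: (Wp2_pibar_ge2 cpl mw w0 w1 nuS PB PF pG ppb p2' od (hC p2 N G proj N0 oG pG)).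
  - by move=> p2; exact: (Wp2_pibar_order2 cpl mw w0 w1 nuS PB PF oG pG ppb p2 od).
move=> K Gd P G proj pibar _ od hN.
have [nuS [n [g [w [mw w0 w1 gG wP]]]]] := dual_quant_weights cs od.
have gw y (cy : conv Gd y) : forall i, \sum_(j < n) w j y * (g j) ord0 i = y ord0 i.
  by case: (wP y cy).
have PB y (cy : conv Gd y) : forall B, measurable B ->
    lebesgue_measure [set u : R | unit_itv u /\ B (P y u)] =
    (\sum_(j < n) w j y * \1_B (g j))%:E.
  by case: (wP y cy).
have PF y (cy : conv Gd y) : forall F : 'rV[R]_d -> R,
    (\int[lebesgue_measure]_(u in unit_itv) (F (P y u))%:E)%E =
    (\sum_(j < n) w j y * F (g j))%:E.
  by case: (wP y cy).
rewrite (opt_dual_quant_err cpl mw w0 nuS PF od).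
apply: poweR_eventually_le => //; first exact: dual_err_ge0.
move=> e e0.
have [N1 N10 h1] := AWp_pibar_eventually d0 M0 muM cpl kpi mw w0 w1 nuS PB gG p1 e0.
exists N1 => N NN; have [oG pG ppb] := hN N (leq_trans N10 NN).
exact: h1 NN oG pG ppb.
Qed.
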